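(* Let assumptions (i)–(iv) of the context hold with the linear-quadratic cost $$C(u_0,u_1)=\int_0^{\bar s}[\beta_1(s)u_1^2(s)+q_1(s)u_1(s)]\,ds+\beta_0u_0^2+q_0u_0,$$ where $\beta_0\in\mathbb R$, $\beta_1\in L^\infty(0,\bar s)$, $\beta_0,\beta_1(s)\ge\epsilon>0$, $q_0\ge0$, $q_1\in L^2(0,\bar s)$. Define $$w_1(s)=\frac{\bar\alpha(0)}{2\beta_0}e^{-\mu s}+\int_0^se^{-\mu(s-\sigma)}\frac{\bar\alpha(\sigma)}{2\beta_1(\sigma)}d\sigma,\qquad w_2(s)=\frac{q_0}{2\beta_0}e^{-\mu s}+\int_0^se^{-\mu(s-\sigma)}\frac{q_1(\sigma)}{2\beta_1(\sigma)}d\sigma,$$ $$c_1=\int_0^{\bar s}\alpha(s)w_1(s)\,ds,\qquad c_2=\int_0^{\bar s}\alpha(s)w_2(s)\,ds .$$ Then $(\bar x,\bar\zeta,\bar u)$, $\bar u=(\bar u_0,\bar u_1)$, is an MP-equilibrium point if and only if there is a solution $\eta\in\mathbb R$ of $$\eta=R'(\eta c_1-c_2)$$ such that $\bar x(s)=-w_2(s)+\eta w_1(s)$, and moreover $$\bar\zeta(s)=R'(\langle\alpha,\bar x\rangle)\bar\alpha(s),\qquad \bar u_0=\frac{\bar\zeta(0)-q_0}{2\beta_0},\qquad \bar u_1(s)=\frac{\bar\zeta(s)-q_1(s)}{2\beta_1(s)} .$$ The constant control $\bar u$ is optimal at $\bar x$, $\bar x$ is also a CLE-equilibrium point and, if $V_0$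 is Fréchet differentiable, then $\bar x$ is also the unique CLE-equilibrium point.
   Context: Model (optimal investment with vintage capital). $\bar s\in[0,+\infty]$ is the maximal age, $\mu>0$ a depreciation factor, $\lambda\in\mathbb R$ the discount rate, with $\lambda>-\mu$. State equation: $\partial_\tau K(\tau,s)+\partial_sK(\tau,s)+\mu K(\tau,s)=u_1(\tau,s)$, $K(\tau,0)=u_0(\tau)$, $K(t,s)=x(s)$, for $\tau>t$, $s\in(0,\bar s]$, with controls $u=(u_0,u_1)\in L^p_\lambda(t,+\infty;U)$, $U=\mathbb R\times L^2(0,\bar s)$, i.e. $\tau\mapsto e^{-\lambda\tau/p}u(\tau)\in L^p(t,+\infty;U)$ (here $p=2$). Payoff to maximize (no sign constraint on $K$): $I(t,x;u)=\int_t^{+\infty}e^{-\lambda\tau}[R(\langle\alpha,K(\tau)\rangle)-C(u(\tau))]\,d\tau$, where $\langle\alpha,x\rangle=\int_0^{\bar s}\alpha(s)x(s)\,ds$ and $C(u_0,u_1)=C_0(u_0)+\int_0^{\bar s}c_1(s,u_1(s))\,ds$ (in this context $c_1(\cdot,\cdot)$ is the running cost density, not to be confused with the number $c_1$ in the claim). Put $\bar\alpha(s)=\int_s^{\bar s}e^{-(\mu+\lambda)(\sigma-s)}\alpha(\sigma)\,d\sigma$. $f^*$ denotes the convex conjugate. A control is optimal at $x$ if it maximizes $I(0,x;\cdot)$. Assumptions: (i) $R\in C^1(\mathbb R)$ concave, $R'$ Lipschitz; $\alpha\in H^1(0,\bar s)$, $\alpha(\bar s)=0$. (ii) $C_0$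 and $r\mapsto c_1(s,r)$ convex, lower semicontinuous, with injective subdifferential (subdifferentials at distinct points are disjoint). (iii) $C_0^*$ and $r\mapsto c_1(s,\cdot)^*(r)$ differentiable with Lipschitz derivatives, for all $s$. (iv) $C_0(r)$ and $c_1(s,r)$ bounded below by $a|r|^p+b$, some $a>0$, $b\in\mathbb R$, $p>1$. Value function. Let $V=\{f\in H^1(0,\bar s):f(\bar s)=0\}$ and $V'$ its dual, with pivot space $L^2(0,\bar s)$ ($V\subset L^2\subset V'$). The state equation is extended to initial data $x\in V'$ as the mild equation $K'=AK+Bu$ in $V'$, where $A$ generates the extension to $V'$ (by duality with $V$) of the semigroup $[e^{A_0t}f](s)=e^{-\mu t}f(s-t)$ for $s\ge t$, $0$ otherwise, on $L^2$, and $B(u_0,u_1)=u_1+u_0\delta_0$; $\langle\alpha,\cdot\rangle$ is extended by duality. $V_0(x)=\sup_uI(0,x;u)$, $x\in V'$, is a concave function; its superdifferential $\partial V_0(x)$ is a subset of $V$. MP-equilibrium point: a triple $(x,\zeta,(u_0,u_1))\in L^2(0,\bar s)\times H^2(0,\bar s)\times(\mathbb R\times L^2(0,\bar s))$ with $x(s)=e^{-\mu s}u_0+\int_0^se^{-\mu(s-\sigma)}u_1(\sigma)\,d\sigma$, $\zeta(s)=R'(\langle\alpha,x\rangle)\bar\alpha(s)$, $u_0=(C_0^* )'(\zeta(0))$, $u_1(s)=[c_1(s,\cdot)^*]'(\zeta(s))$ (a stationary solution of the state, co-state and maximum conditions). CLE-equilibrium point: $x\in L^2(0,\bar s)$ for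 which there is $\xi\in\partial V_0(x)$ (so $\xi=V_0'(x)$ if $V_0$ is Fréchet differentiable) with $x(s)=e^{-\mu s}u_0+\int_0^se^{-\mu(s-\sigma)}u_1(\sigma)\,d\sigma$, where $u_0=(C_0^* )'(\xi(0))$, $u_1(s)=[c_1(s,\cdot)^*]'(\xi(s))$.
   Formalization: Optimality, the CLE property and uniqueness are stated only for λ>0 (for λ≤0 a nonzero constant control is not admissible); uniqueness also assumes η=R'(ηc₁−c₂) has at most one solution, since for sign-changing α several η may give distinct CLE-equilibria. *)

(* Defs.v *)
From HB Require Import structures.
From mathcomp Require Import all_boot all_order all_algebra.
From mathcomp Require Import all_classical all_reals all_analysis.

Set Implicit Arguments.
Unset Strict Implicit.
Unset Printing Implicit Defensive.

Import Order.TTheory GRing.Theory Num.Theory.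
Import numFieldNormedType.Exports.

Local Open Scope ring_scope.
Local Open Scope classical_set_scope.

(** Data of the optimal investment problem with vintage capital. A function of
    the age is a map [R -> R], of which only the values on [ages] matter;
    elements of L^2(0, sbar) are compared almost everywhere, elements of
    H^1(0, sbar) are given by their continuous representative. *)
Record vintage_model (R : realType) := VintageModel {
  sbar : \bar R;            (* maximal age, possibly +oo *)
  mu : R;                   (* depreciation factor *)
  lam : R;                  (* discount rate *)
  revenue : R -> R;
  alpha : R -> R;           (* productivity *)
  cost0 : R -> R;           (* C_0 *)
  cost1 : R -> R -> R       (* (s, r) |-> c_1(s, r) *)
}.

(** ** Function spaces over the set of ages *)

Definition ages (R : realType) (M : vintage_model R) : set R :=
  [set s | 0 <= s /\ (s%:E <= sbar M)%E].

Definition ae_ages (R : realType) (M : vintage_model R) (P : R -> Prop) : Prop :=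
  \forall s \ae (@lebesgue_measure R), ages M s -> P s.

Definition pair_ages (R : realType) (M : vintage_model R) (f g : R -> R) : R :=
  \int[@lebesgue_measure R]_(s in ages M) (f s * g s).

Definition Lp_ages (R : realType) (M : vintage_model R) (p : \bar R)
    (f : R -> R) : Prop :=
  (f \_ (ages M)) \in Lfun (@lebesgue_measure R) p.

(** [f] is the primitive of [g], hence [g] is the weak derivative of [f]. *)
Definition primitive_of (R : realType) (M : vintage_model R)
    (f g : R -> R) : Prop :=
  forall s, ages M s ->
    f s = f 0 + \int[@lebesgue_measure R]_(x in `[0, s]) g x.

(** H^1(0, sbar), as the L^2 functions which are primitives of L^2 functions. *)
Definition H1 (R : realType) (M : vintage_model R) (f : R -> R) : Prop :=
  Lp_ages M 2%:E f /\ exists2 g, Lp_ages M 2%:E g & primitive_of M f g.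

Definition H2 (R : realType) (M : vintage_model R) (f : R -> R) : Prop :=
  Lp_ages M 2%:E f /\ exists2 g, H1 M g & primitive_of M f g.

Definition vanishes_at_sbar (R : realType) (M : vintage_model R)
    (f : R -> R) : Prop :=
  match sbar M with
  | s%:E => f s = 0
  | +oo%E => f x @[x --> +oo] --> (0 : R)
  | -oo%E => False
  end.

Definition V (R : realType) (M : vintage_model R) (f : R -> R) : Prop :=
  H1 M f /\ vanishes_at_sbar M f.

(** The weak derivative of [f] is chosen among a.e. equal functions. *)
Definition weak_derivative (R : realType) (M : vintage_model R)
    (f : R -> R) : R -> R :=
  xget (cst 0) [set g | Lp_ages M 2%:E g /\ primitive_of M f g].

Definition H1_norm (R : realType) (M : vintage_model R) (f : R -> R) : R :=
  Num.sqrt (pair_ages M f f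
            + pair_ages M (weak_derivative M f) (weak_derivative M f)).

(** An element of V' is the restriction to [V M] of a map [(R -> R) -> R];
    boundedness makes its values independent of the representative. *)
Definition dualV (R : realType) (M : vintage_model R)
    (x : (R -> R) -> R) : Prop :=
  (forall (a : R) (f g : R -> R), V M f -> V M g ->
     x (fun s => a * f s + g s) = a * x f + x g) /\
  exists k : R, forall f, V M f -> `|x f| <= k * H1_norm M f.

Definition dual_norm (R : realType) (M : vintage_model R)
    (x : (R -> R) -> R) : R :=
  sup [set `|x f| | f in [set f | V M f /\ H1_norm M f <= 1]].

(** The inclusion of the pivot space L^2(0, sbar) in V'. *)
Definition pivot (R : realType) (M : vintage_model R) (x : R -> R) :
    (R -> R) -> R :=
  fun f => pair_ages M f x.

(** ** State equation, payoff and value function *)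

(** The restriction to V of the adjoint, in L^2(0, sbar), of the semigroup
    [f |-> (s |-> if t <= s then expR (- mu * t) * f (s - t) else 0)]. *)
Definition adjoint_semigroup (R : realType) (M : vintage_model R)
    (t : R) (f : R -> R) : R -> R :=
  fun s => if ((s + t)%:E <= sbar M)%E then expR (- mu M * t) * f (s + t) else 0.

(** The extension to V' of the semigroup, by duality with V. *)
Definition semigroup (R : realType) (M : vintage_model R)
    (t : R) (x : (R -> R) -> R) : (R -> R) -> R :=
  fun f => x (adjoint_semigroup M t f).

(** [B (u0, u1) = u1 + u0 * delta_0]. *)
Definition control_operator (R : realType) (M : vintage_model R)
    (u : R * (R -> R)) : (R -> R) -> R :=
  fun f => pair_ages M f u.2 + u.1 * f 0.

(** Mild solution in V' with initial datum [x] at time [t]; the integral in V'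
    is computed by testing against [f]. *)
Definition state (R : realType) (M : vintage_model R) (t : R)
    (x : (R -> R) -> R) (u : R -> R * (R -> R)) (tau : R) : (R -> R) -> R :=
  fun f => semigroup M (tau - t) x f
    + \int[@lebesgue_measure R]_(sigma in `[t, tau])
        semigroup M (tau - sigma) (control_operator M (u sigma)) f.

(** L^2_lambda(t, +oo; R * L^2(0, sbar)), where L^2(t, +oo; L^2(0, sbar)) is
    identified with L^2 of the product ]t, +oo[ * (0, sbar). *)
Definition admissible (R : realType) (M : vintage_model R) (t : R)
    (u : R -> R * (R -> R)) : Prop :=
  ((fun tau => expR (- lam M * tau / 2) * (u tau).1) \_ `]t, +oo[)
    \in Lfun (@lebesgue_measure R) 2%:E /\
  ((fun z : R * R => expR (- lam M * z.1 / 2) * (u z.1).2 z.2)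
     \_ (`]t, +oo[ `*` ages M))
    \in Lfun ((@lebesgue_measure R) \x (@lebesgue_measure R))%E 2%:E.

Definition cost (R : realType) (M : vintage_model R)
    (u : R * (R -> R)) : \bar R :=
  ((cost0 M u.1)%:E
   + \int[@lebesgue_measure R]_(s in ages M) (cost1 M s (u.2 s))%:E)%E.

Definition payoff (R : realType) (M : vintage_model R) (t : R)
    (x : (R -> R) -> R) (u : R -> R * (R -> R)) : \bar R :=
  (\int[@lebesgue_measure R]_(tau in `]t, +oo[)
     ((expR (- lam M * tau))%:E
      * ((revenue M (state M t x u tau (alpha M)))%:E - cost M (u tau))))%E.

Definition optimal (R : realType) (M : vintage_model R)
    (x : (R -> R) -> R) (u : R -> R * (R -> R)) : Prop :=
  admissible M 0 u /\
  forall v, admissible M 0 v -> (payoff M 0 x v <= payoff M 0 x u)%E.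

Definition V0 (R : realType) (M : vintage_model R)
    (x : (R -> R) -> R) : \bar R :=
  ereal_sup [set payoff M 0 x u | u in admissible M 0].

Definition superdifferential_V0 (R : realType) (M : vintage_model R)
    (x : (R -> R) -> R) : set (R -> R) :=
  [set xi | [/\ V M xi, V0 M x \is a fin_num &
    forall y, dualV M y -> (V0 M y <= V0 M x + (y xi - x xi)%:E)%E]].

(** Fréchet differentiability on V', the derivative being an element of
    V'' = V. *)
Definition frechet_differentiable_V0 (R : realType) (M : vintage_model R) :
    Prop :=
  (forall x, dualV M x -> V0 M x \is a fin_num) /\
  forall x, dualV M x -> exists2 xi, V M xi &
    forall e : R, 0 < e -> exists2 d : R, 0 < d &
      forall y, dualV M y -> dual_norm M (fun f => y f - x f) <= d ->
        `|fine (V0 M y) - fine (V0 M x) - (y xi - x xi)|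
          <= e * dual_norm M (fun f => y f - x f).

(** ** Convex analysis on the line *)

Definition conjugate (R : realType) (f : R -> R) (p : R) : \bar R :=
  ereal_sup [set (p * r - f r)%:E | r in [set: R]].

Definition conjugate' (R : realType) (f : R -> R) : R -> R :=
  derive1 (fun p => fine (conjugate f p)).

Definition subdifferential (R : realType) (f : R -> R) (r : R) : set R :=
  [set p | forall r', f r + p * (r' - r) <= f r'].

Definition convex_lsc_injective (R : realType) (f : R -> R) : Prop :=
  [/\ convex_function [set: R^o] (f : R^o -> R^o),
      lower_semicontinuous (EFin \o f) &
      forall r r', r != r' ->
        subdifferential f r `&` subdifferential f r' = set0].

Definition conjugate_smooth (R : realType) (f : R -> R) : Prop :=
  [/\ forall p, conjugate f p \is a fin_num,
      forall p, derivable (fun p => fine (conjugate f p)) p 1 &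
      [lipschitz conjugate' f p | p in setT]].

Definition model_assumptions (R : realType) (M : vintage_model R) : Prop :=
  [/\ (* (i) *)
      [/\ forall r, derivable (revenue M) r 1,
          continuous (derive1 (revenue M)),
          convex_function [set: R^o] ((fun r => - revenue M r) : R^o -> R^o),
          [lipschitz derive1 (revenue M) r | r in setT] &
          V M (alpha M)],
      (* (ii) *)
      convex_lsc_injective (cost0 M) /\
      (forall s, 0 < s -> (s%:E < sbar M)%E -> convex_lsc_injective (cost1 M s)),
      (* (iii) *)
      conjugate_smooth (cost0 M) /\
      (forall s, 0 < s -> (s%:E < sbar M)%E -> conjugate_smooth (cost1 M s)) &
      (* (iv) *)
      exists a b p : R, [/\ 0 < a, 1 < p,
        forall r, a * `|r| `^ p + b <= cost0 M r &
        forall s r, 0 < s -> (s%:E < sbar M)%E ->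
          a * `|r| `^ p + b <= cost1 M s r]].

(** ** Equilibrium points *)

Definition alpha_bar (R : realType) (M : vintage_model R) (s : R) : R :=
  \int[@lebesgue_measure R]_(sigma in [set x | s <= x /\ (x%:E <= sbar M)%E])
    (expR (- (mu M + lam M) * (sigma - s)) * alpha M sigma).

Definition stationary_state (R : realType) (M : vintage_model R)
    (u0 : R) (u1 : R -> R) (s : R) : R :=
  expR (- mu M * s) * u0
  + \int[@lebesgue_measure R]_(sigma in `[0, s])
      (expR (- mu M * (s - sigma)) * u1 sigma).

Definition MP_equilibrium (R : realType) (M : vintage_model R)
    (x zeta : R -> R) (u : R * (R -> R)) : Prop :=
  [/\ Lp_ages M 2%:E x, H2 M zeta & Lp_ages M 2%:E u.2] /\
  [/\ ae_ages M (fun s => x s = stationary_state M u.1 u.2 s),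
      forall s, ages M s ->
        zeta s = derive1 (revenue M) (pair_ages M (alpha M) x) * alpha_bar M s,
      u.1 = conjugate' (cost0 M) (zeta 0) &
      ae_ages M (fun s => u.2 s = conjugate' (cost1 M s) (zeta s))].

Definition CLE_equilibrium (R : realType) (M : vintage_model R)
    (x : R -> R) : Prop :=
  Lp_ages M 2%:E x /\
  exists2 xi, superdifferential_V0 M (pivot M x) xi &
    ae_ages M (fun s => x s =
      stationary_state M (conjugate' (cost0 M) (xi 0))
        (fun sigma => conjugate' (cost1 M sigma) (xi sigma)) s).

(** ** Linear-quadratic cost *)

Definition lq_model (R : realType) (sb : \bar R) (mu lam : R)
    (Rev alpha : R -> R) (beta0 q0 : R) (beta1 q1 : R -> R) :
    vintage_model R :=
  VintageModel sb mu lam Rev alpha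
    (fun r => beta0 * r ^+ 2 + q0 * r)
    (fun s r => beta1 s * r ^+ 2 + q1 s * r).

Definition w1 (R : realType) (M : vintage_model R)
    (beta0 : R) (beta1 : R -> R) (s : R) : R :=
  alpha_bar M 0 / (2 * beta0) * expR (- mu M * s)
  + \int[@lebesgue_measure R]_(sigma in `[0, s])
      (expR (- mu M * (s - sigma)) * (alpha_bar M sigma / (2 * beta1 sigma))).

Definition w2 (R : realType) (M : vintage_model R)
    (beta0 q0 : R) (beta1 q1 : R -> R) (s : R) : R :=
  q0 / (2 * beta0) * expR (- mu M * s)
  + \int[@lebesgue_measure R]_(sigma in `[0, s])
      (expR (- mu M * (s - sigma)) * (q1 sigma / (2 * beta1 sigma))).

(* Main.v *)
Require Import Defs.
From HB Require Import structures.
From mathcomp Require Import all_boot all_order all_algebra.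
From mathcomp Require Import all_classical all_reals all_analysis.
From mathcomp Require Import measurable_realfun ess_sup_inf ring lra.

Set Implicit Arguments.
Unset Strict Implicit.
Unset Printing Implicit Defensive.

Import Order.TTheory GRing.Theory Num.Theory.
Import numFieldNormedType.Exports.

Local Open Scope ring_scope.
Local Open Scope classical_set_scope.

(* Tested against [f] in V, the mild solution is [y (T t f)] plus a convolution
   of the control with [T _ f], where [T] is the adjoint semigroup; the Laplace
   transform at [lam] of [T _ alpha] is the resolvent of [alpha] at [mu + lam],
   which is [alpha_bar]. Let the constant control [u] keep [x], and let
   [eta = Rev' <alpha, x>]. If [eta * alpha_bar] is the gradient of the cost at
   [u], then concavity of [Rev] and convexity of the cost show that no control
   pays more from a datum [y] than the payoff of [u] at [x] plus
   [<y - x, eta * alpha_bar>]: [u] is optimal at [x], and [eta * alpha_bar] is a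
   supergradient of V0 there.
   Conversely, let [xi] be a supergradient at [y] whose feedback [u] keeps [y].
   By dynamic programming over [[0, t]], and by strong convexity of the cost, no
   control improves on [u] at [y] by more than [O(t^2)] plus the discounted gap
   [exp (- lam t) (V0 y - payoff of u)]; hence [V0 y] is the payoff of [u]. Since
   [Rev'] is Lipschitz, the payoff of [u] at [y + theta * delta_s] has derivative
   [Rev' <alpha, y> * alpha_bar s] in [theta] and lies below
   [V0 y + theta * xi s]: therefore [xi = Rev' <alpha, y> * alpha_bar], and [y]
   is a stationary state of the maximum principle, determined by its [eta]. *)

(** * Integrals over an arbitrary measure and over the line *)

(** Why the gap is [O(t^2)]: a supergradient bounds V0 at the state reached at time [t], so it
    prices a deviation made at time [r] by the shift of [xi] by the delay [t - r], whereas the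
    feedback makes [xi] itself the marginal cost. Since [xi] is only H^1, the two prices of a
    deviation of size [n] differ by [O(sqrt t) n]. The strongly convex loss [c n^2] turns this into
    [O(t)], and integration over a time [t] gives [O(t^2)]. The gap between V0 and the payoff of the
    feedback is multiplied by [1 - exp (- lam t)], which is of exact order [t], so it must vanish. A
    second obstacle is that elements of V' are bare functionals on V: neither the measurability of
    [t |-> y (T t f)] nor the exchange of [y] with an integral in time is given. Both are Fubini
    statements when [y] is an H^1 inner product, and they pass to the limit because such functionals
    are dense in V' for the dual norm. *)

Section measure_tools.
Context d (T : measurableType d) (R : realType).
Variable m : {measure set T -> \bar R}.
Implicit Types (f g h : T -> R) (D : set T).

Lemma aeS (P Q : T -> Prop) : (forall x, P x -> Q x) ->
  {ae m, forall x, P x} -> {ae m, forall x, Q x}.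
Proof. by move=> PQ; exact: filterS. Qed.

Lemma aeI (P Q : T -> Prop) : {ae m, forall x, P x} -> {ae m, forall x, Q x} ->
  {ae m, forall x, P x /\ Q x}.
Proof. exact: filterI. Qed.

Lemma aeT (P : T -> Prop) : (forall x, P x) -> {ae m, forall x, P x}.
Proof.
by move=> PT; exists set0; split => // x /= /(_ (PT x)).
Qed.

Definition integ f := m.-integrable setT (EFin \o f).

Lemma integ_measurable f : integ f -> measurable_fun setT f.
Proof. by move=> /measurable_int/measurable_EFinP. Qed.

Lemma integ_le f g : measurable_fun setT f -> (forall x, `|f x| <= g x) ->
  integ g -> integ f.
Proof.
move=> mf fg ig; apply: le_integrable ig => //; first exact/measurable_EFinP.
move=> x _ /=; rewrite lee_fin; exact: le_trans (fg x) (ler_norm _).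
Qed.

Lemma integD f g : integ f -> integ g -> integ (fun x => f x + g x).
Proof. by move=> fi gi; exact: (integrableD measurableT fi gi). Qed.

Lemma integB f g : integ f -> integ g -> integ (fun x => f x - g x).
Proof. by move=> fi gi; exact: (integrableB measurableT fi gi). Qed.

Lemma integZ a f : integ f -> integ (fun x => a * f x).
Proof. by move=> fi; exact: (integrableZl measurableT a fi). Qed.

Lemma integ_norm f : integ f -> integ (fun x => `|f x|).
Proof. by move=> fi; exact: integrable_norm. Qed.

Lemma integ0 : integ (fun=> 0).
Proof. exact: integrable0. Qed.

Lemma integ_ltyP f : integ f <->
  measurable_fun setT f /\ (\int[m]_x (`|f x|)%:E < +oo)%E.
Proof.
split=> [/integrableP[/measurable_EFinP]//|[mf fi]].
by apply/integrableP; split=> //; exact/measurable_EFinP.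
Qed.

Lemma Rint_eq0 f : (forall x, f x = 0) -> \int[m]_x f x = 0.
Proof.
move=> f0; rewrite (_ : f = cst 0); last exact/funext.
by rewrite Rintegral_cst// mul0r.
Qed.

Lemma EFin_Rint f : integ f -> (\int[m]_x f x)%:E = (\int[m]_x (f x)%:E)%E.
Proof. by move=> fi; rewrite /Rintegral fineK//; exact: integrable_fin_num. Qed.

Lemma ae_Rint f g : measurable_fun setT f -> measurable_fun setT g ->
  {ae m, forall x, f x = g x} -> \int[m]_x f x = \int[m]_x g x.
Proof.
move=> mf mg fg; congr fine; apply: ae_eq_integral => //.
- exact/measurable_EFinP.
- exact/measurable_EFinP.
- by apply: filterS fg => x /= ->.
Qed.

Lemma ae_integ f g : measurable_fun setT g -> {ae m, forall x, f x = g x} ->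
  integ f -> integ g.
Proof.
move=> mg fg /integ_ltyP[mf fi]; apply/integ_ltyP; split=> //.
rewrite (_ : integral _ _ _ = (\int[m]_x (`|f x|)%:E)%E)//.
apply: ge0_ae_eq_integral => //.
- exact/measurable_EFinP/measurableT_comp.
- exact/measurable_EFinP/measurableT_comp.
- by apply: filterS fg => x /= ->.
Qed.

Lemma integ_le_ae f g : measurable_fun setT f ->
  {ae m, forall x, `|f x| <= g x} -> integ g -> integ f.
Proof.
move=> mf fg /integ_ltyP[mg gi]; apply/integ_ltyP; split=> //.
apply: le_lt_trans gi; apply: ae_ge0_le_integral => //.
- exact/measurable_EFinP/measurableT_comp.
- exact/measurable_EFinP/measurableT_comp.
- by apply: aeS fg => x /= h _; rewrite lee_fin; exact: le_trans h (ler_norm _).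
Qed.

Lemma ae_le_Rint f g : integ f -> integ g ->
  {ae m, forall x, f x <= g x} -> \int[m]_x f x <= \int[m]_x g x.
Proof.
(* [min f g] equals [f] almost everywhere and lies below [g] everywhere, so pointwise monotonicity
   applies to it. *)
move=> fi gi fg; pose h x := Num.min (f x) (g x).
have mf := integ_measurable fi; have mg := integ_measurable gi.
have mh : measurable_fun setT h by exact: measurable_minr.
rewrite (ae_Rint mf mh); last by apply: filterS fg => x /= /min_idPl.
apply: le_Rintegral => //.
- apply: ae_integ mh _ fi.
  by apply: filterS fg => x /= /min_idPl.
- by move=> x _; rewrite /h ge_min lexx orbT.
Qed.

(* The negative and positive parts of an integral are suprema over simple
   functions, so no measurability is needed for monotonicity. *)
Lemma le_integral_pointwise D (f g : T -> \bar R) :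
  (forall x, D x -> (f x <= g x)%E) ->
  (\int[m]_(x in D) f x <= \int[m]_(x in D) g x)%E.
Proof.
move=> fg; rewrite integralE [leRHS]integralE.
have pw (u v : T -> \bar R) : (forall x, D x -> (0 <= u x)%E) ->
    (forall x, D x -> (u x <= v x)%E) ->
    (\int[m]_(x in D) u x <= \int[m]_(x in D) v x)%E.
  move=> u0 uv; rewrite !ge0_integralE//; last first.
    by move=> x Dx; exact: le_trans (u0 x Dx) (uv x Dx).
  apply: ereal_sup_le => _ [h /= hu <-]; exists h => //= x.
  apply: le_trans (hu x) _; rewrite /patch; case: ifPn => //.
  by rewrite inE => /uv.
apply: leeB; apply: pw => x Dx; rewrite ?funepos_ge0 ?funeneg_ge0//.
- by rewrite !funeposE le_max2// fg.
- by rewrite !funenegE le_max2// leeN2 fg.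
Qed.

End measure_tools.

(** * Fubini for real-valued integrals *)

Section fubini_tools.
Context d1 d2 (T1 : measurableType d1) (T2 : measurableType d2) (R : realType).
Variable m1 : {sigma_finite_measure set T1 -> \bar R}.
Variable m2 : {sigma_finite_measure set T2 -> \bar R}.
Local Open Scope ereal_scope.

(** Tonelli applies to the positive and negative parts separately, so integrability of the sections
    does not enter. *)
Lemma measurable_integral_param (f : T1 * T2 -> \bar R) :
  measurable_fun setT f -> measurable_fun setT (fun x => \int[m2]_y f (x, y)).
Proof.
move=> mf; under eq_fun => x do rewrite integralE.
apply: emeasurable_funB.
- rewrite (_ : (fun x => _) = fubini_F m2 (f ^\+)).
    by apply: measurable_fun_fubini_tonelli_F => //; exact: measurable_funepos.
  by apply/funext => x; apply: eq_integral => y _; rewrite !funeposE.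
- rewrite (_ : (fun x => _) = fubini_F m2 (f ^\-)).
    by apply: measurable_fun_fubini_tonelli_F => //; exact: measurable_funeneg.
  by apply/funext => x; apply: eq_integral => y _; rewrite !funenegE.
Qed.

Lemma measurable_Rint_param (f : T1 * T2 -> R) :
  measurable_fun setT f ->
  measurable_fun setT (fun x => (\int[m2]_y f (x, y))%R).
Proof.
move=> mf; apply: measurableT_comp; first by [].
by apply: (measurable_integral_param (f := EFin \o f)); exact/measurable_EFinP.
Qed.

(** The second premise is Tonelli's test for integrability on the product. Real integrals agree with
    extended ones where the section is integrable, that is almost everywhere, and the conclusions
    are transported along [e1] and [e2]. *)
Lemma Rfubini (f : T1 * T2 -> R) : measurable_fun setT f ->
  \int[m1]_x \int[m2]_y `|f (x, y)|%:E < +oo ->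
  [/\ {ae m1, forall x, integ m2 (fun y => f (x, y))},
      {ae m2, forall y, integ m1 (fun x => f (x, y))},
      integ m1 (fun x => (\int[m2]_y f (x, y))%R),
      integ m2 (fun y => (\int[m1]_x f (x, y))%R) &
      (\int[m1]_x (\int[m2]_y f (x, y)) = \int[m2]_y (\int[m1]_x f (x, y)))%R].
Proof.
move=> mf fi.
have If : (m1 \x m2).-integrable setT (EFin \o f).
  by apply/integrable12ltyP => //; exact/measurable_EFinP.
have ae1 := ae_integrable1 If; have ae2 := ae_integrable2 If.
have e1 : ae_eq m1 setT (fun x => \int[m2]_y (f (x, y))%:E)
    (fun x => (\int[m2]_y f (x, y))%R%:E).
  by apply: filterS ae1 => x /= fx _; rewrite EFin_Rint.
have e2 : ae_eq m2 setT (fun y => \int[m1]_x (f (x, y))%:E)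
    (fun y => (\int[m1]_x f (x, y))%R%:E).
  by apply: filterS ae2 => x /= fx _; rewrite EFin_Rint.
have I1 := integrable_fubini_F If.
have I2 : m2.-integrable setT (fubini_G m1 (EFin \o f)).
  have mG := measurable_fubini_G If.
  apply/integrableP; split => //.
  move/(integrable21ltyP _ _ (measurable_int _ If)) : (If); apply: le_lt_trans.
  apply: ge0_le_integral => //.
  - exact: measurableT_comp.
  - apply: (measurable_fun_fubini_tonelli_G (abse \o (EFin \o f))).
      by apply: measurableT_comp => //; exact/measurable_EFinP.
    by move=> z; exact: abse_ge0.
  - move=> y _; apply: le_abse_integral => //.
    exact/measurable_EFinP/measurable_fun_pair1.
have mF1 := measurable_Rint_param mf.
have mF2 : measurable_fun setT (fun y => (\int[m1]_x f (x, y))%R).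
  apply: measurableT_comp; first by [].
  exact: measurable_int I2.
split => //.
- apply/integrableP; split; first exact/measurable_EFinP.
  move/integrableP : I1 => [mI1 I1]; apply: le_lt_trans I1.
  rewrite le_eqVlt; apply/orP; left; apply/eqP/ge0_ae_eq_integral => //.
  + by apply: measurableT_comp => //; exact/measurable_EFinP.
  + exact: measurableT_comp.
  + by apply: filterS e1 => x /= h Dx; rewrite /fubini_F /= (h Dx).
- apply/integrableP; split; first exact/measurable_EFinP.
  move/integrableP : I2 => [mI2 I2]; apply: le_lt_trans I2.
  rewrite le_eqVlt; apply/orP; left; apply/eqP/ge0_ae_eq_integral => //.
  + by apply: measurableT_comp => //; exact/measurable_EFinP.
  + exact: measurableT_comp.
  + by apply: filterS e2 => x /= h Dx; rewrite /fubini_G /= (h Dx).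
- rewrite {1 3}/Rintegral; congr fine.
  transitivity (\int[m1]_x \int[m2]_y (EFin \o f) (x, y)).
    apply: ae_eq_integral => //; first exact/measurable_EFinP.
      exact: measurable_int I1.
    by apply: filterS e1 => x /= h Dx; rewrite (h Dx).
  rewrite (Fubini If); apply: ae_eq_integral => //.
  + exact: measurable_int I2.
  + exact/measurable_EFinP.
Qed.

End fubini_tools.
Arguments measurable_integral_param {d1 d2 T1 T2 R m2} f.
Arguments measurable_Rint_param {d1 d2 T1 T2 R m2} f.
Arguments Rfubini {d1 d2 T1 T2 R m1 m2} f.

(** * Square-integrable functions and the Cauchy-Schwarz inequality *)

Section square_integrable.
Context d (T : measurableType d) (R : realType).
Variable m : {measure set T -> \bar R}.
Implicit Types (f g h : T -> R).

Definition L2 f := measurable_fun setT f /\ integ m (fun x => f x ^+ 2).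

Definition nrm f := Num.sqrt (\int[m]_x (f x ^+ 2)).

Lemma L2_measurable f : L2 f -> measurable_fun setT f. Proof. by case. Qed.

Lemma L2_ltyP f : L2 f <->
  measurable_fun setT f /\ (\int[m]_x (f x ^+ 2)%:E < +oo)%E.
Proof.
have e : (\int[m]_x (`|f x ^+ 2|)%:E = \int[m]_x (f x ^+ 2)%:E)%E.
  by apply: eq_integral => x _; rewrite ger0_norm// sqr_ge0.
split=> -[mf].
  by move=> /integ_ltyP[_]; rewrite e.
move=> fi; split=> //; apply/integ_ltyP; rewrite e; split=> //.
exact: measurable_funX.
Qed.

Lemma Lfun2P f : f \in Lfun m 2%:E <-> L2 f.
Proof.
split=> [fi|/L2_ltyP[mf fi]].
  split; first by move: fi; rewrite inE => /andP[/[!inE]].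
  exact: Lfun2_integrable_sqr.
rewrite inE; apply/andP; split; rewrite inE//=.
rewrite /finite_norm unlock poweR_lty//.
apply: le_lt_trans fi.
by under eq_integral => x _ do rewrite /= powR_mulrn// -normrX ger0_norm ?sqr_ge0//.
Qed.

Lemma L2_mul f g : L2 f -> L2 g -> integ m (fun x => f x * g x).
Proof.
move=> [mf fi] [mg gi].
apply: (integ_le (g := fun x => f x ^+ 2 + g x ^+ 2)).
- exact: measurable_funM.
- move=> x; rewrite normrM -(real_normK (num_real (f x))) -(real_normK (num_real (g x))).
  have := sqr_ge0 (`|f x| - `|g x|); have := normr_ge0 (f x); have := normr_ge0 (g x).
  move: `|f x| `|g x| => a b; nra.
- exact: integD.
Qed.

Lemma L2_le f g : measurable_fun setT f -> (forall x, `|f x| <= `|g x|) ->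
  L2 g -> L2 f.
Proof.
move=> mf fg [mg gi]; split=> //; apply: integ_le gi; first exact: measurable_funX.
by move=> x; rewrite normrX -(real_normK (num_real (g x))) lerXn2r ?nnegrE.
Qed.

Lemma L2Z a f : L2 f -> L2 (fun x => a * f x).
Proof.
move=> [mf fi]; split; first exact: measurable_funM.
by under eq_fun => x do rewrite exprMn; exact: integZ.
Qed.

Lemma L2D f g : L2 f -> L2 g -> L2 (fun x => f x + g x).
Proof.
move=> lf lg; have [mf fi] := lf; have [mg gi] := lg.
split; first exact: measurable_funD.
under eq_fun => x do rewrite sqrrD.
apply: integD => //; apply: integD => //.
under eq_fun => x do rewrite -mulr_natl.
by apply: integZ; exact: L2_mul.
Qed.

Lemma L2B f g : L2 f -> L2 g -> L2 (fun x => f x - g x).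
Proof.
move=> lf lg; under eq_fun => x do rewrite -mulN1r.
by apply: L2D => //; exact: L2Z.
Qed.

Lemma L2_norm f : L2 f -> L2 (fun x => `|f x|).
Proof.
move=> lf; have [mf _] := lf; apply: L2_le lf; last by move=> x; rewrite normr_id.
exact: measurableT_comp.
Qed.

Lemma nrm_ge0 f : 0 <= nrm f. Proof. exact: sqrtr_ge0. Qed.

Lemma sqr_nrm f : nrm f ^+ 2 = \int[m]_x (f x ^+ 2).
Proof. by rewrite sqr_sqrtr//; apply: Rintegral_ge0 => x _; exact: sqr_ge0. Qed.

Lemma Rint_sqrD a f g : L2 f -> L2 g ->
  \int[m]_x ((f x + a * g x) ^+ 2) =
  nrm f ^+ 2 + 2 * a * (\int[m]_x (f x * g x)) + a ^+ 2 * nrm g ^+ 2.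
Proof.
move=> lf lg; have [mf fi] := lf; have [mg gi] := lg; have fg := L2_mul lf lg.
rewrite !sqr_nrm.
transitivity (\int[m]_x ((f x ^+ 2 + (2 * a) * (f x * g x)) + a ^+ 2 * g x ^+ 2)).
  by apply: eq_Rintegral => x _; ring.
rewrite RintegralD//; last by apply: integZ.
  rewrite RintegralD//; last by apply: integZ.
  by rewrite !RintegralZl.
by apply: integD => //; exact: integZ.
Qed.

(** A quadratic that is nowhere negative has a nonpositive discriminant. It serves for
    Cauchy-Schwarz and again for the near minimizers in [dual_approx]. *)
Lemma discriminant_le (a b c : R) :
  (forall t, 0 <= a ^+ 2 + 2 * t * c + t ^+ 2 * b ^+ 2) -> 0 <= a -> 0 <= b ->
  `|c| <= a * b.
Proof.
move=> h a0 b0; rewrite -(@ler_pXn2r _ 2) ?nnegrE ?mulr_ge0// real_normK ?num_real// exprMn.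
have [b20|b20] := eqVneq (b ^+ 2) 0.
  rewrite b20 mulr0; have [->|c0] := eqVneq c 0; first by rewrite expr0n.
  (* For [b = 0] the polynomial is affine in [t], and this [t] gives it the value -1. *)
  have := h (- (a ^+ 2 + 1) / (2 * c)); rewrite b20 mulr0 addr0.
  rewrite (_ : 2 * (- (a ^+ 2 + 1) / (2 * c)) * c = - (a ^+ 2 + 1)); last by field.
  lra.
have B : 0 < b ^+ 2 by rewrite lt_neqAle eq_sym b20 sqr_ge0.
have := h (- c / b ^+ 2); rewrite -(@pmulr_lge0 _ (b ^+ 2))//.
set u := b ^+ 2 in b20 B *.
rewrite (_ : (a ^+ 2 + 2 * (- c / u) * c + (- c / u) ^+ 2 * u) * u =
  a ^+ 2 * u - c ^+ 2); last by field.
lra.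
Qed.

Lemma cauchy_schwarz f g : L2 f -> L2 g ->
  `|\int[m]_x (f x * g x)| <= nrm f * nrm g.
Proof.
move=> lf lg; apply: discriminant_le; rewrite ?nrm_ge0// => t.
by rewrite -Rint_sqrD//; apply: Rintegral_ge0 => x _; exact: sqr_ge0.
Qed.

Lemma nrm_norm f : nrm (fun x => `|f x|) = nrm f.
Proof.
congr Num.sqrt; apply: eq_Rintegral => x _.
by rewrite real_normK// num_real.
Qed.

Lemma cauchy_schwarz_norm f g : L2 f -> L2 g ->
  \int[m]_x `|f x * g x| <= nrm f * nrm g.
Proof.
move=> lf lg; rewrite -(nrm_norm f) -(nrm_norm g).
under eq_Rintegral => x _ do rewrite normrM.
apply: le_trans (cauchy_schwarz (L2_norm lf) (L2_norm lg)).
exact: ler_norm.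
Qed.

Lemma nrmZ a f : L2 f -> nrm (fun x => a * f x) = `|a| * nrm f.
Proof.
move=> lf; rewrite /nrm.
under eq_Rintegral => x _ do rewrite exprMn.
by rewrite RintegralZl//; [rewrite sqrtrM ?sqr_ge0// sqrtr_sqr | case: lf].
Qed.

Lemma le_nrm f g : L2 f -> L2 g -> {ae m, forall x, `|f x| <= `|g x|} ->
  nrm f <= nrm g.
Proof.
move=> [mf fi] [mg gi] fg; rewrite ler_wsqrtr//; apply: ae_le_Rint => //.
apply: filterS fg => x /= h.
by rewrite -(real_normK (num_real (f x))) -(real_normK (num_real (g x))) lerXn2r ?nnegrE.
Qed.

Lemma ae_L2 f g : measurable_fun setT g -> {ae m, forall x, f x = g x} ->
  L2 f -> L2 g.
Proof.
move=> mg fg [mf fi]; split=> //; apply: ae_integ _ fi; first exact: measurable_funX.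
by apply: filterS fg => x /= ->.
Qed.

End square_integrable.

(** * Translation invariance of the Lebesgue integral *)

Section translation.
Context (R : realType).
Local Notation leb := (@lebesgue_measure R).

Lemma measurable_shift (c : R) :
  measurable_fun setT (fun x : R => x + c).
Proof. by apply: measurable_funD => //; exact: measurable_cst. Qed.

(** The pushforward agrees with Lebesgue measure on half-open intervals, which determine it. *)
Lemma lebesgue_measure_shift (c : R) (A : set R) : measurable A ->
  pushforward leb ((fun x => x + c) : R -> measurableTypeR R) A = leb A.
Proof.
move=> mA; apply/esym; have ms := measurable_shift c.
pose shift_mfun := isMeasurableFun.Build _ _ _ _ _ ms.
pose S : {mfun _ >-> _} := HB.pack (fun x : R => x + c) shift_mfun.
apply: (@lebesgue_measure_unique R (pushforward leb (S : R -> measurableTypeR R))) => //.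
move=> _ [[a b]] _ <-; transitivity (leb `](a - c), (b - c)]%classic).
  rewrite !lebesgue_measure_itv/= !lte_fin ltrD2r; case: ifP => // _.
  by congr EFin; ring.
rewrite /pushforward; congr (leb _).
by apply/seteqP; split => x /=; rewrite !in_itv/= ltrBlDr lerBrDr.
Qed.

Lemma ge0_integral_shift (c : R) (f : R -> \bar R) : measurable_fun setT f ->
  (forall x, (0 <= f x)%E) -> (\int[leb]_x f (x + c)%R = \int[leb]_x f x)%E.
Proof.
move=> mf f0.
have ms : measurable_fun setT
    ((fun x => x + c)%R : measurableTypeR R -> measurableTypeR R).
  exact: measurable_shift.
rewrite -[LHS](@ge0_integral_pushforward _ _ _ _ R _ ms leb setT f)//.
by apply: eq_measure_integral => A mA _; exact: lebesgue_measure_shift.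
Qed.

Lemma integral_shift (c : R) (f : R -> \bar R) : measurable_fun setT f ->
  (\int[leb]_x f (x + c)%R = \int[leb]_x f x)%E.
Proof.
move=> mf; rewrite integralE [RHS]integralE -(ge0_integral_shift c (f := (f ^\+)%E))//; last first.
  exact: measurable_funepos.
rewrite -(ge0_integral_shift c (f := (f ^\-)%E))//; last exact: measurable_funeneg.
by congr (_ - _)%E; apply: eq_integral => x _; rewrite ?funeposE ?funenegE.
Qed.

Lemma Rint_shift (c : R) (f : R -> R) : measurable_fun setT f ->
  \int[leb]_x f (x + c) = \int[leb]_x f x.
Proof.
by move=> mf; congr fine; apply: (integral_shift c (f := EFin \o f)); exact/measurable_EFinP.
Qed.

Lemma measurable_fun_shift (c : R) (f : R -> R) : measurable_fun setT f ->
  measurable_fun setT (fun x : R => f (x + c)).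
Proof. by move=> mf; exact: (measurableT_comp mf (measurable_shift c)). Qed.

Lemma integ_shift (c : R) (f : R -> R) : integ leb f ->
  integ leb (fun x => f (x + c)).
Proof.
move=> /integ_ltyP[mf fi]; apply/integ_ltyP; split; first exact: measurable_fun_shift.
rewrite (integral_shift c (f := fun x => (`|f x|)%:E))//.
exact/measurable_EFinP/measurableT_comp.
Qed.

Lemma L2_shift (c : R) (f : R -> R) : L2 leb f -> L2 leb (fun x => f (x + c)).
Proof.
by move=> [mf fi]; split; [exact: measurable_fun_shift | exact: (integ_shift c fi)].
Qed.

Lemma nrm_shift (c : R) (f : R -> R) : measurable_fun setT f ->
  nrm leb (fun x => f (x + c)) = nrm leb f.
Proof.
move=> mf; congr Num.sqrt; apply: (Rint_shift c (f := fun x => f x ^+ 2)).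
exact: measurable_funX.
Qed.

End translation.

(** * Causal exponentials and indicators of bounded intervals *)

Section half_line.
Context (R : realType).
Local Notation leb := (@lebesgue_measure R).
Implicit Types (k t s h : R).

(** Cutting the exponential at 0 puts causality into the integrand: integrals run over the whole
    line, where translations and Fubini need no domains. *)
Definition hexp k t := if 0 <= t then expR (- k * t) else 0.

Definition box h t : R := if (0 <= t) && (t <= h) then 1 else 0.

Lemma hexp_ge0 k t : 0 <= hexp k t.
Proof. by rewrite /hexp; case: ifPn => // _; exact: expR_ge0. Qed.

Lemma hexp_pos k t : 0 <= t -> hexp k t = expR (- k * t).
Proof. by rewrite /hexp => ->. Qed.

Lemma hexp_neg k t : t < 0 -> hexp k t = 0.
Proof. by rewrite /hexp leNgt => ->. Qed.

Lemma hexp_le1 k t : 0 <= k -> hexp k t <= 1.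
Proof.
rewrite /hexp => k0; case: ifPn => // t0.
by rewrite -expR0 ler_expR mulNr oppr_le0 mulr_ge0.
Qed.

Lemma hexpD k l t : hexp (k + l) t = hexp k t * hexp l t.
Proof.
rewrite /hexp; case: ifPn => _; last by rewrite mul0r.
by rewrite -expRD -mulrDl opprD.
Qed.

Lemma hexpM k s t : 0 <= s -> 0 <= t -> hexp k (s + t) = hexp k s * hexp k t.
Proof. by move=> s0 t0; rewrite !hexp_pos ?addr_ge0// -expRD mulrDr. Qed.

Lemma measurable_nonneg : measurable_fun setT (fun t : R => 0 <= t).
Proof. exact: measurable_fun_ler. Qed.

Lemma measurable_hexp k : measurable_fun setT (hexp k).
Proof.
apply: measurable_fun_ifT => //; first exact: measurable_nonneg.
by apply: measurableT_comp => //; exact: measurable_funM.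
Qed.

(** The exponential law supplies the integrability of [hexp] and its total mass [1 / k]. *)
Lemma hexp_pdf k t : exponential_pdf k t = k * hexp k t.
Proof.
rewrite /exponential_pdf /hexp patchE mem_setE in_itv/= andbT.
by case: ifP => _; rewrite ?mulr0.
Qed.

Lemma integ_hexp k : 0 < k -> integ leb (hexp k).
Proof.
move=> k0; have := integrable_exponential_pdf k0.
move/(integZ (k^-1)).
by under eq_fun => t do rewrite /= hexp_pdf mulKf ?gt_eqF//.
Qed.

Lemma Rint_hexp k : 0 < k -> \int[leb]_t hexp k t = k^-1.
Proof.
move=> k0; have := integral_exponential_pdf k0.
have h := integ_hexp k0.
rewrite (_ : integral _ _ _ = (\int[leb]_t (k * hexp k t))%:E); last first.
  by rewrite EFin_Rint; [apply: eq_integral => t _; rewrite hexp_pdf | exact: integZ].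
rewrite RintegralZl// => -[] h1.
by apply: (mulfI (lt0r_neq0 k0)); rewrite h1 divff ?gt_eqF.
Qed.

Lemma L2_hexp k : 0 < k -> L2 leb (hexp k).
Proof.
move=> k0; split; first exact: measurable_hexp.
under eq_fun => t do rewrite expr2 -hexpD.
by apply: integ_hexp; rewrite addr_gt0.
Qed.

(** The tail of the exponential law. Read from right to left it writes [hexp k r] as an integral
    over thresholds [t], which lets Fubini replace integration by parts in [Res_wderiv]. *)
Lemma Rint_hexp_tail (k r : R) : 0 < k -> 0 <= r ->
  \int[leb]_t (k * hexp k t * (r <= t)%R%:R) = hexp k r.
Proof.
move=> k0 r0; have mh := measurable_hexp k.
rewrite -(Rint_shift r); last first.
  apply: measurable_funM; first exact: measurable_funM.
  rewrite (_ : (fun t : R => _) = \1_(`[r, +oo[%classic)).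
    exact/measurable_indicP.
  by apply/funext => t; rewrite indicE mem_setE in_itv/= andbT.
rewrite (_ : hexp k r = k * hexp k r * \int[leb]_t hexp k t); last first.
  by rewrite Rint_hexp// mulrAC divff ?mul1r// gt_eqF.
rewrite -RintegralZl//; last exact: integ_hexp.
apply: eq_Rintegral => t _; rewrite lerDr.
have [t0|t0] := boolP (0 <= t); last by rewrite (@hexp_neg k t) ?ltNge// !mulr0.
by rewrite mulr1 hexpM// mulrAC mulrA.
Qed.

Lemma boxE h t : box h t = \1_(`[0, h]%classic) t.
Proof. by rewrite /box indicE mem_setE in_itv/=; case: ifP. Qed.

Lemma box_ge0 h t : 0 <= box h t.
Proof. by rewrite /box; case: ifP. Qed.

Lemma box_le1 h t : box h t <= 1.
Proof. by rewrite /box; case: ifP. Qed.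

Lemma measurable_box h : measurable_fun setT (box h).
Proof.
rewrite (_ : box h = \1_(`[0, h]%classic)); last exact/funext/boxE.
exact/measurable_indicP.
Qed.

Lemma integ_box h : integ leb (box h).
Proof.
rewrite (_ : box h = \1_(`[0, h]%classic)); last exact/funext/boxE.
exact: (integrable_indic_itv 0 h true false).
Qed.

Lemma Rint_box h : 0 <= h -> \int[leb]_t box h t = h.
Proof.
move=> h0; rewrite /Rintegral; under eq_integral => t _ do rewrite boxE.
transitivity (fine (leb `[0, h]%classic)).
  by congr fine; rewrite integral_indic// setIT.
rewrite lebesgue_measure_itv/= lte_fin.
by case: ltgtP h0 => //= h0' _; rewrite ?subr0.
Qed.

Lemma L2_box h : L2 leb (box h).
Proof.
split; first exact: measurable_box.
rewrite (_ : (fun t => _) = box h); first exact: integ_box.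
by apply/funext => t; rewrite /box; case: ifP; rewrite ?expr1n ?expr0n.
Qed.

Lemma nrm_box h : 0 <= h -> nrm leb (box h) = Num.sqrt h.
Proof.
move=> h0; rewrite /nrm; congr Num.sqrt; rewrite -[RHS](Rint_box h0).
by apply: eq_Rintegral => t _; rewrite /box; case: ifP; rewrite ?expr1n ?expr0n.
Qed.

Lemma Rint_itv_box h (f : R -> R) :
  \int[leb]_(x in `[0, h]) f x = \int[leb]_x (box h x * f x).
Proof.
rewrite Rintegral_mkcond; apply: eq_Rintegral => x _.
rewrite patchE /box mem_setE in_itv/=; by case: ifP; rewrite ?mul1r ?mul0r.
Qed.

End half_line.

(** * Functions of the age and the space V *)

Section ages_space.
Context (R : realType) (M : vintage_model R).
Hypothesis sbar_ge0 : (0 <= sbar M)%E.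
Local Notation leb := (@lebesgue_measure R).
Implicit Types f g F G : R -> R.

(** Extension by zero to the line, where the translations of the semigroup never leave the domain of
    an integral. *)
Definition ext f : R -> R := f \_ (ages M).

Lemma ext_if f s : ext f s = if s \in ages M then f s else 0.
Proof. exact: patchE. Qed.

Lemma ages0 : ages M 0.
Proof. by split. Qed.

Lemma ages_le s r : ages M r -> 0 <= s -> s <= r -> ages M s.
Proof. by move=> [_ rs] s0 sr; split=> //; apply: le_trans rs; rewrite lee_fin. Qed.

Lemma measurable_ages : measurable (ages M : set R).
Proof.
rewrite /ages; case: (sbar M) sbar_ge0 => [b||]// _.
- rewrite (_ : [set s | _] = `[0, b]%classic)//.
  by apply/seteqP; split => x /=; rewrite in_itv/= lee_fin; [case=> -> ->|move=> /andP[]].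
- rewrite (_ : [set s | _] = `[0, +oo[%classic)//.
  apply/seteqP; split => x /=; rewrite in_itv/= ?andbT; first by case.
  by move=> x0; split=> //; exact: leey.
Qed.

Lemma extE f s : ages M s -> ext f s = f s.
Proof. by move=> As; rewrite /ext patchE mem_set. Qed.

Lemma ext_out f s : ~ ages M s -> ext f s = 0.
Proof. by move=> As; rewrite /ext patchE memNset. Qed.

Lemma ext_neg f s : s < 0 -> ext f s = 0.
Proof. by move=> s0; apply: ext_out => -[]; rewrite leNgt s0. Qed.

Lemma ext_cst a f s : ext (fun x => a * f x) s = a * ext f s.
Proof. by rewrite /ext !patchE; case: ifP => //; rewrite mulr0. Qed.

Lemma extD f g s : ext (fun x => f x + g x) s = ext f s + ext g s.
Proof. by rewrite /ext !patchE; case: ifP => //; rewrite addr0. Qed.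

Lemma extB f g s : ext (fun x => f x - g x) s = ext f s - ext g s.
Proof. by rewrite /ext !patchE; case: ifP => //; rewrite subr0. Qed.

Lemma extM f g s : ext (fun x => f x * g x) s = ext f s * ext g s.
Proof. by rewrite /ext !patchE; case: ifP => //; rewrite mulr0. Qed.

Lemma eq_ext f g : (forall s, ages M s -> f s = g s) -> ext f = ext g.
Proof.
move=> fg; apply/funext => s; rewrite /ext !patchE; case: ifP => //.
by rewrite inE => /fg.
Qed.

Lemma measurable_ext f : measurable_fun (ages M) f <-> measurable_fun setT (ext f).
Proof. by split; move/(measurable_restrictT _ measurable_ages). Qed.

Lemma Lp2P f : Lp_ages M 2%:E f <-> L2 leb (ext f).
Proof. exact: Lfun2P. Qed.

Lemma pair_agesE f g : pair_ages M f g = \int[leb]_s (ext f s * ext g s).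
Proof.
rewrite /pair_ages Rintegral_mkcond; apply: eq_Rintegral => s _.
by rewrite -extM.
Qed.

Lemma ae_ext f g : ae_ages M (fun s => f s = g s) -> {ae leb, forall s, ext f s = ext g s}.
Proof.
apply: aeS => s /= h; rewrite /ext !patchE; case: ifP => //.
by rewrite inE => /h.
Qed.

Definition prim G s := \int[leb]_x (box s x * G x).

Lemma integ_boxM s G : L2 leb G -> integ leb (fun x => box s x * G x).
Proof. by move=> lG; exact: L2_mul (L2_box s) lG. Qed.

Lemma ae_neq (s : R) : {ae leb, forall x, x != s}.
Proof.
exists [set s]; split => //; first exact: lebesgue_measure_set1.
by move=> x /= /negP; rewrite negbK => /eqP.
Qed.

Lemma primD G s h : L2 leb G -> 0 <= s -> 0 <= h ->
  prim G (s + h) - prim G s = \int[leb]_x (box h x * G (x + s)).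
Proof.
move=> lG s0 h0; rewrite /prim.
rewrite -RintegralB//; [|exact: integ_boxM|exact: integ_boxM].
have lGs := L2_shift s lG.
transitivity (\int[leb]_x (box h (x - s) * G x)); last first.
  rewrite -(Rint_shift s); last first.
    apply: measurable_funM; last by case: lG.
    exact: (measurable_fun_shift (- s) (measurable_box h)).
  by apply: eq_Rintegral => x _; rewrite addrK.
apply: ae_Rint.
- by apply: measurable_funB; apply: measurable_funM;
    solve [exact: measurable_box | by case: lG].
- apply: measurable_funM; last by case: lG.
  exact: (measurable_fun_shift (- s) (measurable_box h)).
(* At [x = s] the difference of the boxes is 0 while [box h 0] is 1; the kernels agree everywhere
   else. *)
apply: aeS (ae_neq s) => x xs; rewrite -mulrBl; congr (_ * _).
rewrite /box subr_ge0 lerBlDr [h + s]addrC.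
have [x0|x0] := leP 0 x => /=; last first.
  by rewrite subrr leNgt (lt_le_trans x0 s0).
by have [xs'|xs'|xs'] := ltgtP x s; rewrite ?subrr ?subr0//=;
  [rewrite (le_trans (ltW xs') _) ?lerDl ?subrr//|move: xs; rewrite xs' eqxx].
Qed.

Lemma prim_itv G s : \int[leb]_(x in `[0, s]) G x = prim G s.
Proof. exact: Rint_itv_box. Qed.

Lemma prim_ext g s : ages M s -> prim (ext g) s = \int[leb]_(x in `[0, s]) g x.
Proof.
move=> As; rewrite Rint_itv_box; apply: eq_Rintegral => x _.
rewrite /box; case: ifP => [/andP[x0 xs]|_]; last by rewrite !mul0r.
by rewrite !mul1r extE//; exact: ages_le As _ _.
Qed.

(** A relation instead of the chosen [weak_derivative], so that derivatives of combinations,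
    translates and resolvents can be exhibited explicitly. *)
Definition wderiv f g := L2 leb (ext g) /\ forall s, ages M s -> f s = f 0 + prim (ext g) s.

Lemma wderivP f g : wderiv f g <-> Lp_ages M 2%:E g /\ primitive_of M f g.
Proof.
split=> -[/Lp2P lg fg]; split=> // s As; rewrite fg// prim_ext//.
Qed.

Lemma H1P f : H1 M f <-> L2 leb (ext f) /\ exists g, wderiv f g.
Proof.
split=> [[/Lp2P lf [g lg fg]]|[lf [g /wderivP[lg fg]]]]; split=> //.
- by exists g; apply/wderivP.
- exact/Lp2P.
- by exists g.
Qed.

Lemma VP f : V M f <->
  [/\ L2 leb (ext f), exists g, wderiv f g & vanishes_at_sbar M f].
Proof.
split=> [[/H1P[]]//|[lf fg vf]]; split=> //; exact/H1P.
Qed.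

Lemma out_agesP s : 0 <= s -> ~ ages M s -> exists b : R, sbar M = b%:E /\ b < s.
Proof.
rewrite /ages => s0; case: (sbar M) sbar_ge0 => [b||] // _ h.
- by exists b; split=> //; rewrite ltNge; apply/negP => sb; apply: h; split=> //; rewrite lee_fin.
- by exfalso; apply: h; split=> //; exact: leey.
Qed.

End ages_space.

(** * Schur test for integral operators with kernel [q ^ 2] *)

Section schur_test.
Context (R : realType).
Local Notation leb := (@lebesgue_measure R).
Variables (q : R * R -> R) (C : R).
Hypothesis mq : measurable_fun setT q.
Hypothesis q0 : forall z, 0 <= q z.
Hypothesis q1 : forall z, q z <= 1.
Hypothesis qr : forall s, L2 leb (fun t => q (s, t)) /\
  \int[leb]_t (q (s, t) ^+ 2) <= C.
Hypothesis qc : forall t, L2 leb (fun s => q (s, t)) /\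
  \int[leb]_s (q (s, t) ^+ 2) <= C.

Lemma schur_row f s : L2 leb f -> L2 leb (fun t => q (s, t) * f t).
Proof.
move=> lf; have [mf _] := lf; apply: L2_le lf.
  by apply: measurable_funM => //; exact: measurable_fun_pair2.
by move=> t; rewrite normrM ler_piMl// ger0_norm.
Qed.

Lemma schur_row_integ f s : L2 leb f -> integ leb (fun t => q (s, t) ^+ 2 * f t).
Proof.
move=> lf; under eq_fun => t do rewrite expr2 -mulrA.
by apply: L2_mul; [exact: (qr s).1 | exact: schur_row].
Qed.

Lemma schur_measurable f : measurable_fun setT f ->
  measurable_fun setT (fun z : R * R => q z ^+ 2 * f z.2).
Proof.
move=> mf; apply: measurable_funM; first exact: measurable_funX.
exact: (measurableT_comp mf measurable_snd).
Qed.

(** Cauchy-Schwarz on [q * (q * f)] bounds the squared transform by [C] times the integral of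
    [q^2 f^2]; by Tonelli and the column bound, the latter has integral at most [C] times that of
    [f^2]. The kernel is given by its square root to make this splitting explicit. *)
Lemma schur_test f : L2 leb f ->
  L2 leb (fun s => \int[leb]_t (q (s, t) ^+ 2 * f t)).
Proof.
move=> lf; have [mf fi] := lf.
have mI : measurable_fun setT (fun s => \int[leb]_t (q (s, t) ^+ 2 * f t)).
  apply: (measurable_Rint_param (m2 := leb) (fun z => q z ^+ 2 * f z.2)).
  exact: schur_measurable.
have C0 : 0 <= C.
  by apply: le_trans (qr 0).2; apply: Rintegral_ge0 => t _; exact: sqr_ge0.
pose J s := \int[leb]_t (q (s, t) ^+ 2 * f t ^+ 2).
have mff : measurable_fun setT (fun z : R * R => q z ^+ 2 * f z.2 ^+ 2).
  by apply: (schur_measurable (f := fun t => f t ^+ 2)); exact: measurable_funX.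
have iJ : integ leb J.
  have [] // := Rfubini (m1 := leb) (m2 := leb) (fun z => q z ^+ 2 * f z.2 ^+ 2) mff.
  rewrite [ltLHS](_ : _ =
      \int[leb]_s \int[leb]_t (q (s, t) ^+ 2 * f t ^+ 2)%:E)%E; last first.
    apply: eq_integral => s _; apply: eq_integral => t _.
    by rewrite ger0_norm// mulr_ge0// sqr_ge0.
  rewrite (fubini_tonelli (m1 := leb) (m2 := leb) (fun z => (q z ^+ 2 * f z.2 ^+ 2)%:E))/=; last 2 first.
  - exact/measurable_EFinP.
  - by move=> z; rewrite lee_fin mulr_ge0 ?sqr_ge0.
  apply: (@le_lt_trans _ _ (\int[leb]_t (C * f t ^+ 2)%:E)%E); last first.
    by apply: integrable_lty => //; exact: (integZ C fi).
  apply: le_integral_pointwise => t _.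
  have [lq qC] := qc t.
  have -> : (\int[leb]_s (q (s, t) ^+ 2 * f t ^+ 2)%:E =
             (\int[leb]_s (q (s, t) ^+ 2 * f t ^+ 2))%:E)%E.
    rewrite EFin_Rint//; under eq_fun => s do rewrite mulrC.
    by apply: integZ; case: lq.
  rewrite RintegralZr//; last by case: lq.
  by rewrite lee_fin ler_wpM2r// sqr_ge0.
split=> //; apply: (integ_le _ _ (integZ C iJ)).
  exact: measurable_funX.
move=> s; have [lq qC] := qr s.
have -> : \int[leb]_t (q (s, t) ^+ 2 * f t) =
    \int[leb]_t (q (s, t) * (q (s, t) * f t)).
  by apply: eq_Rintegral => t _; rewrite expr2 mulrA.
have lr := schur_row s lf.
rewrite normrX; apply: (@le_trans _ _
  ((nrm leb (fun t => q (s, t)) * nrm leb (fun t => q (s, t) * f t)) ^+ 2)).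
  by rewrite lerXn2r ?nnegrE ?mulr_ge0 ?nrm_ge0//; exact: cauchy_schwarz.
rewrite exprMn !sqr_nrm /J.
have -> : \int[leb]_t ((q (s, t) * f t) ^+ 2) = \int[leb]_t (q (s, t) ^+ 2 * f t ^+ 2).
  by apply: eq_Rintegral => t _; rewrite exprMn.
by apply: ler_wpM2r => //; apply: Rintegral_ge0 => t _; rewrite mulr_ge0 ?sqr_ge0.
Qed.

End schur_test.

Section schur_fubini.
Context (R : realType).
Local Notation leb := (@lebesgue_measure R).
Variables (q : R * R -> R) (C : R).
Hypothesis mq : measurable_fun setT q.
Hypothesis q0 : forall z, 0 <= q z.
Hypothesis q1 : forall z, q z <= 1.
Hypothesis qr : forall s, L2 leb (fun t => q (s, t)) /\
  \int[leb]_t (q (s, t) ^+ 2) <= C.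
Hypothesis qc : forall t, L2 leb (fun s => q (s, t)) /\
  \int[leb]_s (q (s, t) ^+ 2) <= C.

(** The double integral converges absolutely because the transform of [|f|] is in L^2 and can be
    paired with [g]. *)
Lemma schur_fubini f g : L2 leb f -> L2 leb g ->
  \int[leb]_s (g s * \int[leb]_t (q (s, t) ^+ 2 * f t)) =
  \int[leb]_t (f t * \int[leb]_s (q (s, t) ^+ 2 * g s)).
Proof.
move=> lf lg; have [mf fi] := lf; have [mg gi] := lg.
pose h (z : R * R) := g z.1 * (q z ^+ 2 * f z.2).
have mh : measurable_fun setT h.
  apply: measurable_funM; first exact: (measurableT_comp mg measurable_fst).
  exact: schur_measurable.
have mqt : measurable_fun setT (fun z : R * R => q (z.2, z.1)).
  apply: (measurableT_comp mq); apply: measurable_fun_pair;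
    [exact: measurable_snd|exact: measurable_fst].
have lI := schur_test mq q0 q1 qr qc (L2_norm lf).
have gl := integ_norm (L2_mul lg lI).
have [|_ _ _ _] := Rfubini (m1 := leb) (m2 := leb) h mh.
  apply: le_lt_trans (integrable_lty measurableT gl).
  apply: le_integral_pointwise => s _ /=.
  have ir := schur_row_integ mq q0 q1 qr s (L2_norm lf).
  have -> : (\int[leb]_t `|h (s, t)|%:E =
      (\int[leb]_t (`|g s| * (q (s, t) ^+ 2 * `|f t|)))%:E)%E.
    rewrite EFin_Rint; last exact: integZ.
    apply: eq_integral => t _; rewrite /h normrM (normrM (_ ^+ 2)).
    by rewrite (ger0_norm (sqr_ge0 _)).
  rewrite RintegralZl// lee_fin normrM ler_wpM2l//.
  exact: ler_norm.
move=> e; transitivity (\int[leb]_x (\int[leb]_y h (x, y))).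
  apply: eq_Rintegral => s _; rewrite /h/= RintegralZl//.
  exact: schur_row_integ.
rewrite {}e; apply: eq_Rintegral => t _; rewrite /h/= -RintegralZl//.
  by apply: eq_Rintegral => s _; ring.
exact: (schur_row_integ mqt (fun z => q0 _) (fun z => q1 _) qc).
Qed.

End schur_fubini.

(** * The resolvent of the translations and its transpose *)

Section exponential_kernel.
Context (R : realType).
Local Notation leb := (@lebesgue_measure R).
Variable k : R.
Hypothesis k0 : 0 < k.
Implicit Types F G U : R -> R.

Lemma Rint_opp (f : R -> R) : measurable_fun setT f ->
  \int[leb]_x f (- x) = \int[leb]_x f x.
Proof.
have ms : measurable_fun setT (-%R : measurableTypeR R -> measurableTypeR R) by [].
have H (g : R -> \bar R) : measurable_fun setT g -> (forall x, (0 <= g x)%E) ->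
    (\int[leb]_x g (- x)%R = \int[leb]_x g x)%E.
  move=> mg g0; rewrite -[LHS](@ge0_integral_pushforward _ _ _ _ R _ ms leb setT g)//.
  by apply: eq_measure_integral => A mA _; exact: lebesgue_measureN.
move=> mf; congr fine; have mfE : measurable_fun setT (EFin \o f) by exact/measurable_EFinP.
rewrite integralE [RHS]integralE -(H ((EFin \o f)^\+)%E)//; last exact: measurable_funepos.
rewrite -(H ((EFin \o f)^\-)%E)//; last exact: measurable_funeneg.
by congr (_ - _)%E; apply: eq_integral => x _; rewrite ?funeposE ?funenegE.
Qed.

(** The Laplace transform at [k] of the left translates of [F], that is, their resolvent; [Cov] is
    its transpose, a causal convolution. Both kernels are the square of [hexp (k / 2)], as the Schur
    test wants. *)
Definition Res F s := \int[leb]_t (hexp k (t - s) * F t).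

Definition Cov U s := \int[leb]_t (hexp k (s - t) * U t).

Let q (z : R * R) := hexp (k / 2) (z.2 - z.1).

Let mq : measurable_fun setT q.
Proof.
apply: (measurableT_comp (measurable_hexp _)); apply: measurable_funB;
  [exact: measurable_snd|exact: measurable_fst].
Qed.

Let q0 z : 0 <= q z. Proof. exact: hexp_ge0. Qed.

Let k20 : 0 < k / 2. Proof. by rewrite divr_gt0. Qed.

Let q1 z : q z <= 1. Proof. by apply: hexp_le1; exact: ltW. Qed.

Let qq z : q z ^+ 2 = hexp k (z.2 - z.1).
Proof. by rewrite expr2 -hexpD -splitr. Qed.

Let qr s : L2 leb (fun t => q (s, t)) /\ \int[leb]_t (q (s, t) ^+ 2) <= k^-1.
Proof.
split; first exact: (L2_shift (- s) (L2_hexp k20)).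
under eq_Rintegral => t _ do rewrite qq/=.
by rewrite (Rint_shift (- s) (measurable_hexp k)) Rint_hexp.
Qed.

Let qc t : L2 leb (fun s => q (s, t)) /\ \int[leb]_s (q (s, t) ^+ 2) <= k^-1.
Proof.
have e : \int[leb]_s (q (s, t) ^+ 2) = k^-1.
  under eq_Rintegral => s _ do rewrite qq/=.
  rewrite -Rint_opp; last first.
    apply: (measurableT_comp (measurable_hexp _)); exact: measurable_funB.
  under eq_Rintegral => s _ do rewrite opprK [t + s]addrC.
  by rewrite (Rint_shift t (measurable_hexp k)) Rint_hexp.
have mqc : measurable_fun setT (fun s => q (s, t)) by exact: measurable_fun_pair1.
split; last by rewrite e.
split=> //; apply/integ_ltyP; split; first exact: measurable_funX.
(* An infinite integral would have real value 0 by convention, against the value [k^-1] just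
   computed. *)
rewrite ltey; apply/eqP => i.
suff : (0:R) = k^-1 by apply/eqP; rewrite lt_eqF// invr_gt0.
rewrite -e /Rintegral -[LHS]/(fine +oo%E) -i; congr fine.
by apply: eq_integral => s _; rewrite ger0_norm ?sqr_ge0.
Qed.

Lemma Res_integ F s : L2 leb F -> integ leb (fun t => hexp k (t - s) * F t).
Proof.
move=> lF; under eq_fun => t do rewrite -[hexp _ _](qq (s, t)).
exact: (schur_row_integ mq q0 q1 qr).
Qed.

Lemma Cov_integ U s : L2 leb U -> integ leb (fun t => hexp k (s - t) * U t).
Proof.
move=> lF; under eq_fun => t do rewrite -[hexp _ _](qq (t, s)).
apply: (schur_row_integ (q := fun z => q (z.2, z.1)) _ (fun z => q0 _) (fun z => q1 _) qc) => //.
by apply: (measurableT_comp mq); apply: measurable_fun_pair;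
    [exact: measurable_snd|exact: measurable_fst].
Qed.

Lemma Res_shift F s : measurable_fun setT F ->
  Res F s = \int[leb]_t (hexp k t * F (t + s)).
Proof.
move=> mF; rewrite /Res -(Rint_shift s); last first.
  by apply: measurable_funM => //; exact: (measurable_fun_shift (- s) (measurable_hexp k)).
by apply: eq_Rintegral => t _; rewrite addrK.
Qed.

Lemma L2_Res F : L2 leb F -> L2 leb (Res F).
Proof.
move=> lF; have := schur_test mq q0 q1 qr qc lF.
by congr L2; apply/funext => s; apply: eq_Rintegral => t _; rewrite qq.
Qed.

Lemma L2_Cov U : L2 leb U -> L2 leb (Cov U).
Proof.
have mqt : measurable_fun setT (fun z : R * R => q (z.2, z.1)).
  by apply: (measurableT_comp mq); apply: measurable_fun_pair;
    [exact: measurable_snd|exact: measurable_fst].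
move=> lU; have := schur_test mqt (fun z => q0 _) (fun z => q1 _) qc qr lU.
by congr L2; apply/funext => s; apply: eq_Rintegral => t _; rewrite qq.
Qed.

Lemma Res_Cov F U : L2 leb F -> L2 leb U ->
  \int[leb]_s (F s * Cov U s) = \int[leb]_s (Res F s * U s).
Proof.
move=> lF lU; have := schur_fubini mq q0 q1 qr qc lF lU.
move=> e; under [RHS]eq_Rintegral => s _ do rewrite mulrC.
transitivity (\int[leb]_t (F t * \int[leb]_s (q (s, t) ^+ 2 * U s))).
  by apply: eq_Rintegral => s _; congr (_ * _); apply: eq_Rintegral => t _; rewrite qq.
rewrite -e; apply: eq_Rintegral => s _; congr (_ * _).
by apply: eq_Rintegral => t _; rewrite qq.
Qed.

End exponential_kernel.

(** * Sobolev estimates in V *)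

Section V_theory.
Context (R : realType) (M : vintage_model R).
Hypothesis sbar_ge0 : (0 <= sbar M)%E.
Local Notation leb := (@lebesgue_measure R).
Local Notation ext := (ext M).
Implicit Types f g F G : R -> R.

Lemma L2_box_shift G s h : L2 leb G -> integ leb (fun x => box h x * G (x + s)).
Proof. by move=> lG; apply: L2_mul (L2_box h) (L2_shift s lG). Qed.

Lemma prim_le G s h : L2 leb G -> 0 <= h ->
  `|\int[leb]_x (box h x * G (x + s))| <= Num.sqrt h * nrm leb G.
Proof.
move=> lG h0; rewrite -(nrm_box h0) -(nrm_shift s (L2_measurable lG)).
by apply: cauchy_schwarz; [exact: L2_box | exact: L2_shift].
Qed.

(* Past [sbar], both sides vanish because of the boundary condition. *)
Lemma V_ext_prim f g s : V M f -> wderiv M f g -> 0 <= s ->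
  ext f s = f 0 + prim (ext g) s.
Proof.
move=> [_ vf] [lg fg] s0; have [As|nAs] := pselect (ages M s).
  by rewrite extE// fg.
rewrite ext_out//; have [b [eb bs]] := out_agesP sbar_ge0 s0 nAs.
have b0 : 0 <= b by move: sbar_ge0; rewrite eb lee_fin.
have Ab : ages M b by split=> //; rewrite eb.
move: vf; rewrite /vanishes_at_sbar eb => fb.
transitivity (f b); first by rewrite fb.
rewrite fg//; congr (_ + _); rewrite /prim; apply: eq_Rintegral => x _.
have [Ax|nAx] := pselect (ages M x); last by rewrite ext_out// !mulr0.
congr (_ * _); case: Ax => x0; rewrite eb lee_fin => xb.
by rewrite /box x0 xb (le_trans xb (ltW bs)).
Qed.

Lemma ext_increment f g s h : V M f -> wderiv M f g -> 0 <= s -> 0 <= h ->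
  ext f (s + h) - ext f s = \int[leb]_x (box h x * ext g (x + s)).
Proof.
move=> Vf fg s0 h0; rewrite -primD//; last by case: fg.
rewrite !(V_ext_prim Vf fg)// ?addr_ge0//; ring.
Qed.

Lemma ext_increment_le f g s h : V M f -> wderiv M f g -> 0 <= s -> 0 <= h ->
  `|ext f (s + h) - ext f s| <= Num.sqrt h * nrm leb (ext g).
Proof.
by move=> Vf fg s0 h0; rewrite (ext_increment Vf fg)//; apply: prim_le => //; case: fg.
Qed.

Lemma V_L2 f : V M f -> L2 leb (ext f).
Proof. by move=> /VP[]. Qed.

Lemma V_wderiv f : V M f -> exists g, wderiv M f g.
Proof. by move=> /VP[]. Qed.

(** Sobolev embedding: [f s] is compared with its mean over the unit interval that starts at [s].
    This interval may pass [sbar], where the boundary condition keeps the extension by zero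
    absolutely continuous. *)
Lemma ext_bound f g s : V M f -> wderiv M f g ->
  `|ext f s| <= nrm leb (ext f) + nrm leb (ext g).
Proof.
move=> Vf fg; have lf := V_L2 Vf; have [s0|s0] := leP 0 s; last first.
  by rewrite ext_neg// normr0 addr_ge0 ?nrm_ge0.
have i1 := integ_norm (L2_box_shift s 1 lf).
have -> : `|ext f s| = \int[leb]_h (`|ext f s| * box 1 h).
  by rewrite RintegralZl ?Rint_box ?mulr1//; exact: integ_box.
apply: (@le_trans _ _ (\int[leb]_h (`|box 1 h * ext f (h + s)| + nrm leb (ext g) * box 1 h))).
  apply: le_Rintegral => //; first exact: (integZ _ (integ_box _)).
    by apply: integD => //; exact: (integZ _ (integ_box _)).
  move=> h _; rewrite /box; case: ifPn => [/andP[h0 h1]|_]; last first.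
    by rewrite mul0r normr0 !mulr0 addr0.
  rewrite !mulr1 mul1r addrC -lerBlDr; apply: le_trans (lerB_dist _ _) _.
  rewrite distrC [h + s]addrC; apply: le_trans (ext_increment_le Vf fg s0 h0) _.
  by rewrite ler_piMl ?nrm_ge0// -sqrtr1 ler_wsqrtr.
rewrite RintegralD//; last exact: (integZ _ (integ_box _)).
rewrite RintegralZl ?Rint_box ?mulr1 ?lerD2r//; last exact: integ_box.
rewrite (_ : nrm leb (ext f) = nrm leb (box 1) * nrm leb (fun h => ext f (h + s))).
  by apply: cauchy_schwarz_norm; [exact: L2_box | exact: L2_shift].
by rewrite nrm_box// sqrtr1 mul1r nrm_shift//; case: lf.
Qed.

(** By Lebesgue differentiation a primitive has derivative [D] almost everywhere, and a vanishing
    one has derivative 0. This makes weak derivatives unique. *)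
Lemma prim_eq0 (D : R -> R) : L2 leb D -> (forall s, 0 <= s -> prim D s = 0) ->
  {ae leb, forall x, 0 < x -> D x = 0}.
Proof.
move=> lD pD.
have iD y : leb.-integrable [set` Interval (BLeft 0) (BRight y)] (EFin \o D).
  apply/integrable_mkcond => //; have := integ_boxM y lD.
  congr (integrable _ _ _); apply/funext => x /=.
  rewrite /box patchE mem_setE in_itv/=.
  by case: ifP; rewrite ?mul1r ?mul0r.
have locD : locally_integrable setT D.
  split; [by case: lD|exact: openT|move=> K _ cK].
  have [a [b KS]] : exists a b : R, K `<=` `[a, b].
    have [N [_ KN]] := compact_bounded cK.
    exists (- (N + 1)), (N + 1) => x Kx.
    by rewrite /= in_itv/= -ler_norml; apply: (KN (N + 1)) => //; rewrite ltrDl.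
  have iab : leb.-integrable `[a, b] (EFin \o D).
    have [ab|ba] := leP a b; last first.
      by rewrite set_itv_ge ?bnd_simp -?ltNge//; exact: integrable_set0.
    apply/integrable_mkcond => //.
    have := L2_mul (L2_shift (- a) (L2_box (b - a))) lD.
    congr (integrable _ _ _); apply/funext => x /=.
    rewrite /box patchE mem_setE in_itv/= subr_ge0 lerD2r.
    by case: ifP; rewrite ?mul1r ?mul0r.
  have mK : measurable (K : set R) by exact: compact_measurable.
  suff /integrableP[] : leb.-integrable K (EFin \o D) by [].
  by apply: integrableS iab.
have := FTC1 iD locD.
apply: aeS => x /= h x0; move: (x0); rewrite -lte_fin => /h[_ <-].
have e : \near x, (\int[leb]_(t in [set` Interval (BLeft 0) (BRight x)]) D t) = (cst 0 x : R^o).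
  near=> y; rewrite /= prim_itv pD//; apply/ltW.
  by near: y; exact: lt_nbhsr.
by rewrite derive1E (near_eq_derive _ e) derive_cst.
Unshelve. all: end_near. Qed.

End V_theory.

(** * Stability of V under the semigroup and the resolvent *)

Section V_closure.
Context (R : realType) (M : vintage_model R).
Hypothesis sbar_ge0 : (0 <= sbar M)%E.
Local Notation leb := (@lebesgue_measure R).
Local Notation ext := (ext M).
Local Notation T := (adjoint_semigroup M).
Implicit Types f g F G : R -> R.

Lemma wderiv_unique f g1 g2 : V M f -> wderiv M f g1 -> wderiv M f g2 ->
  {ae leb, forall x, ext g1 x = ext g2 x}.
Proof.
move=> Vf w1 w2; have [l1 _] := w1; have [l2 _] := w2.
have lD := L2B l1 l2.
have : {ae leb, forall x, 0 < x -> ext g1 x - ext g2 x = 0}.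
  apply: prim_eq0 lD _ => s s0; rewrite /prim.
  under eq_Rintegral => x _ do rewrite mulrBr.
  rewrite RintegralB//; [|exact: integ_boxM|exact: integ_boxM].
  rewrite -/(prim (ext g1) s) -/(prim (ext g2) s).
  have := V_ext_prim sbar_ge0 Vf w1 s0; have := V_ext_prim sbar_ge0 Vf w2 s0; lra.
move=> h; apply: aeS (aeI h (ae_neq 0)) => x [] /=.
have [x0|x0|x0] := ltgtP x 0 => //.
- by move=> _ _; rewrite !ext_neg.
- by move=> /(_ isT) + _; lra.
Qed.

Lemma weak_derivativeP f : V M f -> wderiv M f (weak_derivative M f).
Proof.
move=> Vf; apply/wderivP; rewrite /weak_derivative.
have [g /wderivP fg] := V_wderiv Vf.
by case: xgetP => [y _ //|/(_ g)].
Qed.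

Lemma H1_normE f g : V M f -> wderiv M f g ->
  H1_norm M f = Num.sqrt (nrm leb (ext f) ^+ 2 + nrm leb (ext g) ^+ 2).
Proof.
move=> Vf fg; have wf := weak_derivativeP Vf.
rewrite /H1_norm !pair_agesE; congr Num.sqrt; congr (_ + _).
  by rewrite sqr_nrm; apply: eq_Rintegral => s _; rewrite expr2.
rewrite sqr_nrm; apply: ae_Rint.
- by apply: measurable_funM; case: wf => -[].
- by apply: measurable_funX; case: fg => -[].
- by apply: aeS (wderiv_unique Vf wf fg) => x ->; rewrite expr2.
Qed.

Lemma H1_norm_ge0 f : 0 <= H1_norm M f. Proof. exact: sqrtr_ge0. Qed.

Lemma nrm_le_H1_norm f g : V M f -> wderiv M f g ->
  nrm leb (ext f) <= H1_norm M f /\ nrm leb (ext g) <= H1_norm M f.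
Proof.
move=> Vf fg; rewrite (H1_normE Vf fg); split.
- rewrite -[leLHS](@ger0_norm R) ?nrm_ge0// -sqrtr_sqr ler_wsqrtr// lerDl sqr_ge0//.
- rewrite -[leLHS](@ger0_norm R) ?nrm_ge0// -sqrtr_sqr ler_wsqrtr// lerDr sqr_ge0//.
Qed.

Lemma ext_le_H1_norm f s : V M f -> `|ext f s| <= 2 * H1_norm M f.
Proof.
move=> Vf; have [g fg] := V_wderiv Vf.
have := ext_bound sbar_ge0 s Vf fg; have [] := nrm_le_H1_norm Vf fg; lra.
Qed.

Lemma wderiv_comb a f1 f2 g1 g2 : wderiv M f1 g1 -> wderiv M f2 g2 ->
  wderiv M (fun s => a * f1 s + f2 s) (fun s => a * g1 s + g2 s).
Proof.
move=> [l1 e1] [l2 e2].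
have E : ext (fun s => a * g1 s + g2 s) = (fun s => a * ext g1 s + ext g2 s).
  by apply/funext => s; rewrite extD ext_cst.
rewrite /wderiv E; split; first exact: L2D (L2Z a l1) l2.
move=> s As; rewrite e1// e2// /prim.
have -> : \int[leb]_x (box s x * (a * ext g1 x + ext g2 x)) =
    a * \int[leb]_x (box s x * ext g1 x) + \int[leb]_x (box s x * ext g2 x).
  rewrite -RintegralZl//; last exact: integ_boxM.
  rewrite -RintegralD//; [|apply: integZ; exact: integ_boxM|exact: integ_boxM].
  by apply: eq_Rintegral => x _; ring.
by rewrite /prim; ring.
Qed.

Lemma V_comb a f1 f2 : V M f1 -> V M f2 -> V M (fun s => a * f1 s + f2 s).
Proof.
move=> /VP[l1 [g1 w1] v1] /VP[l2 [g2 w2] v2].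
apply/VP; split.
- rewrite (_ : ext _ = (fun s => a * ext f1 s + ext f2 s)).
    exact: L2D (L2Z a l1) l2.
  by apply/funext => s; rewrite extD ext_cst.
- by exists (fun s => a * g1 s + g2 s); exact: wderiv_comb.
- move: v1 v2; rewrite /vanishes_at_sbar; case: (sbar M) => [b||]//.
    by move=> -> ->; rewrite mulr0 addr0.
  move=> v1 v2; rewrite -[X in _ --> X]addr0 -[X in _ --> X + _](mulr0 a).
  by apply: cvgD v2; apply: cvgMl_tmp.
Qed.

Lemma V_zero : V M (fun=> 0).
Proof.
have e0 : ext (fun=> 0) = fun=> 0.
  by apply/funext => s; rewrite /ext patchE; case: ifP.
have l0 : L2 leb (fun=> 0).
  by split => //; under eq_fun => x do rewrite expr0n; exact: integ0.
apply/VP; split; rewrite ?e0//.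
- exists (fun=> 0); rewrite /wderiv e0; split=> // s _.
  by rewrite /prim add0r Rint_eq0// => x; rewrite mulr0.
- move: sbar_ge0; rewrite /vanishes_at_sbar; case: (sbar M) => [b||]// _.
  exact: cvg_cst.
Qed.

Lemma VZ a f : V M f -> V M (fun s => a * f s).
Proof.
move=> Vf; rewrite (_ : (fun s => _) = (fun s => a * f s + 0)).
  exact: V_comb Vf V_zero.
by apply/funext => s; rewrite addr0.
Qed.

Lemma adjoint_semigroupD t r f : 0 <= t -> 0 <= r -> T t (T r f) = T (t + r) f.
Proof.
move=> t0 r0; apply/funext => s; rewrite /adjoint_semigroup addrA.
have [h|h] := boolP ((s + t + r)%:E <= sbar M)%E; last first.
  by case: ifP; rewrite ?mulr0.
rewrite (le_trans _ h) ?lee_fin ?lerDl//.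
by rewrite mulrA -expRD mulrDr.
Qed.

(** On nonnegative ages the cut at [sbar] is absorbed by the extension by zero: the semigroup is a
    damped left translation of the line. *)
Lemma ext_T t f s : 0 <= t ->
  ext (T t f) s = if 0 <= s then expR (- mu M * t) * ext f (s + t) else 0.
Proof.
move=> t0; case: ifPn => s0; last by rewrite ext_neg// ltNge.
have [A|nA] := pselect (ages M (s + t)).
  have As : ages M s by apply: (ages_le A) => //; rewrite lerDl.
  by rewrite !extE// /adjoint_semigroup (proj2 A).
rewrite (ext_out _ nA) mulr0; have [As|nAs] := pselect (ages M s).
  rewrite extE// /adjoint_semigroup ifN//.
  by apply/negP => h; apply: nA; split=> //; rewrite addr_ge0.
by rewrite ext_out.
Qed.

Lemma L2_T t f : 0 <= t -> L2 leb (ext f) -> L2 leb (ext (T t f)).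
Proof.
move=> t0 lf.
apply: (L2_le _ _ (L2Z (expR (- mu M * t)) (L2_shift t lf))).
  rewrite (_ : ext (T t f) =
    (fun s => if 0 <= s then expR (- mu M * t) * ext f (s + t) else 0)); last first.
    by apply/funext => s; rewrite ext_T.
  apply: measurable_fun_ifT => //; first exact: measurable_nonneg.
  apply: measurable_funM => //; exact: measurable_fun_shift (L2_measurable lf).
by move=> s; rewrite ext_T//; case: ifP => // _; rewrite normr0.
Qed.

Lemma nrm_T t f : 0 <= t -> L2 leb (ext f) ->
  nrm leb (ext (T t f)) <= expR (- mu M * t) * nrm leb (ext f).
Proof.
move=> t0 lf; rewrite -(nrm_shift t (L2_measurable lf)).
have ls := L2_shift t lf.
rewrite -[X in X * _](@ger0_norm R) ?expR_ge0// -nrmZ//.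
apply: le_nrm; [exact: L2_T|exact: L2Z|apply: aeT => s].
by rewrite ext_T//; case: ifP => // _; rewrite normr0.
Qed.

(** The cut of [T t f] at [sbar - t] creates no jump since [f] vanishes at [sbar]: the increments of
    [ext f] are integrals of [ext g] on the whole half-line. *)
Lemma wderiv_T t f g : 0 <= t -> V M f -> wderiv M f g -> wderiv M (T t f) (T t g).
Proof.
move=> t0 Vf fg; have [lg _] := fg; split; first exact: L2_T.
move=> s As; have s0 : 0 <= s by case: As.
have A0 : ages M 0 by exact: ages0.
rewrite -(extE _ As) -(extE (T t f) A0) !ext_T// lexx s0 add0r.
suff <- : expR (- mu M * t) * (ext f (t + s) - ext f t) = prim (ext (T t g)) s.
  by rewrite [s + t]addrC; ring.
rewrite (ext_increment sbar_ge0 Vf fg)// -RintegralZl//; last exact: L2_box_shift.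
rewrite /prim; apply: eq_Rintegral => x _; rewrite /box ext_T//.
by case: ifP => [/andP[-> _]|]; rewrite ?mul1r ?mul0r ?mulr0.
Qed.

Lemma V_T t f : 0 <= t -> V M f -> V M (T t f).
Proof.
move=> t0 Vf; have [g fg] := V_wderiv Vf.
apply/VP; split.
- exact: L2_T (V_L2 Vf).
- by exists (T t g); exact: wderiv_T.
- case: Vf => _; rewrite /vanishes_at_sbar /adjoint_semigroup.
  case: (sbar M) => [b||]//.
    rewrite lee_fin => fb; case: ifP => // h.
    have -> : b + t = b by apply/le_anti; rewrite h lerDl t0.
    by rewrite fb mulr0.
  move=> v; under eq_fun => s do rewrite leey.
  rewrite -(mulr0 (expR (- mu M * t))); apply: cvgMl_tmp.
  exact: (cvg_comp (fun x => x + t) f (cvg_addrr t) v).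
Qed.

Lemma H1_norm_T t f : 0 <= t -> V M f ->
  H1_norm M (T t f) <= expR (- mu M * t) * H1_norm M f.
Proof.
move=> t0 Vf; have [g fg] := V_wderiv Vf; have [lg _] := fg.
rewrite (H1_normE (V_T t0 Vf) (wderiv_T t0 Vf fg)) (H1_normE Vf fg).
rewrite -[X in X * Num.sqrt _](@ger0_norm R) ?expR_ge0// -sqrtr_sqr -sqrtrM ?sqr_ge0//.
rewrite ler_wsqrtr// mulrDr -!exprMn lerD// lerXn2r ?nnegrE ?mulr_ge0 ?expR_ge0 ?nrm_ge0//;
  apply: nrm_T => //; exact: (V_L2 Vf).
Qed.

Lemma L2_ext f : L2 leb f -> L2 leb (ext f).
Proof.
move=> lf; have [mf _] := lf; apply: L2_le lf => [|s].
  by apply/(measurable_ext sbar_ge0); exact: measurable_funTS.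
by rewrite /ext patchE; case: ifP; rewrite ?normr0.
Qed.

Variable k : R.
Hypothesis k0 : 0 < k.

(** Each translate of [ext f] has increments that are integrals of [ext g]; Fubini exchanges them
    with the Laplace integral. *)
Lemma Res_increment f g s : V M f -> wderiv M f g -> 0 <= s ->
  Res k (ext f) s - Res k (ext f) 0 = \int[leb]_x (box s x * Res k (ext g) x).
Proof.
move=> Vf fg s0; have lf := V_L2 Vf; have [lg _] := fg.
have [mf _] := lf; have [mg _] := lg.
have i1 x : integ leb (fun t => hexp k t * ext f (t + x)).
  by have := integ_shift x (Res_integ k0 x lf); under eq_fun => t do rewrite addrK.
have iG x : integ leb (fun t => hexp k t * ext g (t + x)).
  by have := integ_shift x (Res_integ k0 x lg); under eq_fun => t do rewrite addrK.
rewrite !Res_shift// -RintegralB//; [|exact: i1|exact: i1].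
pose h (z : R * R) := box s z.1 * (hexp k z.2 * ext g (z.2 + z.1)).
have mh : measurable_fun setT h.
  apply: measurable_funM; first exact: (measurableT_comp (measurable_box s) measurable_fst).
  apply: measurable_funM; first exact: (measurableT_comp (measurable_hexp k) measurable_snd).
  by apply: (measurableT_comp mg); apply: measurable_funD;
    [exact: measurable_snd|exact: measurable_fst].
have [|_ _ _ _ e] := Rfubini (m1 := leb) (m2 := leb) h mh.
  have lr := L2_Res k0 (L2_norm lg).
  apply: le_lt_trans (integrable_lty measurableT (L2_mul (L2_box s) lr)).
  apply: le_integral_pointwise => x _ /=.
  have ig : integ leb (fun t => hexp k t * `|ext g (t + x)|).
    have := integ_norm (iG x).
    by under eq_fun => t do rewrite normrM (ger0_norm (hexp_ge0 _ _)).
  rewrite (_ : integral _ _ _ = (\int[leb]_t (box s x * (hexp k t * `|ext g (t + x)|)))%:E).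
    by rewrite RintegralZl// Res_shift//; exact: measurableT_comp.
  rewrite EFin_Rint; last exact: integZ.
  apply: eq_integral => t _; rewrite /h/= normrM (ger0_norm (box_ge0 _ _)).
  by rewrite normrM (ger0_norm (hexp_ge0 _ _)).
transitivity (\int[leb]_t \int[leb]_x h (x, t)).
  apply: eq_Rintegral => t _; rewrite -mulrBr /h/= addr0.
  have [t0|t0] := leP 0 t; last first.
    by rewrite (hexp_neg _ t0) mul0r; apply/esym/Rint_eq0 => x; rewrite mul0r mulr0.
  rewrite (ext_increment sbar_ge0 Vf fg t0 s0) -(RintegralZl _ measurableT (L2_box_shift t s lg)).
  by apply: eq_Rintegral => x _; rewrite [t + x]addrC; ring.
rewrite -{}e; apply: eq_Rintegral => x _; rewrite /h/= (RintegralZl _ measurableT (iG x)).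
by rewrite Res_shift.
Qed.

Lemma L2_ext_Res f : L2 leb (ext f) -> L2 leb (ext (Res k (ext f))).
Proof. by move=> lf; apply: L2_ext; exact: L2_Res. Qed.

Lemma wderiv_Res f g : V M f -> wderiv M f g ->
  wderiv M (Res k (ext f)) (Res k (ext g)).
Proof.
move=> Vf fg; have [lg _] := fg; split; first exact: L2_ext_Res.
move=> s As; have s0 : 0 <= s by case: As.
have := Res_increment Vf fg s0; rewrite /prim => e.
suff <- : \int[leb]_x (box s x * Res k (ext g) x) =
    \int[leb]_x (box s x * ext (Res k (ext g)) x) by rewrite -e addrC subrK.
apply: eq_Rintegral => x _; rewrite /box.
case: ifP => [/andP[x0 xs]|_]; last by rewrite !mul0r.
by rewrite extE//; exact: (ages_le As).
Qed.

Lemma V_Res f : V M f -> V M (Res k (ext f)).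
Proof.
move=> Vf; have lf := V_L2 Vf; have [g fg] := V_wderiv Vf; have [mf _] := lf.
apply/VP; split; first exact: L2_ext_Res.
  by exists (Res k (ext g)); exact: wderiv_Res.
case: (Vf) => _; rewrite /vanishes_at_sbar.
have agesE s : 0 <= s -> (s%:E <= sbar M)%E -> ages M s by [].
case E: (sbar M) => [b||]// v.
  have b0 : 0 <= b by move: sbar_ge0; rewrite E lee_fin.
  rewrite Res_shift//; apply: Rint_eq0 => t; have [t0|t0|t0] := ltgtP t 0.
  - by rewrite hexp_neg ?mul0r.
  - rewrite ext_out ?mulr0// => -[_]; rewrite E lee_fin; lra.
  - by rewrite t0 add0r extE ?v ?mulr0//; apply: agesE; rewrite ?E.
apply/cvgrPdist_le => e e0.
(* The mass of [hexp k] is [1 / k], so a bound [k * e] on the tail of [f] integrates to [e]. *)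
have ke : 0 < k * e by rewrite mulr_gt0.
move/cvgrPdist_le : v => /(_ _ ke)[A [Areal vA]].
near=> x; rewrite sub0r normrN Res_shift//.
have x0 : 0 <= x by near: x; exact: nbhs_pinfty_ge.
have i1 : integ leb (fun t => hexp k t * ext f (t + x)).
  by have := integ_shift x (Res_integ k0 x lf); under eq_fun => t do rewrite addrK.
apply: le_trans (le_normr_Rintegral measurableT i1) _.
rewrite (_ : e = \int[leb]_t (k * e * hexp k t)); last first.
  rewrite RintegralZl//; last exact: integ_hexp.
  by rewrite Rint_hexp// mulrAC divff ?mul1r// gt_eqF.
apply: le_Rintegral => //; [exact: integ_norm|by apply: integZ; exact: integ_hexp|].
move=> t _; rewrite normrM (ger0_norm (hexp_ge0 _ _)) mulrC.
have [t0|t0] := leP 0 t; last by rewrite hexp_neg// !mulr0.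
apply: ler_wpM2r; first exact: hexp_ge0.
rewrite extE; last by apply: agesE; rewrite ?addr_ge0// E leey.
have := vA (t + x); rewrite sub0r normrN; apply.
apply: lt_le_trans (_ : x <= _); last by rewrite lerDr.
by near: x; exact: nbhs_pinfty_gt.
Unshelve. all: end_near. Qed.

(** Integration by parts in the Laplace integral, done by Fubini: [tail] writes the weight as an
    integral over thresholds [t], and integrating [ext g] up to the threshold gives the increment of
    [ext f]. *)
Lemma Res_wderiv f g s : V M f -> wderiv M f g -> 0 <= s ->
  Res k (ext g) s = k * Res k (ext f) s - ext f s.
Proof.
move=> Vf fg s0; have lf := V_L2 Vf; have [lg _] := fg.
have [mf _] := lf; have [mg _] := lg.
have i1 x : integ leb (fun t => hexp k t * ext f (t + x)).
  by have := integ_shift x (Res_integ k0 x lf); under eq_fun => t do rewrite addrK.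
have iG x : integ leb (fun t => hexp k t * ext g (t + x)).
  by have := integ_shift x (Res_integ k0 x lg); under eq_fun => t do rewrite addrK.
pose h (z : R * R) := ext g (z.1 + s) * (k * hexp k z.2 * box z.2 z.1).
have mbox : measurable_fun setT (fun z : R * R => box z.2 z.1).
  apply: measurable_fun_ifT => //; apply: measurable_and.
    by apply: measurable_fun_ler => //; exact: measurable_fst.
  by apply: measurable_fun_ler; [exact: measurable_fst|exact: measurable_snd].
have mh : measurable_fun setT h.
  apply: measurable_funM.
    apply: (measurableT_comp (measurable_fun_shift s mg)); exact: measurable_fst.
  apply: measurable_funM => //; apply: measurable_funM => //.
  exact: (measurableT_comp (measurable_hexp k) measurable_snd).
have tail x : \int[leb]_t (k * hexp k t * box t x) = hexp k x.
  have [x0|x0] := leP 0 x; last first.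
    by rewrite hexp_neg//; apply: Rint_eq0 => t; rewrite /box leNgt x0/= mulr0.
  rewrite -(Rint_hexp_tail k0 x0); apply: eq_Rintegral => t _.
  by rewrite /box x0/=; case: ifP.
have ib x : integ leb (fun t => k * hexp k t * box t x).
  apply: (integ_le _ _ (integZ k (integ_hexp k0))).
    apply: measurable_funM; first by apply: measurable_funM => //; exact: measurable_hexp.
    exact: (measurable_fun_pair2 _ mbox).
  move=> t; rewrite ger0_norm ?mulr_ge0 ?box_ge0 ?hexp_ge0 ?(ltW k0)//.
  by rewrite ler_piMr ?box_le1// mulr_ge0 ?hexp_ge0 ?(ltW k0).
rewrite !Res_shift//.
have [|_ _ _ _ e] := Rfubini (m1 := leb) (m2 := leb) h mh.
  apply: le_lt_trans (integrable_lty measurableT (integ_norm (iG s))).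
  apply: le_integral_pointwise => x _ /=.
  rewrite (_ : integral _ _ _ = (\int[leb]_t (`|ext g (x + s)| * (k * hexp k t * box t x)))%:E).
    rewrite RintegralZl//; last exact: ib.
    by rewrite tail normrM (ger0_norm (hexp_ge0 _ _)) mulrC.
  rewrite EFin_Rint; last by apply: integZ; exact: ib.
  apply: eq_integral => t _; rewrite /h/= normrM; congr (_ * _)%:E.
  by rewrite ger0_norm// ?mulr_ge0 ?box_ge0 ?hexp_ge0 ?(ltW k0).
transitivity (\int[leb]_x \int[leb]_t h (x, t)).
  apply: eq_Rintegral => x _; rewrite /h/= (RintegralZl _ measurableT (ib x)).
  by rewrite tail mulrC.
rewrite {}e.
have -> : ext f s = \int[leb]_t (k * ext f s * hexp k t).
  rewrite RintegralZl//; last exact: integ_hexp.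
  by rewrite Rint_hexp// mulrAC divff ?mul1r// gt_eqF.
rewrite -(RintegralZl _ measurableT (i1 s)) -(RintegralB measurableT (integZ k (i1 s))
  (integZ (k * ext f s) (integ_hexp k0))).
apply: eq_Rintegral => t _; rewrite /h/=.
have [t0|t0] := leP 0 t; last first.
  rewrite hexp_neg// !mulr0 mul0r mulr0 subr0.
  by apply: Rint_eq0 => x; rewrite mul0r mulr0.
transitivity (k * hexp k t * (ext f (s + t) - ext f s)).
  rewrite (ext_increment sbar_ge0 Vf fg s0 t0) -(RintegralZl _ measurableT (L2_box_shift s t lg)).
  by apply: eq_Rintegral => x _; ring.
by rewrite [s + t]addrC; ring.
Qed.

End V_closure.

(** * Equilibria of the maximum principle *)

Section real_analysis.
Context (R : realType).
Local Notation leb := (@lebesgue_measure R).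

Lemma measurable_inv : measurable_fun setT (fun x : R => x^-1).
Proof.
rewrite (_ : (fun x => x^-1) =
  (fun x => if 0 <= x then x `^ (-1) else - ((- x) `^ (-1)))); last first.
  apply/funext => x; case: ifPn => x0; first by rewrite powR_inv1.
  by rewrite powR_inv1 ?invrN ?opprK// oppr_ge0 ltW// ltNge.
apply: measurable_fun_ifT; first exact: measurable_nonneg.
  exact: measurable_powR.
apply: measurableT_comp => //.
by apply: (measurableT_comp (measurable_powR _)).
Qed.

Lemma measurable_fun_inv d (T : measurableType d) (f : T -> R) :
  measurable_fun setT f -> measurable_fun setT (fun x => (f x)^-1).
Proof. by move=> mf; exact: (measurableT_comp measurable_inv mf). Qed.

Lemma L2_le_ae d (T : measurableType d) (m : {measure set T -> \bar R})
    (f g : T -> R) : measurable_fun setT f -> {ae m, forall x, `|f x| <= `|g x|} ->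
  L2 m g -> L2 m f.
Proof.
move=> mf fg /L2_ltyP[mg gi]; apply/L2_ltyP; split=> //.
apply: le_lt_trans gi; apply: ae_ge0_le_integral => //.
- by move=> x _; rewrite lee_fin sqr_ge0.
- exact/measurable_EFinP/measurable_funX.
- by move=> x _; rewrite lee_fin sqr_ge0.
- exact/measurable_EFinP/measurable_funX.
apply: aeS fg => x /= h _.
by rewrite lee_fin -(real_normK (num_real (f x))) -(real_normK (num_real (g x))) lerXn2r ?nnegrE.
Qed.

Lemma concave_chord (f : R -> R) (a b t : R) :
  convex_function [set: R^o] ((fun r => - f r) : R^o -> R^o) ->
  0 <= t -> t <= 1 -> t * f b + (1 - t) * f a <= f (a + t * (b - a)).
Proof.
move=> cf t0 t1.
have : - f (t * b + (1 - t) * a) <= t * - f b + (1 - t) * - f a.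
  by apply: (cf (Itv01 t0 t1) b a); rewrite inE.
rewrite (_ : t * b + (1 - t) * a = a + t * (b - a)); last by ring.
lra.
Qed.

Lemma concave_tangent (f : R -> R) (a b : R) :
  convex_function [set: R^o] ((fun r => - f r) : R^o -> R^o) ->
  derivable f a 1 -> f b <= f a + derive1 f a * (b - a).
Proof.
move=> cf df; rewrite -lerBlDl.
have d : (fun h => h^-1 *: (f (h *: 1 + a) - f a)) @ 0^' --> derive1 f a.
  by rewrite derive1E; exact: df.
(* With [h] of the sign of [b - a], the ratio is a chord parameter; the one-sided limit [h -> 0] is
   then taken from the side of [b]. *)
have chord h : 0 < h / (b - a) <= 1 -> h / (b - a) * (f b - f a) <= f (h + a) - f a.
  move=> /andP[h0 h1]; have := concave_chord a b cf (ltW h0) h1.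
  have ba : b - a != 0.
    by apply/eqP => ba; move: h0; rewrite ba invr0 mulr0 ltxx.
  rewrite (_ : a + h / (b - a) * (b - a) = h + a); last by field.
  by move: (h / (b - a)) => t; lra.
have [ba|ab|->] := ltgtP b a; last by rewrite !subrr mulr0.
- rewrite -ler_ndivlMr ?subr_lt0//.
  have d' := cvg_dnbhs_at_left d; apply: (cvgr_to_le d').
  near=> h.
  have h0 : h < 0 by near: h; exact: nbhs_left_lt.
  have hb : b - a < h by near: h; apply: nbhs_left_gt; rewrite subr_lt0.
  have : 0 < h / (b - a) <= 1.
    by rewrite nmulr_lgt0 ?h0 ?invr_lt0 ?subr_lt0//= ler_ndivrMr ?subr_lt0// mul1r ltW.
  move=> /chord c; rewrite -![_ *: _]/(_ * _) mulr1 mulrC ler_ndivrMr//.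
  apply: (le_trans _ c); rewrite le_eqVlt; apply/orP; left; apply/eqP; ring.
- rewrite -ler_pdivrMr ?subr_gt0//.
  have d' := cvg_dnbhs_at_right d; apply: (cvgr_to_ge d').
  near=> h.
  have h0 : 0 < h by near: h; exact: nbhs_right_gt.
  have hb : h < b - a by near: h; apply: nbhs_right_lt; rewrite subr_gt0.
  have : 0 < h / (b - a) <= 1.
    by rewrite divr_gt0 ?subr_gt0//= ler_pdivrMr ?subr_gt0// mul1r ltW.
  move=> /chord c; rewrite -![_ *: _]/(_ * _) mulr1 [leRHS]mulrC ler_pdivlMr//.
  apply: (le_trans _ c); rewrite le_eqVlt; apply/orP; left; apply/eqP; ring.
Unshelve. all: end_near. Qed.

(** By the mean value theorem the increment is [derive1 f c * x] with [c] within [|x|] of [a]. It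
    bounds payoffs from below to second order, where concavity bounds them from above to first
    order. *)
Lemma lipschitz_lower (f : R -> R) : (forall r, derivable f r 1) ->
  [lipschitz derive1 f r | r in setT] ->
  exists2 L, 0 < L & forall a x : R, f a + derive1 f a * x - L * x ^+ 2 <= f (a + x).
Proof.
move=> df [L0 [L0r Lf]]; pose L := Num.max 1 (L0 + 1).
have LL0 : L0 < L by rewrite /L lt_max ltrDl ltr01 orbT.
have L_gt0 : 0 < L by rewrite /L lt_max ltr01.
exists L => // a x.
have lip c : `|derive1 f c - derive1 f a| <= L * `|c - a|.
  exact: (Lf L LL0 (c, a)).
have drv (c : R) : is_derive c 1 f (derive1 f c) by rewrite derive1E; exact: DeriveDef.
have cf : continuous f by move=> c; apply/differentiable_continuous/derivable1_diffP.
suff [c cx e] : exists2 c, `|c - a| <= `|x| & f (a + x) - f a = derive1 f c * x.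
  have h : `|(derive1 f c - derive1 f a) * x| <= L * x ^+ 2.
    rewrite normrM -(real_normK (num_real x)) expr2 mulrA ler_wpM2r//.
    by apply: le_trans (lip c) _; rewrite ler_wpM2l// ltW.
  move: h; rewrite ler_norml => /andP[h _]; lra.
have [x0|x0] := leP 0 x.
- have ax : a <= a + x by rewrite lerDl.
  have [c] := @MVT_segment _ f (derive1 f) a (a + x) ax (fun c _ => drv c)
    (continuous_subspaceT cf).
  rewrite in_itv/= => /andP[ac ca] e; exists c; last by rewrite e; ring.
  by rewrite !ger0_norm ?subr_ge0// lerBlDl.
- have ax : a + x <= a by rewrite gerDl ltW.
  have [c] := @MVT_segment _ f (derive1 f) (a + x) a ax (fun c _ => drv c)
    (continuous_subspaceT cf).
  rewrite in_itv/= => /andP[ac ca] e; exists c.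
    by rewrite ler0_norm ?subr_le0// ltr0_norm//; lra.
  by rewrite -opprB e; ring.
Qed.

(** The gap to the supremum is [(p - q - 2 b r)^2 / (4 b)], which vanishes at
    [r = (p - q) / (2 b)]. *)
Lemma lq_conjugate (b q p : R) : 0 < b ->
  conjugate (fun r => b * r ^+ 2 + q * r) p = ((p - q) ^+ 2 / (4 * b))%:E.
Proof.
move=> b0; apply/eqP; rewrite eq_le; apply/andP; split.
  apply: ge_ereal_sup => _ [r _ <-]; rewrite lee_fin ler_pdivlMr ?mulr_gt0//.
  rewrite -subr_ge0; have := sqr_ge0 (p - q - 2 * b * r); lra.
apply: ereal_sup_ubound; exists ((p - q) / (2 * b)) => //; congr EFin.
by field; rewrite gt_eqF.
Qed.

Lemma lq_conjugate' (b q p : R) : 0 < b ->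
  conjugate' (fun r => b * r ^+ 2 + q * r) p = (p - q) / (2 * b).
Proof.
move=> b0; rewrite /conjugate'.
have -> : (fun p => fine (conjugate (fun r => b * r ^+ 2 + q * r) p)) =
    ((id - cst q) ^+ 2 * cst ((4 * b)^-1) : R -> R).
  by apply/funext => r; rewrite lq_conjugate// fctE.
rewrite derive1E derive_val; rewrite -![_ *: _]/(_ * _).
transitivity ((4 * b)^-1 * (2 * (p - q))).
  by rewrite mulr0 add0r subr0 mulr1 expr1.
by field; rewrite gt_eqF.
Qed.

End real_analysis.

(** * Stationary states and [alpha_bar] in terms of the kernels *)

Section stationary_states.
Context (R : realType) (M : vintage_model R).
Hypothesis sbar_ge0 : (0 <= sbar M)%E.
Hypothesis mu_gt0 : 0 < mu M.
Hypothesis rate_gt0 : 0 < mu M + lam M.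
Local Notation leb := (@lebesgue_measure R).
Local Notation ext := (ext M).

Lemma wderiv_eq f f' g g' : (forall s, ages M s -> f s = f' s) ->
  (forall s, ages M s -> g s = g' s) -> wderiv M f g -> wderiv M f' g'.
Proof.
move=> ff gg [lg fg]; rewrite /wderiv -(eq_ext gg); split=> // s As.
by rewrite -(ff s As) -(ff 0 (ages0 sbar_ge0)) fg.
Qed.

Lemma V_eq f g : (forall s, ages M s -> f s = g s) -> V M f -> V M g.
Proof.
move=> fg /VP[lf [h fh] vf]; apply/VP; split.
- by rewrite -(eq_ext fg).
- by exists h; exact: wderiv_eq fh.
- move: vf; rewrite /vanishes_at_sbar; move: fg sbar_ge0; rewrite /ages.
  case: (sbar M) => [b||]// fg b0.
    by rewrite fg//; split.
  apply: cvg_trans; apply: near_eq_cvg; near=> x; rewrite fg//.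
  split; last exact: leey.
  by near: x; exact: nbhs_pinfty_ge.
Unshelve. all: end_near. Qed.

Lemma alpha_barE s : ages M s -> alpha_bar M s = Res (mu M + lam M) (ext (alpha M)) s.
Proof.
move=> As; rewrite /alpha_bar Rintegral_mkcond /Res; apply: eq_Rintegral => x _.
rewrite patchE; case: ifPn => [|].
  rewrite inE => -[sx xb]; rewrite hexp_pos ?subr_ge0// extE//.
  by split=> //; apply: le_trans sx; case: As.
rewrite notin_setE /= => nx; have [xs|sx] := ltP x s.
  by rewrite hexp_neg ?mul0r// subr_lt0.
by rewrite ext_out ?mulr0// => -[x0 xb]; apply: nx.
Qed.

Lemma ext_alpha_bar : ext (alpha_bar M) = ext (Res (mu M + lam M) (ext (alpha M))).
Proof. by apply: eq_ext => s; exact: alpha_barE. Qed.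

Lemma stationary_stateE u0 u1 s : ages M s ->
  stationary_state M u0 u1 s = u0 * hexp (mu M) s + Cov (mu M) (ext u1) s.
Proof.
move=> As; have s0 : 0 <= s by case: As.
rewrite /stationary_state Rint_itv_box hexp_pos// [u0 * _]mulrC; congr (_ + _).
apply: eq_Rintegral => x _; rewrite /box.
have [x0|x0] := leP 0 x => /=; last by rewrite mul0r ext_neg// mulr0.
case: ifPn => [xs|]; last first.
  by rewrite -ltNge => sx; rewrite hexp_neg ?mul0r// subr_lt0.
by rewrite mul1r hexp_pos ?subr_ge0// extE//; exact: (ages_le As).
Qed.

Lemma stationary_state_ae u0 u1 v1 s : ages M s ->
  L2 leb (ext u1) -> L2 leb (ext v1) ->
  ae_ages M (fun x => u1 x = v1 x) ->
  stationary_state M u0 u1 s = stationary_state M u0 v1 s.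
Proof.
move=> As lu lv /ae_ext e; rewrite !stationary_stateE//; congr (_ + _).
apply: ae_Rint; [exact: integ_measurable (Cov_integ mu_gt0 s lu)|
  exact: integ_measurable (Cov_integ mu_gt0 s lv)|].
by apply: aeS e => x ->.
Qed.

Lemma stationary_state_comb a u0 u1 v0 v1 s : ages M s ->
  L2 leb (ext u1) -> L2 leb (ext v1) ->
  stationary_state M (a * u0 + v0) (fun x => a * u1 x + v1 x) s =
  a * stationary_state M u0 u1 s + stationary_state M v0 v1 s.
Proof.
move=> As lu lv; rewrite !stationary_stateE//.
suff -> : Cov (mu M) (ext (fun x => a * u1 x + v1 x)) s =
  a * Cov (mu M) (ext u1) s + Cov (mu M) (ext v1) s by ring.
rewrite /Cov -RintegralZl//; last exact: Cov_integ.
rewrite -RintegralD//; [|by apply: integZ; exact: Cov_integ|exact: Cov_integ].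
by apply: eq_Rintegral => x _; rewrite extD ext_cst; ring.
Qed.

Lemma stationary_stateZ a u0 u1 s : ages M s -> L2 leb (ext u1) ->
  stationary_state M (a * u0) (fun x => a * u1 x) s = a * stationary_state M u0 u1 s.
Proof.
move=> As lu; rewrite !stationary_stateE//.
suff -> : Cov (mu M) (ext (fun x => a * u1 x)) s = a * Cov (mu M) (ext u1) s by ring.
rewrite /Cov -RintegralZl//; last exact: Cov_integ.
by apply: eq_Rintegral => x _; rewrite ext_cst; ring.
Qed.

Lemma L2_stationary_state u0 u1 : L2 leb (ext u1) ->
  L2 leb (ext (stationary_state M u0 u1)).
Proof.
move=> lu; rewrite (eq_ext (g := fun s => u0 * hexp (mu M) s + Cov (mu M) (ext u1) s)).
  apply: (L2_ext sbar_ge0); apply: L2D; last exact: L2_Cov.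
  by apply: L2Z; exact: L2_hexp.
by move=> s; exact: stationary_stateE.
Qed.

(* [Cov] is the adjoint of [Res], so that [stationary_state] is the adjoint of
   the resolvent of the semigroup composed with the control operator. *)
Lemma pair_stationary_state f u0 u1 : L2 leb (ext f) -> L2 leb (ext u1) ->
  pair_ages M f (stationary_state M u0 u1) =
  control_operator M (u0, u1) (Res (mu M) (ext f)).
Proof.
move=> lf lu; rewrite /control_operator !pair_agesE/=.
have lC := L2_Cov mu_gt0 lu; have lh := L2_hexp mu_gt0.
transitivity (\int[leb]_s (u0 * (ext f s * hexp (mu M) s) + ext f s * Cov (mu M) (ext u1) s)).
  apply: eq_Rintegral => s _; have [As|nAs] := pselect (ages M s).
    by rewrite (extE (stationary_state _ _ _) As) stationary_stateE//; ring.
  by rewrite !(ext_out _ nAs); ring.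
rewrite RintegralD//; [|by apply: integZ; exact: L2_mul|exact: L2_mul].
rewrite RintegralZl//; last exact: L2_mul.
rewrite addrC Res_Cov//; congr (_ + _).
  apply: eq_Rintegral => s _; have [As|nAs] := pselect (ages M s).
    by rewrite [in RHS]extE.
  by rewrite !(ext_out _ nAs); ring.
congr (_ * _); rewrite /Res; apply: eq_Rintegral => s _.
by rewrite subr0 mulrC.
Qed.

Lemma ae_pair f x y : measurable_fun setT (ext f) -> measurable_fun setT (ext x) ->
  measurable_fun setT (ext y) -> ae_ages M (fun s => x s = y s) ->
  pair_ages M f x = pair_ages M f y.
Proof.
move=> mf mx my /ae_ext e; rewrite !pair_agesE; apply: ae_Rint.
- exact: measurable_funM.
- exact: measurable_funM.
- by apply: aeS e => s ->.
Qed.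

End stationary_states.

(** * Reduction of the maximum principle to the scalar equation for [eta] *)

Section lq_equilibria.
Context (R : realType) (sb : \bar R) (mu lam : R)
    (Rev alpha : R -> R) (beta0 q0 eps : R) (beta1 q1 : R -> R).
Local Notation leb := (@lebesgue_measure R).
Local Notation M := (lq_model sb mu lam Rev alpha beta0 q0 beta1 q1).
Local Notation ext := (ext M).
Hypothesis sb_ge0 : (0 <= sb)%E.
Hypothesis mu_gt0 : 0 < mu.
Hypothesis lam_mu : - mu < lam.
Hypothesis V_alpha : V M alpha.
Hypothesis eps_gt0 : 0 < eps.
Hypothesis eps_beta0 : eps <= beta0.
Hypothesis beta1_fin : Lp_ages M +oo%E beta1.
Hypothesis eps_beta1 : ae_ages M (fun s => eps <= beta1 s).
Hypothesis L2_q1 : Lp_ages M 2%:E q1.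

Local Notation k := (mu + lam).

Let k_gt0 : 0 < k. Proof. by rewrite addrC -ltrBlDr sub0r. Qed.

Let beta0_gt0 : 0 < beta0. Proof. exact: lt_le_trans eps_beta0. Qed.

Lemma measurable_beta1 : measurable_fun setT (ext beta1).
Proof. by move: beta1_fin; rewrite /Lp_ages inE => /andP[/[!inE]]. Qed.

Lemma L2_div_beta1 f : L2 leb (ext f) -> L2 leb (ext (fun s => f s / (2 * beta1 s))).
Proof.
move=> lf; have [mf _] := lf.
apply: (L2_le_ae _ _ (L2Z (2 * eps)^-1 lf)).
  rewrite (_ : ext _ = (fun s => ext f s / (2 * ext beta1 s))).
    apply: measurable_funM => //; apply: measurable_fun_inv.
    by apply: measurable_funM => //; exact: measurable_beta1.
  by apply/funext => s; rewrite !ext_if; case: ifP => //; rewrite mul0r.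
apply: aeS eps_beta1 => s h; have [As|nAs] := pselect (ages M s); last first.
  by rewrite !(ext_out _ nAs) mulr0.
rewrite !extE// normrM mulrC normrM ler_wpM2r//.
have := h As => b1; have b10 : 0 < beta1 s by exact: lt_le_trans b1.
by rewrite !gtr0_norm ?invr_gt0 ?mulr_gt0// lef_pV2 ?posrE ?mulr_gt0// ler_pM2l.
Qed.

Lemma L2_alpha_bar : L2 leb (ext (alpha_bar M)).
Proof.
rewrite ext_alpha_bar; apply: (L2_ext (M := M)) => //.
by apply: (L2_Res k_gt0); exact: V_L2 V_alpha.
Qed.

Lemma V_alpha_bar : V M (alpha_bar M).
Proof.
apply: (V_eq (M := M)) (V_Res (M := M) sb_ge0 k_gt0 V_alpha) => // s As.
by rewrite (alpha_barE As).
Qed.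

(** The weak derivative of [alpha_bar], read from the resolvent equation. It lies in V, which puts
    [alpha_bar], hence the co-state, in H^2. *)
Definition dalpha_bar s := k * alpha_bar M s + - alpha s.

Lemma wderiv_alpha_bar : wderiv M (alpha_bar M) dalpha_bar.
Proof.
have [g fg] := V_wderiv V_alpha.
apply: (wderiv_eq (M := M)) (wderiv_Res (M := M) sb_ge0 k_gt0 V_alpha fg) => //= s As.
  by rewrite (alpha_barE As).
have s0 : 0 <= s by case: As.
rewrite (Res_wderiv (M := M) sb_ge0 k_gt0 V_alpha fg s0) /dalpha_bar.
by rewrite (alpha_barE As) extE.
Qed.

Lemma V_dalpha_bar : V M dalpha_bar.
Proof.
rewrite (_ : dalpha_bar = fun s => k * alpha_bar M s + -1 * alpha s).
  apply: V_comb; first exact: V_alpha_bar.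
  by apply: VZ => //; exact: V_alpha.
by apply/funext => s; rewrite /dalpha_bar mulN1r.
Qed.

Local Notation W1 := (w1 M beta0 beta1).
Local Notation W2 := (w2 M beta0 q0 beta1 q1).
Local Notation c1 := (pair_ages M alpha W1).
Local Notation c2 := (pair_ages M alpha W2).
Local Notation abar := (alpha_bar M).

Lemma L2_extq1 : L2 leb (ext q1).
Proof. exact/Lp2P. Qed.

Lemma w1E s : W1 s = stationary_state M (abar 0 / (2 * beta0))
  (fun x => abar x / (2 * beta1 x)) s.
Proof. by rewrite /w1 /stationary_state mulrC. Qed.

Lemma w2E s : W2 s = stationary_state M (q0 / (2 * beta0))
  (fun x => q1 x / (2 * beta1 x)) s.
Proof. by rewrite /w2 /stationary_state mulrC. Qed.

Lemma L2_ext_w1 : L2 leb (ext W1).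
Proof.
rewrite (_ : W1 = stationary_state M (abar 0 / (2 * beta0))
  (fun x => abar x / (2 * beta1 x))); last exact/funext/w1E.
by apply: L2_stationary_state => //; apply: L2_div_beta1; exact: L2_alpha_bar.
Qed.

Lemma L2_ext_w2 : L2 leb (ext W2).
Proof.
rewrite (_ : W2 = stationary_state M (q0 / (2 * beta0))
  (fun x => q1 x / (2 * beta1 x))); last exact/funext/w2E.
by apply: L2_stationary_state => //; apply: L2_div_beta1; exact: L2_extq1.
Qed.

(** The feedback is affine in [eta] and the stationary state linear in the control: [W1] comes from
    the slope, [- W2] from the constant term. *)
Lemma stationary_lq eta (u1 : R -> R) s : ages M s -> L2 leb (ext u1) ->
  ae_ages M (fun x => u1 x = (eta * abar x - q1 x) / (2 * beta1 x)) ->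
  stationary_state M ((eta * abar 0 - q0) / (2 * beta0)) u1 s = eta * W1 s + - W2 s.
Proof.
move=> As lu eu.
have l1 := L2_div_beta1 L2_alpha_bar; have l2 := L2_div_beta1 L2_extq1.
have l3 : L2 leb (ext (fun x => eta * (abar x / (2 * beta1 x)) +
    (-1) * (q1 x / (2 * beta1 x)))).
  rewrite (_ : ext _ = (fun x => eta * ext (fun x => abar x / (2 * beta1 x)) x +
    (-1) * ext (fun x => q1 x / (2 * beta1 x)) x)).
    by apply: L2D; exact: L2Z.
  by apply/funext => x; rewrite extD !ext_cst.
rewrite w1E w2E.
transitivity (stationary_state M (eta * (abar 0 / (2 * beta0)) + (-1) * (q0 / (2 * beta0)))
   (fun x => eta * (abar x / (2 * beta1 x)) + (-1) * (q1 x / (2 * beta1 x))) s).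
  rewrite (_ : (eta * abar 0 - q0) / (2 * beta0) =
    eta * (abar 0 / (2 * beta0)) + (-1) * (q0 / (2 * beta0))); last by ring.
  apply: (stationary_state_ae (M := M)) => //.
  by apply: aeS eu => x h Ax; rewrite h//; ring.
rewrite (stationary_state_comb (M := M))//; last first.
  rewrite (_ : ext _ = (fun x => (-1) * ext (fun x => q1 x / (2 * beta1 x)) x)).
    exact: L2Z.
  by apply/funext => x; rewrite ext_cst.
by rewrite (stationary_stateZ (M := M))// mulN1r.
Qed.

Lemma conjugate'_cost0 p : conjugate' (cost0 M) p = (p - q0) / (2 * beta0).
Proof. exact: lq_conjugate'. Qed.

Lemma conjugate'_cost1 (xi : R -> R) : ae_ages M (fun s =>
  conjugate' (cost1 M s) (xi s) = (xi s - q1 s) / (2 * beta1 s)).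
Proof.
apply: aeS eps_beta1 => s h As; apply: lq_conjugate'.
exact: lt_le_trans (h As).
Qed.

Lemma L2_feedback eta : L2 leb (ext (fun x => (eta * abar x - q1 x) / (2 * beta1 x))).
Proof.
apply: L2_div_beta1; rewrite (_ : ext _ = (fun x => eta * ext abar x - ext q1 x)).
  by apply: L2B; [apply: L2Z; exact: L2_alpha_bar | exact: L2_extq1].
by apply/funext => x; rewrite extB ext_cst.
Qed.

(** This pairing closes the system: with [eta = Rev' <alpha, x>] it becomes the scalar equation for
    [eta]. *)
Lemma pair_lq eta x : measurable_fun (ages M) x ->
  ae_ages M (fun s => x s = eta * W1 s + - W2 s) ->
  L2 leb (ext x) /\ pair_ages M alpha x = eta * c1 - c2.
Proof.
move=> mx ex; have mX : measurable_fun setT (ext x) by exact/(measurable_ext (M := M)).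
have lx : L2 leb (fun s => eta * ext W1 s - ext W2 s).
  by apply: L2B; [apply: L2Z; exact: L2_ext_w1 | exact: L2_ext_w2].
have e : {ae leb, forall s, eta * ext W1 s - ext W2 s = ext x s}.
  by apply: aeS (ae_ext ex) => s ->; rewrite -ext_cst -extB.
split; first exact: ae_L2 e lx.
have la := V_L2 V_alpha.
rewrite !pair_agesE -RintegralZl//; last exact: L2_mul la L2_ext_w1.
rewrite -RintegralB//; [|by apply: integZ; exact: L2_mul la L2_ext_w1|
  exact: L2_mul la L2_ext_w2].
apply: ae_Rint.
- by apply: measurable_funM => //; case: la.
- apply: integ_measurable; apply: integB; last exact: L2_mul la L2_ext_w2.
  by apply: integZ; exact: L2_mul la L2_ext_w1.
- by apply: aeS e => s <-; ring.
Qed.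

Variables (x zeta : R -> R) (u0 : R) (u1 : R -> R).
Hypothesis mx : measurable_fun (ages M) x.
Hypothesis mu1 : measurable_fun (ages M) u1.

Lemma MP_equilibriumP : MP_equilibrium M x zeta (u0, u1) <->
   exists eta : R,
     [/\ eta = derive1 Rev (eta * c1 - c2),
         ae_ages M (fun s => x s = - W2 s + eta * W1 s),
         forall s, ages M s ->
           zeta s = derive1 Rev (pair_ages M alpha x) * abar s,
         u0 = (zeta 0 - q0) / (2 * beta0) &
         ae_ages M (fun s => u1 s = (zeta s - q1 s) / (2 * beta1 s))].
Proof.
have A0 : ages M 0 by exact: ages0.
split.
  move=> [[/Lp2P lx _ /Lp2P lu] [ex ez eu0 eu1]].
  set eta := derive1 Rev (pair_ages M alpha x).
  have eu1' : ae_ages M (fun s => u1 s = (eta * abar s - q1 s) / (2 * beta1 s)).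
    apply: aeS (aeI eu1 (conjugate'_cost1 zeta)) => s [h1 h2] As.
    by rewrite -ez// -h2// -h1.
  have eu0' : u0 = (eta * abar 0 - q0) / (2 * beta0).
    by move: eu0; rewrite /= conjugate'_cost0 ez.
  have ex' : ae_ages M (fun s => x s = eta * W1 s + - W2 s).
    apply: aeS ex => s h As; rewrite h//= eu0'; exact: stationary_lq.
  have [_ pe] := pair_lq mx ex'.
  exists eta; split=> //.
  - by rewrite -pe.
  - by apply: aeS ex' => s h As; rewrite h// addrC.
  - by rewrite eu0' ez.
  - by apply: aeS eu1' => s h As; rewrite h// ez.
move=> [eta [eeta ex ez eu0 eu1]].
have ex' : ae_ages M (fun s => x s = eta * W1 s + - W2 s).
  by apply: aeS ex => s h As; rewrite h// addrC.
have [lx pe] := pair_lq mx ex'.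
have ez' s : ages M s -> zeta s = eta * abar s by move=> As; rewrite ez// pe -eeta.
have eu1' : ae_ages M (fun s => (eta * abar s - q1 s) / (2 * beta1 s) = u1 s).
  by apply: aeS eu1 => s h As; rewrite h// ez'.
have lu : L2 leb (ext u1).
  apply: ae_L2 (ae_ext eu1') (L2_feedback eta).
  exact/(measurable_ext (M := M)).
split; split => //=.
- exact/Lp2P.
- have E : ext zeta = (fun s => eta * ext abar s).
    by apply/funext => s; rewrite -ext_cst; congr (_ s); exact: eq_ext.
  split; first by apply/Lp2P; rewrite E; apply: L2Z; exact: L2_alpha_bar.
  exists (fun s => eta * dalpha_bar s).
    by case: (VZ (M := M) sb_ge0 eta V_dalpha_bar).
  have /wderivP[_] // : wderiv M zeta (fun s => eta * dalpha_bar s).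
  have := wderiv_comb eta wderiv_alpha_bar wderiv_alpha_bar.
  move=> _; have [l e] := wderiv_alpha_bar.
  rewrite /wderiv (_ : ext _ = (fun s => eta * ext dalpha_bar s)); last first.
    by apply/funext => s; rewrite ext_cst.
  split; first exact: L2Z.
  move=> s As; rewrite !ez'// e// mulrDr; congr (_ + _).
  rewrite /prim -RintegralZl//; last exact: integ_boxM.
  by apply: eq_Rintegral => y _; ring.
- exact/Lp2P.
- apply: aeS ex' => s h As; rewrite h// eu0 ez'//; apply/esym/stationary_lq => //.
  by apply: aeS eu1' => y hy Ay; rewrite hy.
- by rewrite conjugate'_cost0.
- by apply: aeS (aeI eu1 (conjugate'_cost1 zeta)) => s [h1 h2] As; rewrite h1// h2.
Qed.

End lq_equilibria.

(** * The dual of V and its orbits *)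

Section dual_space.
Context (R : realType) (M : vintage_model R).
Hypothesis sbar_ge0 : (0 <= sbar M)%E.
Local Notation leb := (@lebesgue_measure R).
Local Notation ext := (ext M).
Local Notation T := (adjoint_semigroup M).
Local Notation wd := (weak_derivative M).
Implicit Types (f g F G : R -> R) (y : (R -> R) -> R).

Lemma dual0 y : dualV M y -> y (fun=> 0) = 0.
Proof.
move=> [yl _]; have := yl 1 (fun=> 0) (fun=> 0) (V_zero sbar_ge0) (V_zero sbar_ge0).
rewrite (_ : (fun s => _) = fun=> 0); last by apply/funext => s; rewrite mulr0 addr0.
by move=> h; lra.
Qed.

Lemma dualZ y a f : dualV M y -> V M f -> y (fun s => a * f s) = a * y f.
Proof.
move=> dy Vf; have [yl _] := dy; have := yl a f (fun=> 0) Vf (V_zero sbar_ge0).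
by rewrite dual0// addr0; under eq_fun => s do rewrite addr0.
Qed.

Lemma dual_bound y : dualV M y -> exists2 C, 0 <= C &
  forall f, V M f -> `|y f| <= C * H1_norm M f.
Proof.
move=> [_ [C yC]]; exists `|C| => // f Vf; apply: le_trans (yC f Vf) _.
by rewrite ler_wpM2r ?H1_norm_ge0// ler_norm.
Qed.

Lemma wderiv_ages0 f : (forall s, ages M s -> f s = 0) -> wderiv M f (fun=> 0).
Proof.
have e0 : ext (fun=> 0) = fun=> 0.
  by apply/funext => s; rewrite ext_if; case: ifP.
move=> f0; rewrite /wderiv e0; split.
  by split => //; under eq_fun => x do rewrite expr0n; exact: integ0.
move=> s As; rewrite (f0 s As) (f0 0 (ages0 sbar_ge0)).
by rewrite /prim add0r Rint_eq0// => x; rewrite mulr0.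
Qed.

Lemma nrm0 F : F = (fun=> 0) -> nrm leb F = 0.
Proof.
by move=> ->; rewrite /nrm Rint_eq0 ?sqrtr0// => x; rewrite expr0n.
Qed.

(** Functions that agree on [ages] are at [H1_norm] distance 0, so boundedness identifies their
    images. *)
Lemma dual_ext y f g : dualV M y -> V M f -> V M g ->
  (forall s, ages M s -> f s = g s) -> y f = y g.
Proof.
move=> dy Vf Vg fg; have [C C0 yC] := dual_bound dy; have [yl _] := dy.
have := yC _ (V_comb (-1) Vg Vf); rewrite (yl (-1) g f Vg Vf).
have h0 s : ages M s -> -1 * g s + f s = 0 by move=> As; rewrite fg//; ring.
rewrite (H1_normE sbar_ge0 (V_comb (-1) Vg Vf) (wderiv_ages0 h0)).
have e0 : ext (fun=> 0) = fun=> 0.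
  by apply/funext => s; rewrite ext_if; case: ifP.
rewrite (eq_ext (g := fun=> 0) h0) e0 !nrm0// expr0n addr0 sqrtr0 mulr0.
by rewrite normr_le0 => /eqP h; lra.
Qed.

Definition H1_inner f g := pair_ages M f g + pair_ages M (wd f) (wd g).

Lemma H1_innerE f g f' g' : V M f -> V M g -> wderiv M f f' -> wderiv M g g' ->
  H1_inner f g = \int[leb]_s (ext f s * ext g s) + \int[leb]_s (ext f' s * ext g' s).
Proof.
move=> Vf Vg wf wg; rewrite /H1_inner !pair_agesE; congr (_ + _).
have wf' := weak_derivativeP Vf; have wg' := weak_derivativeP Vg.
apply: ae_Rint.
- by apply: measurable_funM; [case: wf' => -[]|case: wg' => -[]].
- by apply: measurable_funM; [case: wf => -[]|case: wg => -[]].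
apply: aeS (aeI (wderiv_unique sbar_ge0 Vf wf' wf) (wderiv_unique sbar_ge0 Vg wg' wg)).
by move=> s [-> ->].
Qed.

Lemma Rint_combM a (A B C : R -> R) : L2 leb A -> L2 leb B -> L2 leb C ->
  \int[leb]_s ((a * A s + B s) * C s) =
  a * \int[leb]_s (A s * C s) + \int[leb]_s (B s * C s).
Proof.
move=> lA lB lC; rewrite -RintegralZl//; last exact: L2_mul.
rewrite -RintegralD//; [|by apply: integZ; exact: L2_mul|exact: L2_mul].
by apply: eq_Rintegral => s _; ring.
Qed.

Lemma H1_inner_comb a f1 f2 g : V M f1 -> V M f2 -> V M g ->
  H1_inner (fun s => a * f1 s + f2 s) g = a * H1_inner f1 g + H1_inner f2 g.
Proof.
move=> V1 V2 Vg; have [h1 w1] := V_wderiv V1; have [h2 w2] := V_wderiv V2.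
have [h wg] := V_wderiv Vg.
rewrite (H1_innerE (V_comb a V1 V2) Vg (wderiv_comb a w1 w2) wg).
rewrite (H1_innerE V1 Vg w1 wg) (H1_innerE V2 Vg w2 wg).
have e u v : ext (fun s => a * u s + v s) = fun s => a * ext u s + ext v s.
  by apply/funext => s; rewrite extD ext_cst.
rewrite !e !Rint_combM//; [ring|..]; try (by case: w1); try (by case: w2);
  try (by case: wg); exact: V_L2.
Qed.

Lemma H1_innerC f g : H1_inner f g = H1_inner g f.
Proof.
rewrite /H1_inner !pair_agesE; congr (_ + _);
  by apply: eq_Rintegral => s _; rewrite mulrC.
Qed.

Lemma H1_inner_norm f : V M f -> H1_inner f f = H1_norm M f ^+ 2.
Proof.
move=> Vf; have [f' wf] := V_wderiv Vf.
rewrite (H1_innerE Vf Vf wf wf) (H1_normE sbar_ge0 Vf wf) sqr_sqrtr ?addr_ge0 ?sqr_ge0//.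
by rewrite !sqr_nrm.
Qed.

(* A near minimizer [g] of [|g|^2 / 2 - y g] represents [y] up to a small error
   in norm; no completeness is needed. *)
Lemma dual_approx y d : dualV M y -> 0 < d ->
  exists2 g, V M g & forall f, V M f -> `|y f - H1_inner f g| <= d * H1_norm M f.
Proof.
move=> dy d0; have [C C0 yC] := dual_bound dy; have [yl _] := dy.
pose J g := H1_norm M g ^+ 2 / 2 - y g.
pose E := [set J g | g in V M].
have infE : has_inf E.
  split; first by exists (J (fun=> 0)), (fun=> 0) => //; exact: V_zero.
  exists (- C ^+ 2 / 2) => _ [g Vg <-]; rewrite /J.
  have := le_trans (ler_norm _) (yC g Vg).
  have := sqr_ge0 (H1_norm M g - C); lra.
(* The error in the infimum is the constant term of the quadratic obtained by perturbing [g] along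
   [t f]; its discriminant bounds the slope by [d] times the norm of [f]. *)
have d2 : 0 < d ^+ 2 / 2 by rewrite divr_gt0 ?exprn_gt0.
have [_ [g Vg <-] Jg] := inf_adherent d2 infE.
exists g => // f Vf.
apply: discriminant_le; [|exact: ltW|exact: H1_norm_ge0] => t.
have Vtf := V_comb (- t) Vf Vg.
have : inf E <= J (fun s => - t * f s + g s).
  by apply: ge_inf; [exact: infE.2|exists (fun s => - t * f s + g s)].
rewrite /J -H1_inner_norm// yl//; set h := fun s => _.
have hE u : V M u -> H1_inner u h = - t * H1_inner f u + H1_inner g u.
  by move=> Vu; rewrite H1_innerC H1_inner_comb.
rewrite {1}/h H1_inner_comb// !hE//.
move: Jg; rewrite /J -!H1_inner_norm// [H1_inner g f]H1_innerC; lra.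
Qed.

Lemma pivot_dual x : L2 leb (ext x) -> dualV M (pivot M x).
Proof.
move=> lx; split.
  move=> a f g Vf Vg; rewrite /pivot !pair_agesE -Rint_combM//; try exact: V_L2.
  by apply: eq_Rintegral => s _; rewrite extD ext_cst.
exists (nrm leb (ext x)) => f Vf; have [f' wf] := V_wderiv Vf.
rewrite /pivot pair_agesE mulrC; apply: le_trans (cauchy_schwarz (V_L2 Vf) lx) _.
by rewrite ler_wpM2r ?nrm_ge0//; case: (nrm_le_H1_norm sbar_ge0 Vf wf).
Qed.

(** Dirac masses are in V' by the Sobolev embedding. Perturbing a datum along them reads a
    supergradient pointwise in [superdifferential_costate]. *)
Lemma eval_dual s : ages M s -> dualV M (fun f => f s).
Proof.
move=> As; split=> //; exists 2 => f Vf.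
by rewrite -(extE f As); exact: ext_le_H1_norm.
Qed.

Lemma dual_comb a y z : dualV M y -> dualV M z -> dualV M (fun f => a * y f + z f).
Proof.
move=> dy dz; have [C C0 yC] := dual_bound dy; have [D D0 zD] := dual_bound dz.
have [yl _] := dy; have [zl _] := dz; split.
  by move=> b f g Vf Vg; rewrite yl// zl//; ring.
exists (`|a| * C + D) => f Vf; rewrite mulrDl -mulrA.
apply: le_trans (ler_normD _ _) _; rewrite normrM lerD ?zD//.
by rewrite ler_wpM2l// yC.
Qed.

End dual_space.

(** * Laplace transform of the orbits of V' *)

Section laplace_transform.
Context (R : realType) (M : vintage_model R).
Hypothesis sbar_ge0 : (0 <= sbar M)%E.
Local Notation leb := (@lebesgue_measure R).
Local Notation ext := (ext M).
Local Notation T := (adjoint_semigroup M).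
Local Notation k := (mu M + lam M).
Hypothesis k_gt0 : 0 < k.
Implicit Types (f g F G : R -> R) (y : (R -> R) -> R).

(** For [B] zero at negative ages this is, up to damping, the pairing of the orbit of [A] with [B],
    in a form that is measurable in the shift. *)
Definition corr (A B : R -> R) t := \int[leb]_s (A (s + t) * B s).

Lemma measurable_corr A B : measurable_fun setT A -> measurable_fun setT B ->
  measurable_fun setT (corr A B).
Proof.
move=> mA mB; apply: (measurable_Rint_param (m2 := leb) (fun z => A (z.2 + z.1) * B z.2)).
apply: measurable_funM; last exact: (measurableT_comp mB measurable_snd).
by apply: (measurableT_comp mA); apply: measurable_funD;
  [exact: measurable_snd|exact: measurable_fst].
Qed.

(** Fubini moves the Laplace integral onto [A]; absolute convergence comes from the L^2 bound on the
    resolvent of [|A|]. *)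
Lemma Rint_hexp_corr r A B : 0 < r -> L2 leb A -> L2 leb B ->
  integ leb (fun t => hexp r t * corr A B t) /\
  \int[leb]_t (hexp r t * corr A B t) = \int[leb]_s (Res r A s * B s).
Proof.
move=> r0 lA lB; have [mA _] := lA; have [mB _] := lB.
pose h (z : R * R) := B z.1 * (hexp r z.2 * A (z.2 + z.1)).
have iA x : integ leb (fun t => hexp r t * A (t + x)).
  by have := integ_shift x (Res_integ r0 x lA); under eq_fun => t do rewrite addrK.
have mh : measurable_fun setT h.
  apply: measurable_funM; first exact: (measurableT_comp mB measurable_fst).
  apply: measurable_funM; first exact: (measurableT_comp (measurable_hexp r) measurable_snd).
  by apply: (measurableT_comp mA); apply: measurable_funD;
    [exact: measurable_snd|exact: measurable_fst].
have [|_ _ _ ih e] := Rfubini (m1 := leb) (m2 := leb) h mh.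
  have lr := L2_Res r0 (L2_norm lA).
  apply: le_lt_trans (integrable_lty measurableT (L2_mul (L2_norm lB) lr)).
  apply: le_integral_pointwise => x _ /=.
  have ig : integ leb (fun t => hexp r t * `|A (t + x)|).
    have := integ_norm (iA x).
    by under eq_fun => t do rewrite normrM (ger0_norm (hexp_ge0 _ _)).
  rewrite (_ : integral _ _ _ = (\int[leb]_t (`|B x| * (hexp r t * `|A (t + x)|)))%:E).
    by rewrite RintegralZl// Res_shift//; exact: measurableT_comp.
  rewrite EFin_Rint; last exact: integZ.
  apply: eq_integral => t _; rewrite /h/= normrM.
  by rewrite normrM (ger0_norm (hexp_ge0 _ _)).
have eh t : \int[leb]_x h (x, t) = hexp r t * corr A B t.
  rewrite /corr -RintegralZl//; last exact: L2_mul (L2_shift t lA) lB.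
  by apply: eq_Rintegral => x _; rewrite /h/= [t + x]addrC; ring.
split; first by move: ih; under eq_fun => t do rewrite eh.
transitivity (\int[leb]_y \int[leb]_x h (x, y)).
  by apply: eq_Rintegral => t _; rewrite eh.
rewrite -{}e; apply: eq_Rintegral => x _; rewrite /h/= RintegralZl//; last exact: iA.
by rewrite Res_shift// mulrC.
Qed.

Definition orbit y f t := if 0 <= t then y (T t f) else 0.

Lemma orbit_bound y f : dualV M y -> V M f ->
  exists2 C, 0 <= C & forall t, `|orbit y f t| <= C * hexp (mu M) t.
Proof.
move=> dy Vf; have [C C0 yC] := dual_bound dy.
exists (C * H1_norm M f); first by rewrite mulr_ge0 ?H1_norm_ge0.
move=> t; rewrite /orbit /hexp; case: ifPn => [t0|_]; last by rewrite normr0 mulr0.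
apply: le_trans (yC _ (V_T sbar_ge0 t0 Vf)) _; rewrite -mulrA ler_wpM2l// mulrC.
exact: H1_norm_T.
Qed.

Lemma H1_inner_orbit f g f' g' t : V M f -> V M g -> wderiv M f f' -> wderiv M g g' ->
  orbit (H1_inner M ^~ g) f t =
  hexp (mu M) t * (corr (ext f) (ext g) t + corr (ext f') (ext g') t).
Proof.
move=> Vf Vg wf wg; rewrite /orbit /hexp; case: ifPn => [t0|_]; last by rewrite mul0r.
rewrite (H1_innerE sbar_ge0 (V_T sbar_ge0 t0 Vf) Vg (wderiv_T sbar_ge0 t0 Vf wf) wg).
have H a b : L2 leb (ext a) -> L2 leb (ext b) ->
    \int[leb]_s (ext (T t a) s * ext b s) = expR (- mu M * t) * corr (ext a) (ext b) t.
  move=> la lb; rewrite /corr -RintegralZl//; last exact: L2_mul (L2_shift t la) lb.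
  apply: eq_Rintegral => s _; rewrite ext_T//; case: ifPn => [_|]; first by rewrite mulrA.
  by rewrite -ltNge => s0; rewrite (ext_neg M b s0) !mulr0.
rewrite !H ?mulrDr//; try (by case: wf); try (by case: wg); exact: V_L2.
Qed.

Lemma H1_inner_laplace f g : V M f -> V M g ->
  [/\ measurable_fun setT (orbit (H1_inner M ^~ g) f),
      integ leb (fun t => hexp (lam M) t * orbit (H1_inner M ^~ g) f t) &
      \int[leb]_t (hexp (lam M) t * orbit (H1_inner M ^~ g) f t) =
      H1_inner M (Res k (ext f)) g].
Proof.
move=> Vf Vg; have [f' wf] := V_wderiv Vf; have [g' wg] := V_wderiv Vg.
have lf := V_L2 Vf; have lg := V_L2 Vg; have [lf' _] := wf; have [lg' _] := wg.
have e t := H1_inner_orbit t Vf Vg wf wg.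
have [i1 e1] := Rint_hexp_corr k_gt0 lf lg.
have [i2 e2] := Rint_hexp_corr k_gt0 lf' lg'.
have E t : hexp (lam M) t * orbit (H1_inner M ^~ g) f t =
    hexp k t * corr (ext f) (ext g) t + hexp k t * corr (ext f') (ext g') t.
  by rewrite e hexpD; ring.
split.
- rewrite (funext e); apply: measurable_funM; first exact: measurable_hexp.
  by apply: measurable_funD; apply: measurable_corr; solve [case: lf => // | case: lg => // | case: lf' => // | case: lg' => //].
- by rewrite (funext E); exact: integD.
- under eq_Rintegral => t _ do rewrite E.
  rewrite RintegralD// e1 e2.
  rewrite (H1_innerE sbar_ge0 (V_Res sbar_ge0 k_gt0 Vf) Vg (wderiv_Res sbar_ge0 k_gt0 Vf wf) wg).
  have H a b : \int[leb]_s (Res k (ext a) s * ext b s) =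
      \int[leb]_s (ext (Res k (ext a)) s * ext b s).
    apply: eq_Rintegral => s _; have [As|nAs] := pselect (ages M s).
      by rewrite (extE (Res _ _) As).
    by rewrite (ext_out b nAs) !mulr0.
  by rewrite !H.
Qed.

(** For an H^1 inner product this is [H1_inner_laplace]. Approximating [y] in the dual norm moves
    its orbit by at most a small multiple of [hexp (mu M)]: measurability passes to the pointwise
    limit, and the identity holds up to any [e]. *)
Lemma laplace_orbit y f : dualV M y -> V M f ->
  [/\ measurable_fun setT (orbit y f),
      integ leb (fun t => hexp (lam M) t * orbit y f t) &
      \int[leb]_t (hexp (lam M) t * orbit y f t) = y (Res k (ext f))].
Proof.
move=> dy Vf.
have H0 : 0 <= H1_norm M f by exact: H1_norm_ge0.
have near_orbit d g : 0 < d -> V M g ->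
    (forall h, V M h -> `|y h - H1_inner M h g| <= d * H1_norm M h) -> forall t,
    `|orbit y f t - orbit (H1_inner M ^~ g) f t| <= d * H1_norm M f * hexp (mu M) t.
  move=> d0 Vg hg t; rewrite /orbit /hexp; case: ifPn => [t0|_]; last first.
    by rewrite subrr normr0 mulr0.
  apply: le_trans (hg _ (V_T sbar_ge0 t0 Vf)) _.
  by rewrite -mulrA ler_wpM2l ?(ltW d0)// mulrC; exact: H1_norm_T.
have mo : measurable_fun setT (orbit y f).
  have pos n : 0 < (n.+1%:R : R)^-1 by rewrite invr_gt0.
  have ap n := cid2 (dual_approx sbar_ge0 dy (pos n)).
  pose G n := projT1 (ap n).
  have VG n : V M (G n) by rewrite /G; case: (ap n).
  have hG n : forall h, V M h -> `|y h - H1_inner M h (G n)| <= n.+1%:R^-1 * H1_norm M h.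
    by rewrite /G; case: (ap n).
  apply: (@measurable_fun_cvg _ _ _ _ (fun n => orbit (H1_inner M ^~ (G n)) f)) => //.
    by move=> n; have [] := H1_inner_laplace Vf (VG n).
  move=> t _; apply/cvgrPdist_le => e e0.
  pose C := H1_norm M f * hexp (mu M) t + 1.
  have C0 : 0 < C by rewrite ltr_pwDr// mulr_ge0 ?hexp_ge0.
  have := near_infty_natSinv_lt (PosNum (divr_gt0 e0 C0)).
  apply: filterS => n /= hn; apply: le_trans (near_orbit _ _ (pos n) (VG n) (hG n) t) _.
  rewrite -mulrA; apply: (@le_trans _ _ (n.+1%:R^-1 * C)).
    by rewrite ler_wpM2l// /C lerDl.
  by rewrite -ler_pdivlMr// ltW.
have io : integ leb (fun t => hexp (lam M) t * orbit y f t).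
  have [C C0 oC] := orbit_bound dy Vf.
  apply: (integ_le _ _ (integZ C (integ_hexp k_gt0))).
    by apply: measurable_funM => //; exact: measurable_hexp.
  move=> t; rewrite normrM (ger0_norm (hexp_ge0 _ _)) hexpD mulrA [leRHS]mulrC.
  by rewrite ler_wpM2l ?hexp_ge0.
split => //.
apply/eqP; rewrite -subr_eq0 -normr_le0; apply/ler_addgt0Pl => e e0; rewrite addr0.
(* [K] is the total error per unit of [d]: the orbits contribute their bound integrated against the
   discount, the right-hand side contributes the norm of the resolvent, and [+ 1] keeps [K]
   positive. *)
pose K := H1_norm M f / k + H1_norm M (Res k (ext f)) + 1.
have K0 : 0 < K.
  by rewrite ltr_pwDr// addr_ge0 ?H1_norm_ge0// divr_ge0 ?H1_norm_ge0// ltW.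
have d0 : 0 < e / K by rewrite divr_gt0.
have [g Vg hg] := dual_approx sbar_ge0 dy d0.
have [mg ig eg] := H1_inner_laplace Vf Vg.
have VR := V_Res sbar_ge0 k_gt0 Vf.
rewrite (_ : _ - _ = \int[leb]_t (hexp (lam M) t * orbit y f t -
    hexp (lam M) t * orbit (H1_inner M ^~ g) f t) -
  (y (Res k (ext f)) - H1_inner M (Res k (ext f)) g)); last first.
  by rewrite RintegralB// eg; ring.
apply: le_trans (ler_normB _ _) _.
apply: (@le_trans _ _ (e / K * (H1_norm M f / k) + e / K * H1_norm M (Res k (ext f)))).
  apply: lerD; last exact: hg.
  apply: le_trans (le_normr_Rintegral measurableT (integB io ig)) _.
  rewrite mulrA -(Rint_hexp k_gt0) -RintegralZl//; last exact: integ_hexp.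
  apply: le_Rintegral => //.
  - exact: integ_norm (integB io ig).
  - by apply: integZ; exact: integ_hexp.
  move=> t _; rewrite -mulrBr normrM (ger0_norm (hexp_ge0 _ _)) hexpD mulrA [leRHS]mulrC.
  by rewrite ler_wpM2l ?hexp_ge0// near_orbit.
rewrite -mulrDr -ler_pdivlMl// invf_div divfK ?gt_eqF//.
by rewrite /K lerDl.
Qed.

End laplace_transform.

(** * Controls and the mild solution *)

Section controls.
Context (R : realType) (M : vintage_model R).
Hypothesis sbar_ge0 : (0 <= sbar M)%E.
Hypothesis mu_gt0 : 0 < mu M.
Hypothesis lam_gt0 : 0 < lam M.
Local Notation leb := (@lebesgue_measure R).
Local Notation ext := (ext M).
Local Notation T := (adjoint_semigroup M).
Local Notation k := (mu M + lam M).
Implicit Types (f g : R -> R) (w : R -> R * (R -> R)).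

(** Admissibility constrains a control at positive times and on [ages] only; [ctl0] and [ctl1] are
    cut there so as to be measurable everywhere. *)
Definition ctl0 w t := if 0 < t then (w t).1 else 0.

Definition ctl1 w t s := if 0 < t then ext (w t).2 s else 0.

Lemma admissibleP w : admissible M 0 w <->
  L2 leb (fun t => hexp (lam M / 2) t * ctl0 w t) /\
  L2 (leb \x leb)%E (fun z : R * R => hexp (lam M / 2) z.1 * ctl1 w z.1 z.2).
Proof.
have e0 : (fun t => expR (- lam M * t / 2) * (w t).1) \_ `]0, +oo[ =
    (fun t => hexp (lam M / 2) t * ctl0 w t).
  apply/funext => t; rewrite patchE mem_setE in_itv/= andbT /ctl0.
  case: ifPn => t0; last by rewrite mulr0.
  by rewrite hexp_pos ?ltW//; congr (expR _ * _); ring.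
have e1 : (fun z : R * R => expR (- lam M * z.1 / 2) * (w z.1).2 z.2)
     \_ (`]0, +oo[ `*` ages M) =
    (fun z : R * R => hexp (lam M / 2) z.1 * ctl1 w z.1 z.2).
  apply/funext => -[t s]; rewrite patchE in_setX mem_setE in_itv/= andbT /ctl1/=.
  case: (ltP 0 t) => t0 /=; last by rewrite mulr0.
  rewrite hexp_pos ?ltW// ext_if; case: ifP => _; last by rewrite mulr0.
  by congr (expR _ * _); ring.
by rewrite /admissible e0 e1; split=> -[/Lfun2P h0 /Lfun2P h1].
Qed.

Section admissible_control.
Variable w : R -> R * (R -> R).
Hypothesis aw : admissible M 0 w.

Let a0 := proj1 ((admissibleP w).1 aw).
Let a1 := proj2 ((admissibleP w).1 aw).

Lemma measurable_ctl0 : measurable_fun setT (ctl0 w).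
Proof.
have [m0 _] := a0.
rewrite (_ : ctl0 w = fun t => expR (lam M / 2 * t) * (hexp (lam M / 2) t * ctl0 w t)).
  by apply: measurable_funM => //; apply: measurableT_comp => //; exact: measurable_funM.
apply/funext => t; rewrite /ctl0; case: ifPn => t0; last by rewrite !mulr0.
by rewrite hexp_pos ?ltW// mulrA -expRD mulNr subrr expR0 mul1r.
Qed.

Lemma measurable_ctl1 : measurable_fun setT (fun z : R * R => ctl1 w z.1 z.2).
Proof.
have [m1 _] := a1.
rewrite (_ : (fun z : R * R => _) = fun z : R * R => expR (lam M / 2 * z.1) *
  (hexp (lam M / 2) z.1 * ctl1 w z.1 z.2)).
  apply: measurable_funM => //; apply: measurableT_comp => //.
  by apply: measurable_funM => //; exact: measurable_fst.
apply/funext => -[t s]; rewrite /ctl1/=; case: ifPn => t0; last by rewrite !mulr0.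
by rewrite hexp_pos ?ltW// mulrA -expRD mulNr subrr expR0 mul1r.
Qed.

Lemma measurable_ctl1_row t : measurable_fun setT (ctl1 w t).
Proof. exact: (measurable_fun_pair2 t measurable_ctl1). Qed.

Let sq (z : R * R) := (hexp (lam M / 2) z.1 * ctl1 w z.1 z.2) ^+ 2.

Let sq_lty : (\int[leb]_t \int[leb]_s `|sq (t, s)|%:E < +oo)%E.
Proof.
have [m1 i1] := a1.
apply/(integrable12ltyP leb leb (f := EFin \o sq)) => //.
exact/measurable_EFinP/measurable_funX.
Qed.

Let msq : measurable_fun setT sq.
Proof. by apply: measurable_funX; case: a1. Qed.

(** Fubini on the square. A slice may leave L^2 on a null set of times, which is why later bounds
    hold for almost every time. *)
Lemma ae_L2_ctl1 : {ae leb, forall t, L2 leb (ctl1 w t)}.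
Proof.
have [ae1 _ _ _ _] := Rfubini (m1 := leb) (m2 := leb) sq msq sq_lty.
apply: aeS ae1 => t h; split; first exact: measurable_ctl1_row.
have [t0|t0] := ltP 0 t; last first.
  by rewrite /ctl1 ltNge t0/=; under eq_fun => s do rewrite expr0n; exact: integ0.
have := integZ (expR (lam M * t)) h; congr integ; apply/funext => s.
rewrite /sq/= exprMn mulrA hexp_pos ?ltW// expr2 -!expRD.
by rewrite (_ : _ + _ = 0) ?expR0 ?mul1r//; field.
Qed.

Definition size_ctl t := nrm leb (ctl1 w t) + `|ctl0 w t|.

Lemma size_ctl_ge0 t : 0 <= size_ctl t.
Proof. by rewrite addr_ge0// nrm_ge0. Qed.

Lemma measurable_nrm_ctl1 : measurable_fun setT (fun t => nrm leb (ctl1 w t)).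
Proof.
apply: measurableT_comp; first exact: (continuous_measurable_fun (@sqrt_continuous R)).
apply: (measurable_Rint_param (m2 := leb) (fun z => ctl1 w z.1 z.2 ^+ 2)).
by apply: measurable_funX; exact: measurable_ctl1.
Qed.

Lemma L2_nrm_ctl1 : L2 leb (fun t => hexp (lam M / 2) t * nrm leb (ctl1 w t)).
Proof.
have [_ _ i1 _ _] := Rfubini (m1 := leb) (m2 := leb) sq msq sq_lty.
have mm : measurable_fun setT (fun t => hexp (lam M / 2) t * nrm leb (ctl1 w t)).
  by apply: measurable_funM; [exact: measurable_hexp|exact: measurable_nrm_ctl1].
split=> //; apply: (ae_integ _ _ i1); first exact: measurable_funX.
apply: aeS ae_L2_ctl1 => t lt; rewrite exprMn sqr_nrm -RintegralZl//; last by case: lt.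
by apply: eq_Rintegral => s _; rewrite /sq/= exprMn.
Qed.

Lemma L2_size_ctl : L2 leb (fun t => hexp (lam M / 2) t * size_ctl t).
Proof.
under eq_fun => t do rewrite mulrDr.
apply: L2D; first exact: L2_nrm_ctl1.
have := L2_norm a0; congr L2; apply/funext => t.
by rewrite normrM (ger0_norm (hexp_ge0 _ _)).
Qed.

Lemma measurable_size_ctl : measurable_fun setT size_ctl.
Proof.
apply: measurable_funD; first exact: measurable_nrm_ctl1.
by apply: measurableT_comp => //; exact: measurable_ctl0.
Qed.

Lemma integ_size_ctl : integ leb (fun t => hexp (lam M) t * size_ctl t).
Proof.
have l2 : 0 < lam M / 2 by rewrite divr_gt0.
have := L2_mul (L2_hexp l2) L2_size_ctl; congr integ; apply/funext => t.
by rewrite mulrA -hexpD -splitr.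
Qed.

Lemma L2_box_size_ctl t : L2 leb (fun x => box t x * size_ctl x).
Proof.
apply: (L2_le _ _ (L2Z (expR (lam M / 2 * t)) L2_size_ctl)).
  by apply: measurable_funM; [exact: measurable_box|exact: measurable_size_ctl].
move=> x; rewrite /box; case: ifPn => [/andP[x0 xt]|_]; last by rewrite mul0r normr0.
rewrite mul1r mulrA [leRHS]normrM ler_peMl// hexp_pos// -expRD ger0_norm ?expR_ge0//.
rewrite -expR0 ler_expR mulNr -mulrBr mulr_ge0 ?subr_ge0// divr_ge0// ltW//.
Qed.

Lemma integ_box_size_ctl t : integ leb (fun x => box t x * size_ctl x).
Proof.
have := L2_mul (L2_box t) (L2_box_size_ctl t); congr integ; apply/funext => x.
by rewrite /box; case: ifP; rewrite ?mul1r ?mul0r.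
Qed.

(* The pairing of the control at time [r] with [T t f], written as a correlation
   to be jointly measurable in [t] and [r]. *)
Definition kap f t r := hexp (mu M) t *
  (corr (ext f) (ctl1 w r) t + ext f t * ctl0 w r).

Lemma kap_neg f t r : t < 0 -> kap f t r = 0.
Proof. by move=> t0; rewrite /kap hexp_neg// mul0r. Qed.

Lemma kap_out f t r : r <= 0 -> kap f t r = 0.
Proof.
move=> r0; rewrite /kap /ctl0 /ctl1 ltNge r0/= mulr0 addr0 /corr.
by rewrite Rint_eq0 ?mulr0// => s; rewrite mulr0.
Qed.

Lemma measurable_kap f : L2 leb (ext f) ->
  measurable_fun setT (fun z : R * R => kap f z.1 z.2).
Proof.
move=> [mf _]; apply: measurable_funM.
  exact: (measurableT_comp (measurable_hexp _) measurable_fst).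
apply: measurable_funD; last first.
  apply: measurable_funM; first exact: (measurableT_comp mf measurable_fst).
  exact: (measurableT_comp measurable_ctl0 measurable_snd).
apply: (measurable_Rint_param (m2 := leb)
  (fun z : (R * R) * R => ext f (z.2 + z.1.1) * ctl1 w z.1.2 z.2)).
have m11 : measurable_fun setT (fun z : (R * R) * R => z.1.1).
  exact: (measurableT_comp measurable_fst measurable_fst).
have m12 : measurable_fun setT (fun z : (R * R) * R => z.1.2).
  exact: (measurableT_comp measurable_snd measurable_fst).
apply: measurable_funM.
  apply: (measurableT_comp mf); apply: measurable_funD => //.
apply: (measurableT_comp measurable_ctl1 (g := fun z : (R * R) * R => (z.1.2, z.2))).
by apply: measurable_fun_pair => //; exact: measurable_snd.
Qed.

Lemma kap_bound f t r : V M f -> L2 leb (ctl1 w r) ->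
  `|kap f t r| <= 2 * H1_norm M f * hexp (mu M) t * size_ctl r.
Proof.
move=> Vf lr; have [f' wf] := V_wderiv Vf; have [nf _] := nrm_le_H1_norm sbar_ge0 Vf wf.
have lf := V_L2 Vf; have [mf _] := lf.
rewrite /kap normrM (ger0_norm (hexp_ge0 _ _)) [_ * hexp _ _]mulrC -mulrA.
rewrite ler_wpM2l ?hexp_ge0//; apply: le_trans (ler_normD _ _) _.
rewrite mulrDr; apply: lerD.
  apply: le_trans (cauchy_schwarz (L2_shift t lf) lr) _.
  rewrite nrm_shift// ler_wpM2r ?nrm_ge0//; have := H1_norm_ge0 M f; lra.
by rewrite normrM ler_wpM2r// ext_le_H1_norm.
Qed.

(** The contribution of the control to the mild solution; [kap_neg] and [kap_out] confine the
    integrand to [0 < r <= t]. *)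
Definition forced f t := \int[leb]_r kap f (t - r) r.

Lemma measurable_kap_diag f t : L2 leb (ext f) ->
  measurable_fun setT (fun r : R => kap f (t - r) r).
Proof.
move=> lf; apply: (measurableT_comp (measurable_kap lf) (g := fun r : R => (t - r, r))).
by apply: measurable_fun_pair => //; exact: measurable_funB.
Qed.

Lemma kap_diag_bound f t r : V M f -> L2 leb (ctl1 w r) ->
  `|kap f (t - r) r| <= 2 * H1_norm M f * (box t r * size_ctl r).
Proof.
move=> Vf lr; rewrite /box; have [r0|r0] := leP 0 r => /=; last first.
  by rewrite kap_out ?normr0 ?mul0r ?mulr0// ltW.
have [rt|tr] := leP r t; last by rewrite kap_neg ?subr_lt0// normr0 mul0r mulr0.
apply: le_trans (kap_bound _ Vf lr) _; rewrite mul1r ler_wpM2r ?size_ctl_ge0//.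
by rewrite ler_piMr ?mulr_ge0 ?H1_norm_ge0// hexp_le1// ltW.
Qed.

Lemma integ_kap_diag f t : V M f -> integ leb (fun r : R => kap f (t - r) r).
Proof.
move=> Vf; apply: (integ_le_ae _ _ (integZ (2 * H1_norm M f) (integ_box_size_ctl t))).
  exact: measurable_kap_diag (V_L2 Vf).
by apply: aeS ae_L2_ctl1 => r lr; exact: kap_diag_bound.
Qed.

Lemma forced_bound f t : V M f ->
  `|forced f t| <= 2 * H1_norm M f * \int[leb]_r (box t r * size_ctl r).
Proof.
move=> Vf; have ib := integ_box_size_ctl t.
apply: le_trans (le_normr_Rintegral measurableT (integ_kap_diag t Vf)) _.
rewrite -RintegralZl//; apply: ae_le_Rint.
- exact: integ_norm (integ_kap_diag t Vf).
- exact: integZ.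
- by apply: aeS ae_L2_ctl1 => r lr; exact: kap_diag_bound.
Qed.

Lemma forced_comb a f g t : V M f -> V M g ->
  forced (fun s => a * f s + g s) t = a * forced f t + forced g t.
Proof.
move=> Vf Vg; have if_ := integ_kap_diag t Vf; have ig := integ_kap_diag t Vg.
rewrite /forced -RintegralZl// -RintegralD//; last exact: integZ.
apply: ae_Rint.
- exact: measurable_kap_diag (V_L2 (V_comb a Vf Vg)).
- exact: integ_measurable (integD (integZ a if_) ig).
apply: aeS ae_L2_ctl1 => r lr; rewrite /kap.
rewrite (_ : ext (fun s => a * f s + g s) = fun s => a * ext f s + ext g s); last first.
  by apply/funext => s; rewrite extD ext_cst.
rewrite (_ : corr _ _ _ = a * corr (ext f) (ctl1 w r) (t - r) +
    corr (ext g) (ctl1 w r) (t - r)); first by ring.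
by rewrite /corr (Rint_combM a (A := fun s => ext f (s + (t - r))))//; apply: L2_shift; exact: V_L2.
Qed.

End admissible_control.

End controls.

(** * The mild solution and the Laplace transform of its forced part *)

Section state_equation.
Context (R : realType) (M : vintage_model R).
Hypothesis sbar_ge0 : (0 <= sbar M)%E.
Hypothesis mu_gt0 : 0 < mu M.
Hypothesis lam_gt0 : 0 < lam M.
Local Notation leb := (@lebesgue_measure R).
Local Notation ext := (ext M).
Local Notation T := (adjoint_semigroup M).
Local Notation k := (mu M + lam M).
Implicit Types (f g : R -> R) (w v : R -> R * (R -> R)) (y : (R -> R) -> R).

Let k_gt0 : 0 < k. Proof. exact: addr_gt0. Qed.

Definition cpair w f t := \int[leb]_s (ext f s * ctl1 M w t s) + ext f 0 * ctl0 w t.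

Lemma cpairE w f t : 0 < t -> cpair w f t = control_operator M (w t) f.
Proof.
move=> t0; rewrite /cpair /control_operator /ctl1 /ctl0 t0 pair_agesE.
by rewrite (extE f (ages0 sbar_ge0)) [_ * f 0]mulrC.
Qed.

Section one_control.
Variable w : R -> R * (R -> R).
Hypothesis aw : admissible M 0 w.

Lemma cpair_T f t r : 0 <= t -> V M f -> L2 leb (ctl1 M w r) ->
  cpair w (T t f) r = kap M w f t r.
Proof.
move=> t0 Vf lr; rewrite /cpair /kap ext_T// lexx add0r hexp_pos// mulrDr mulrA.
congr (_ + _); rewrite /corr -RintegralZl//; last exact: L2_mul (L2_shift t (V_L2 Vf)) lr.
apply: eq_Rintegral => s _; rewrite ext_T//; case: ifPn => [_|]; first by rewrite mulrA.
rewrite -ltNge => s0; suff -> : ctl1 M w r s = 0 by rewrite !mulr0.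
by rewrite /ctl1; case: ifP => // _; exact: ext_neg.
Qed.

Lemma measurable_cpair_diag f t : V M f ->
  measurable_fun setT (fun r : R => if (0 < r) && (r <= t) then cpair w (T (t - r) f) r else 0).
Proof.
move=> Vf; have [mf _] := V_L2 Vf.
have ml := measurable_ctl1 aw; have m0 := measurable_ctl0 aw.
(* [H] omits the cut of the semigroup at negative ages, where the control vanishes, and is jointly
   measurable. *)
pose H r s := expR (- mu M * (t - r)) * ext f (s + (t - r)).
have mH : measurable_fun setT (fun z : R * R => H z.1 z.2).
  have mt : measurable_fun setT (fun z : R * R => t - z.1).
    by apply: measurable_funB => //; exact: measurable_fst.
  apply: measurable_funM.
    by apply: measurableT_comp => //; exact: measurable_funM.
  apply: (measurableT_comp mf); apply: measurable_funD => //.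
pose P r := \int[leb]_s (H r s * ctl1 M w r s) + H r 0 * ctl0 w r.
have mP : measurable_fun setT P.
  apply: measurable_funD.
    apply: (measurable_Rint_param (m2 := leb) (fun z => H z.1 z.2 * ctl1 M w z.1 z.2)).
    exact: measurable_funM.
  apply: measurable_funM => //; exact: (measurable_fun_pair1 (f := fun z : R * R => H z.1 z.2) 0 mH).
rewrite (_ : (fun r : R => _) = fun r => if (0 < r) && (r <= t) then P r else 0).
  apply: measurable_fun_ifT => //; apply: measurable_and.
    exact: measurable_fun_ltr.
  exact: measurable_fun_ler.
apply/funext => r; case: ifPn => // /andP[r0 rt].
have tr : 0 <= t - r by rewrite subr_ge0.
rewrite /cpair /P /H ext_T// lexx; congr (_ + _).
apply: eq_Rintegral => s _; rewrite ext_T//; case: ifPn => [//|].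
rewrite -ltNge => s0; suff -> : ctl1 M w r s = 0 by rewrite !mulr0.
by rewrite /ctl1; case: ifP => // _; exact: ext_neg.
Qed.

Lemma stateE y f t : 0 <= t -> V M f ->
  state M 0 y w t f = orbit M y f t + forced M w f t.
Proof.
move=> t0 Vf; rewrite /state /semigroup /orbit t0 subr0; congr (_ + _).
(* [D] is the integrand of [state]. It is shown equal to [kap] only at times with an L^2 slice, so
   it needs its own measurability before the integrals can be compared. *)
pose D r := if (0 < r) && (r <= t) then cpair w (T (t - r) f) r else 0.
have mD : measurable_fun setT D by exact: measurable_cpair_diag.
have ik := integ_kap_diag sbar_ge0 mu_gt0 lam_gt0 aw t Vf.
have eD : {ae leb, forall r, kap M w f (t - r) r = D r}.
  apply: aeS (ae_L2_ctl1 aw) => r lr; rewrite /D; case: ifPn => [/andP[r0 rt]|].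
    by rewrite cpair_T// subr_ge0.
  rewrite negb_and -leNgt -ltNge => /orP[r0|tr]; first by rewrite kap_out.
  by rewrite kap_neg// subr_lt0.
have iD : integ leb D by exact: ae_integ eD ik.
have patchD : (fun r => control_operator M (w r) (T (t - r) f)) \_ `]0, t] = D.
  apply/funext => r; rewrite patchE mem_setE in_itv/= /D.
  by case: ifP => // /andP[r0 _]; rewrite cpairE.
(* The control is arbitrary at time 0, so that endpoint is removed first. *)
rewrite -Rintegral_itv_obnd_cbnd; last first.
  apply/integrable_mkcond => //; move: iD; rewrite /integ -patchD.
  by congr integrable; apply/funext => r; rewrite /= !patchE; case: ifP.
rewrite Rintegral_mkcond patchD /forced; apply/esym/ae_Rint => //.
exact: integ_measurable ik.
Qed.

(** An action at time [r] is felt at time [t + r] through [T t f], and the Laplace transform in the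
    delay [t] produces the resolvent. *)
Lemma ae_kap_laplace f : V M f ->
  {ae leb, forall r, 0 <= r -> integ leb (fun t => hexp (lam M) (t + r) * kap M w f t r) /\
    \int[leb]_t (hexp (lam M) (t + r) * kap M w f t r) =
    hexp (lam M) r * cpair w (Res k (ext f)) r}.
Proof.
move=> Vf; have lf := V_L2 Vf; have [mf _] := lf.
apply: aeS (ae_L2_ctl1 aw) => r lr r0.
have [i1 e1] := Rint_hexp_corr k_gt0 lf lr.
have i2 : integ leb (fun t => hexp k t * ext f t).
  by have := Res_integ k_gt0 0 lf; under eq_fun => t do rewrite subr0.
have E t : hexp (lam M) (t + r) * kap M w f t r =
    hexp (lam M) r * (hexp k t * corr (ext f) (ctl1 M w r) t +
      ctl0 w r * (hexp k t * ext f t)).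
  have [t0|t0] := leP 0 t; last by rewrite kap_neg// (hexp_neg k t0); ring.
  by rewrite hexpM// /kap hexpD; ring.
split.
  by rewrite (funext E); apply: integZ; apply: integD => //; exact: integZ.
under eq_Rintegral => t _ do rewrite E.
rewrite RintegralZl//; last by apply: integD => //; exact: integZ.
rewrite RintegralD//; last exact: integZ.
rewrite RintegralZl// {}e1 /cpair; congr (_ * (_ + _)).
  apply: eq_Rintegral => s _; have [As|nAs] := pselect (ages M s).
    by rewrite (extE (Res _ _) As).
  suff -> : ctl1 M w r s = 0 by rewrite !mulr0.
  by rewrite /ctl1; case: ifP => // _; exact: ext_out.
rewrite mulrC (extE (Res k (ext f)) (ages0 sbar_ge0)); congr (_ * _).
by rewrite /Res; apply: eq_Rintegral => t _; rewrite subr0.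
Qed.

(** Fubini between the time of observation and the time of action; [hb] dominates the integrand by
    the discounted size of the control times a decaying exponential of the delay. *)
Lemma laplace_forced f : V M f ->
  [/\ integ leb (fun t => hexp (lam M) t * forced M w f t),
      integ leb (fun r => hexp (lam M) r * cpair w (Res k (ext f)) r) &
      \int[leb]_t (hexp (lam M) t * forced M w f t) =
      \int[leb]_r (hexp (lam M) r * cpair w (Res k (ext f)) r)].
Proof.
move=> Vf; have lf := V_L2 Vf.
pose C := 2 * H1_norm M f.
have C0 : 0 <= C by rewrite mulr_ge0 ?H1_norm_ge0.
have mk := measurable_kap aw lf.
pose h (z : R * R) := hexp (lam M) z.2 * kap M w f (z.2 - z.1) z.1.
have mh : measurable_fun setT h.
  apply: measurable_funM; first exact: (measurableT_comp (measurable_hexp _) measurable_snd).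
  apply: (measurableT_comp mk (g := fun z : R * R => (z.2 - z.1, z.1))).
  apply: measurable_fun_pair; last exact: measurable_fst.
  by apply: measurable_funB; [exact: measurable_snd|exact: measurable_fst].
have hb r t : L2 leb (ctl1 M w r) ->
    `|h (r, t)| <= C * (hexp (lam M) r * size_ctl M w r) * hexp k (t - r).
  move=> lr; rewrite /h/=.
  have [r0|r0] := leP r 0.
    by rewrite kap_out// mulr0 normr0 !mulr_ge0 ?hexp_ge0 ?size_ctl_ge0 ?H1_norm_ge0.
  have [tr|rt] := ltP t r.
    by rewrite kap_neg ?subr_lt0// mulr0 normr0 !mulr_ge0 ?hexp_ge0 ?size_ctl_ge0 ?H1_norm_ge0.
  rewrite normrM (ger0_norm (hexp_ge0 _ _)).
  rewrite -{1}(subrK r t) (hexpM (lam M)) ?subr_ge0 ?(ltW r0)//.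
  apply: (@le_trans _ _ (hexp (lam M) (t - r) * hexp (lam M) r *
      (C * hexp (mu M) (t - r) * size_ctl M w r))).
    by rewrite ler_wpM2l ?mulr_ge0 ?hexp_ge0//; exact: kap_bound.
  by rewrite hexpD le_eqVlt; apply/orP; left; apply/eqP; ring.
have isz := integ_size_ctl lam_gt0 aw.
have ihx r : integ leb (fun t => hexp k (t - r)) by exact: (integ_shift (- r) (integ_hexp k_gt0)).
have ehx r : \int[leb]_t hexp k (t - r) = k^-1.
  by rewrite (Rint_shift (- r) (measurable_hexp k)) Rint_hexp.
have e1 t : \int[leb]_r h (r, t) = hexp (lam M) t * forced M w f t.
  by rewrite /forced -RintegralZl//; exact: (integ_kap_diag sbar_ge0 mu_gt0 lam_gt0 aw t Vf).
have e2 : {ae leb, forall r, \int[leb]_t h (r, t) =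
    hexp (lam M) r * cpair w (Res k (ext f)) r}.
  apply: aeS (ae_kap_laplace Vf) => r hr.
  have [r0|r0] := leP 0 r; last first.
    rewrite hexp_neg// mul0r; apply: Rint_eq0 => t.
    by rewrite /h/= (kap_out _ _ _ _ (ltW r0)) mulr0.
  have [_ <-] := hr r0; rewrite -(Rint_shift r); last exact: (measurable_fun_pair2 r mh).
  by apply: eq_Rintegral => t _; rewrite /h/= addrK.
have mcp : measurable_fun setT (fun r => hexp (lam M) r * cpair w (Res k (ext f)) r).
  have [mRf _] := V_L2 (V_Res sbar_ge0 k_gt0 Vf).
  apply: measurable_funM; first exact: measurable_hexp.
  apply: measurable_funD; last first.
    by apply: measurable_funM; [exact: measurable_cst|exact: (measurable_ctl0 aw)].
  apply: (measurable_Rint_param (m2 := leb)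
    (fun z => ext (Res k (ext f)) z.2 * ctl1 M w z.1 z.2)).
  apply: measurable_funM; first exact: (measurableT_comp mRf measurable_snd).
  exact: measurable_ctl1.
have [|_ _ i1 i2 e] := Rfubini (m1 := leb) (m2 := leb) h mh.
  apply: (@le_lt_trans _ _ (\int[leb]_r
      (k^-1 * (C * (hexp (lam M) r * size_ctl M w r)))%:E)%E); last first.
    by apply: integrable_lty => //; exact: (integZ _ (integZ C isz)).
  have msz := integ_measurable isz.
  apply: ae_ge0_le_integral => //.
  - by move=> r _; exact: integral_ge0.
  - apply: (measurable_fun_fubini_tonelli_F (m2 := leb) (fun z => `|h z|%:E)) => //.
    exact/measurable_EFinP/measurableT_comp.
  - move=> r _; rewrite lee_fin !mulr_ge0 ?hexp_ge0 ?size_ctl_ge0 ?H1_norm_ge0// invr_ge0 ltW//.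
  - by apply/measurable_EFinP; apply: measurable_funM => //; exact: measurable_funM.
  apply: aeS (ae_L2_ctl1 aw) => r lr _.
  rewrite mulrC -(ehx r) -RintegralZl//; last exact: ihx.
  rewrite EFin_Rint; last by apply: integZ; exact: ihx.
  by apply: le_integral_pointwise => t _; rewrite lee_fin hb.
split.
- by move: i2; under eq_fun => t do rewrite e1.
- exact: ae_integ e2 i1.
- under eq_Rintegral => t _ do rewrite -e1.
  by rewrite -{}e; apply: ae_Rint => //; exact: integ_measurable i1.
Qed.

End one_control.

Definition control_sub v (u : R * (R -> R)) t : R * (R -> R) :=
  ((v t).1 - u.1, fun s => (v t).2 s - u.2 s).

Lemma ctl0_sub v u t : ctl0 (control_sub v u) t = ctl0 v t - ctl0 (fun=> u) t.
Proof. by rewrite /ctl0; case: ifP => //; rewrite subr0. Qed.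

Lemma ctl1_sub v u t s :
  ctl1 M (control_sub v u) t s = ctl1 M v t s - ctl1 M (fun=> u) t s.
Proof. by rewrite /ctl1; case: ifP => //; rewrite ?subr0// extB. Qed.

Lemma admissible_sub v u : admissible M 0 v -> admissible M 0 (fun=> u) ->
  admissible M 0 (control_sub v u).
Proof.
move=> /admissibleP[v0 v1] /admissibleP[u0 u1]; apply/admissibleP; split.
- have := L2B v0 u0; congr L2; apply/funext => t.
  by rewrite ctl0_sub mulrBr.
- have := L2B v1 u1; congr L2; apply/funext => z.
  by rewrite ctl1_sub mulrBr.
Qed.

Lemma admissible_cst u : L2 leb (ext u.2) -> admissible M 0 (fun=> u).
Proof.
move=> lu; have [mu2 iu2] := lu; have l2 : 0 < lam M / 2 by rewrite divr_gt0.
have lh := L2_hexp l2.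
have E t : hexp (lam M / 2) t * ctl0 (fun=> u) t = hexp (lam M / 2) t * (if 0 < t then u.1 else 0).
  by [].
have mpos : measurable_fun setT (fun t : R => if 0 < t then 1 else 0 : R).
  by apply: measurable_fun_ifT => //; exact: measurable_fun_ltr.
apply/admissibleP; split.
- have lh1 := L2Z u.1 lh; apply: L2_le lh1.
    apply: measurable_funM; first exact: measurable_hexp.
    by apply: measurable_fun_ifT => //; exact: measurable_fun_ltr.
  move=> t; rewrite /ctl0 [u.1 * _]mulrC; case: ifP => // _.
  by rewrite mulr0 normr0.
apply/L2_ltyP.
have m1 : measurable_fun setT (fun z : R * R => hexp (lam M / 2) z.1 * ctl1 M (fun=> u) z.1 z.2).
  apply: measurable_funM; first exact: (measurableT_comp (measurable_hexp _) measurable_fst).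
  apply: measurable_fun_ifT => //.
    by apply: measurable_fun_ltr => //; exact: measurable_fst.
  exact: (measurableT_comp mu2 measurable_snd).
split => //; rewrite fubini_tonelli1//=; last first.
- by move=> z; rewrite lee_fin sqr_ge0.
- exact/measurable_EFinP/measurable_funX.
apply: (@le_lt_trans _ _ (\int[leb]_t
    ((\int[leb]_s (ext u.2 s ^+ 2)) * hexp (lam M) t)%:E)%E); last first.
  by apply: integrable_lty => //; exact: (integZ _ (integ_hexp lam_gt0)).
apply: le_integral_pointwise => t _; rewrite /fubini_F/=.
rewrite [X in (_ <= X%:E)%E]mulrC -RintegralZl// EFin_Rint; last exact: integZ.
apply: le_integral_pointwise => s _; rewrite lee_fin exprMn expr2 -hexpD -splitr.
rewrite ler_wpM2l ?hexp_ge0// /ctl1; case: ifP => // _.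
by rewrite expr0n sqr_ge0.
Qed.

Lemma kap_sub v u f t r : V M f -> L2 leb (ctl1 M v r) -> L2 leb (ctl1 M (fun=> u) r) ->
  kap M (control_sub v u) f t r = kap M v f t r - kap M (fun=> u) f t r.
Proof.
move=> Vf lv lu; rewrite /kap ctl0_sub.
rewrite (_ : corr (ext f) (ctl1 M (control_sub v u) r) t =
  corr (ext f) (ctl1 M v r) t - corr (ext f) (ctl1 M (fun=> u) r) t); first by ring.
have lf := L2_shift t (V_L2 Vf).
rewrite /corr -RintegralB//; [|exact: L2_mul|exact: L2_mul].
by apply: eq_Rintegral => s _; rewrite ctl1_sub mulrBr.
Qed.

Lemma forced_sub v u f t : V M f -> admissible M 0 v -> admissible M 0 (fun=> u) ->
  forced M v f t = forced M (control_sub v u) f t + forced M (fun=> u) f t.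
Proof.
move=> Vf av au; have asub := admissible_sub av au.
have iv := integ_kap_diag sbar_ge0 mu_gt0 lam_gt0 av t Vf.
have iu := integ_kap_diag sbar_ge0 mu_gt0 lam_gt0 au t Vf.
have iw := integ_kap_diag sbar_ge0 mu_gt0 lam_gt0 asub t Vf.
rewrite /forced -RintegralD//; apply: ae_Rint.
- exact: integ_measurable iv.
- exact: integ_measurable (integD iw iu).
apply: aeS (aeI (ae_L2_ctl1 av) (ae_L2_ctl1 au)) => r [lv lu].
by rewrite kap_sub// subrK.
Qed.

End state_equation.

(** * Constant controls and the linear-quadratic payoff *)

Section constant_control.
Context (R : realType) (M : vintage_model R).
Hypothesis sbar_ge0 : (0 <= sbar M)%E.
Hypothesis mu_gt0 : 0 < mu M.
Hypothesis lam_gt0 : 0 < lam M.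
Local Notation leb := (@lebesgue_measure R).
Local Notation ext := (ext M).
Local Notation T := (adjoint_semigroup M).
Variables (u0 : R) (u1 x : R -> R).
Hypothesis lu : L2 leb (ext u1).
Hypothesis lx : L2 leb (ext x).
Hypothesis x_stationary : ae_ages M (fun s => x s = stationary_state M u0 u1 s).

(** What an action of the constant control leaves after a delay [t]: [kap] freed from the time of
    action. Integrated over all delays it gives the stationary state. *)
Definition impulse f t := hexp (mu M) t * (corr (ext f) (ext u1) t + ext f t * u0).

Lemma impulse_integ f : V M f -> integ leb (impulse f) /\
  \int[leb]_t impulse f t = pivot M x f.
Proof.
move=> Vf; have lf := V_L2 Vf.
have [i1 e1] := Rint_hexp_corr mu_gt0 lf lu.
have i2 : integ leb (fun t => hexp (mu M) t * ext f t).
  by have := Res_integ mu_gt0 0 lf; under eq_fun => t do rewrite subr0.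
have E t : impulse f t = hexp (mu M) t * corr (ext f) (ext u1) t +
    u0 * (hexp (mu M) t * ext f t).
  by rewrite /impulse; ring.
split; first by rewrite (funext E); apply: integD => //; exact: integZ.
under eq_Rintegral => t _ do rewrite E.
rewrite RintegralD//; last exact: integZ.
rewrite RintegralZl// e1 /pivot.
have [ms _] := L2_stationary_state sbar_ge0 mu_gt0 u0 lu.
have [mf _] := lf; have [mx _] := lx.
rewrite (ae_pair mf mx ms x_stationary) (pair_stationary_state mu_gt0 u0 lf lu).
rewrite /control_operator pair_agesE/=; congr (_ + _ * _).
  apply: eq_Rintegral => s _; have [As|nAs] := pselect (ages M s).
    by rewrite (extE (Res _ _) As).
  by rewrite !(ext_out _ nAs) !mulr0.
by rewrite /Res; apply: eq_Rintegral => t _; rewrite subr0.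
Qed.

Lemma impulse_T f r t : L2 leb (ext f) -> 0 <= r ->
  impulse (T r f) t = if 0 <= t then impulse f (t + r) else 0.
Proof.
move=> lf r0; rewrite /impulse; case: ifPn => [t0|]; last first.
  by rewrite -ltNge => t0; rewrite hexp_neg// mul0r.
have -> : corr (ext (T r f)) (ext u1) t =
    expR (- mu M * r) * corr (ext f) (ext u1) (t + r).
  rewrite /corr -RintegralZl//; last exact: L2_mul (L2_shift (t + r) lf) lu.
  apply: eq_Rintegral => s _; rewrite ext_T//; case: ifPn => [_|].
    by rewrite addrA mulrA.
  rewrite -ltNge => st; rewrite (ext_neg M u1) ?mulr0//.
  by apply: le_lt_trans st; rewrite lerDl.
by rewrite ext_T// t0 hexpM// [hexp _ r]hexp_pos//; ring.
Qed.

Lemma Rint_reflect (g : R -> R) c : measurable_fun setT g ->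
  \int[leb]_r g (c - r) = \int[leb]_r g r.
Proof.
move=> mg; rewrite -(Rint_shift c mg) -(Rint_opp (measurable_fun_shift c mg)).
by apply: eq_Rintegral => r _; rewrite addrC.
Qed.

Lemma measurable_step c : measurable_fun setT (fun r : R => (r < c)%R%:R : R).
Proof.
rewrite (_ : (fun r => _) = \1_(`]-oo, c[%classic)).
  exact/measurable_indicP.
by apply/funext => r; rewrite indicE mem_setE in_itv.
Qed.

Lemma integ_step c g : integ leb g -> integ leb (fun r : R => (r < c)%R%:R * g r).
Proof.
move=> ig; apply: (integ_le _ _ (integ_norm ig)).
  by apply: measurable_funM; [exact: measurable_step|exact: integ_measurable ig].
by move=> r; case: (r < c); rewrite ?mul1r ?mul0r ?normr0.
Qed.

Lemma forced_cst f t : V M f ->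
  forced M (fun=> (u0, u1)) f t = \int[leb]_r ((r < t)%R%:R * impulse f r).
Proof.
move=> Vf; have [ii _] := impulse_integ Vf.
rewrite -(Rint_reflect t); last exact: integ_measurable (integ_step t ii).
rewrite /forced; apply: eq_Rintegral => r _; rewrite gtrBl.
rewrite /kap /impulse /ctl0 /ctl1 /=; case: ifPn => _ /=; first by rewrite mul1r.
by rewrite mul0r mulr0 addr0 /corr Rint_eq0 ?mulr0// => s; rewrite mulr0.
Qed.

(** The stationary state sums the responses over all delays: the orbit keeps the delays beyond [t],
    and the control resupplies those below [t]. *)
Lemma stationary_orbit f t : V M f -> 0 <= t ->
  orbit M (pivot M x) f t + forced M (fun=> (u0, u1)) f t = pivot M x f.
Proof.
move=> Vf t0; have [ii <-] := impulse_integ Vf.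
have [_ eT] := impulse_integ (V_T sbar_ge0 t0 Vf).
have ist := integ_step t ii.
have ms := integ_measurable (integB ii ist).
rewrite forced_cst// /orbit t0 -eT.
transitivity (\int[leb]_r (impulse f r - (r < t)%R%:R * impulse f r) +
    \int[leb]_r ((r < t)%R%:R * impulse f r)); last by rewrite RintegralB// subrK.
congr (_ + _); rewrite -[RHS](Rint_shift t)//.
apply: eq_Rintegral => r _; rewrite impulse_T//; last exact: V_L2.
rewrite gtrDr ltNge; case: (0 <= r) => /=; first by rewrite mul0r subr0.
by rewrite mul1r subrr.
Qed.

End constant_control.

Section lq_payoff.
Context (R : realType) (sb : \bar R) (mu lam : R)
    (Rev alpha : R -> R) (beta0 q0 eps : R) (beta1 q1 : R -> R).
Local Notation leb := (@lebesgue_measure R).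
Local Notation M := (lq_model sb mu lam Rev alpha beta0 q0 beta1 q1).
Local Notation ext := (ext M).
Hypothesis sb_ge0 : (0 <= sb)%E.
Hypothesis mu_gt0 : 0 < mu.
Hypothesis lam_gt0 : 0 < lam.
Hypothesis V_alpha : V M alpha.
Hypothesis eps_gt0 : 0 < eps.
Hypothesis eps_beta0 : eps <= beta0.
Hypothesis beta1_fin : Lp_ages M +oo%E beta1.
Hypothesis eps_beta1 : ae_ages M (fun s => eps <= beta1 s).
Hypothesis L2_q1 : Lp_ages M 2%:E q1.
Local Notation k := (mu + lam).

Let k_gt0 : 0 < k. Proof. exact: addr_gt0. Qed.

Let mbeta : measurable_fun setT (ext beta1). Proof. exact: measurable_beta1 beta1_fin. Qed.

Let lq1 : L2 leb (ext q1). Proof. exact/Lp2P. Qed.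

Lemma beta1_bounded : exists2 B : R, 0 <= B & {ae leb, forall s, `|ext beta1 s| <= B}.
Proof.
move: beta1_fin; rewrite /Lp_ages inE => /andP[_ /[!inE]/=].
rewrite /finite_norm unlock /Lnorm; case: ifPn => [_|].
  move=> hB; have [B {}hB] := @ess_supr_bounded _ _ R leb (fun s => `|ext beta1 s|) hB.
  exists `|B| => //; apply: aeS hB => s h; exact: le_trans h (ler_norm _).
(* The norm at [+oo] is an essential supremum only if the whole space has positive measure; in the
   other case every property holds almost everywhere. *)
rewrite -leNgt => T0 _; exists 0 => //; exists setT; split => //.
by apply/le_anti; rewrite T0 measure_ge0.
Qed.

Definition rcost (u : R * (R -> R)) : R := beta0 * u.1 ^+ 2 + q0 * u.1 +
  \int[leb]_s (ext beta1 s * ext u.2 s ^+ 2 + ext q1 s * ext u.2 s).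

Lemma integ_cost (u : R -> R) : L2 leb (ext u) ->
  integ leb (fun s => ext beta1 s * ext u s ^+ 2 + ext q1 s * ext u s).
Proof.
move=> lu; have [m_u iu] := lu; have [B B0 hB] := beta1_bounded.
apply: integD; last exact: L2_mul.
apply: (integ_le_ae _ _ (integZ B iu)).
  by apply: measurable_funM => //; exact: measurable_funX.
apply: aeS hB => s h; rewrite normrM (ger0_norm (sqr_ge0 _)).
by rewrite ler_wpM2r ?sqr_ge0.
Qed.

(* [zeta] is the gradient of the cost at [u], which is [2 eps]-strongly convex. *)
Lemma rcost_convex (u v : R * (R -> R)) (zeta : R -> R) :
  L2 leb (ext u.2) -> L2 leb (ext v.2) -> L2 leb (ext zeta) ->
  u.1 = (zeta 0 - q0) / (2 * beta0) ->
  ae_ages M (fun s => u.2 s = (zeta s - q1 s) / (2 * beta1 s)) ->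
  rcost u + control_operator M (v.1 - u.1, fun s => v.2 s - u.2 s) zeta +
    eps * ((v.1 - u.1) ^+ 2 + nrm leb (fun s => ext v.2 s - ext u.2 s) ^+ 2) <= rcost v.
Proof.
move=> lu lv lz eu0 eu1; have lw := L2B lv lu; have [mw iw] := lw.
have b0 : 0 < beta0 by exact: lt_le_trans eps_beta0.
have iu := integ_cost lu; have iv := integ_cost lv; have izw := L2_mul lz lw.
have e0 : beta0 * u.1 ^+ 2 + q0 * u.1 + zeta 0 * (v.1 - u.1) + eps * (v.1 - u.1) ^+ 2
    <= beta0 * v.1 ^+ 2 + q0 * v.1.
  have -> : zeta 0 = 2 * beta0 * u.1 + q0 by rewrite eu0; field; rewrite gt_eqF.
  have : 0 <= (beta0 - eps) * (v.1 - u.1) ^+ 2 by rewrite mulr_ge0 ?sqr_ge0 ?subr_ge0.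
  lra.
rewrite /rcost /control_operator pair_agesE sqr_nrm /=.
set I1 := \int[leb]_s _; set I2 := \int[leb]_s _; set I3 := \int[leb]_s _; set I4 := \int[leb]_s _.
suff : I1 + I2 + eps * I3 <= I4 by move: e0; lra.
have e2 : I2 = \int[leb]_s (ext zeta s * (ext v.2 s - ext u.2 s)).
  by apply: eq_Rintegral => s _; rewrite extB.
rewrite e2 /I1 /I3 /I4 -(RintegralZl eps measurableT iw).
rewrite -RintegralD// -RintegralD//; [|exact: integD|exact: integZ].
apply: ae_le_Rint => //; first by apply: integD; [exact: integD|exact: integZ].
apply: aeS (aeI eu1 eps_beta1) => s [h1 h2].
have [As|nAs] := pselect (ages M s); last first.
  by rewrite !(ext_out _ nAs) expr0n !mulr0 !mul0r subrr expr0n mulr0 !addr0.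
rewrite !extE//; have b1 := h2 As; have b1p : 0 < beta1 s by exact: lt_le_trans b1.
have -> : zeta s = 2 * beta1 s * u.2 s + q1 s by rewrite h1//; field; rewrite gt_eqF.
have : 0 <= (beta1 s - eps) * (v.2 s - u.2 s) ^+ 2 by rewrite mulr_ge0 ?sqr_ge0 ?subr_ge0.
lra.
Qed.

End lq_payoff.

(** * Restarting a control *)

Section restart.
Context (R : realType) (M : vintage_model R).
Hypothesis sbar_ge0 : (0 <= sbar M)%E.
Hypothesis mu_gt0 : 0 < mu M.
Hypothesis lam_gt0 : 0 < lam M.
Local Notation leb := (@lebesgue_measure R).
Local Notation ext := (ext M).
Local Notation T := (adjoint_semigroup M).
Implicit Types (f g : R -> R) (y : (R -> R) -> R).
Variable v : R -> R * (R -> R).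
Hypothesis av : admissible M 0 v.
Variable t : R.
Hypothesis t_ge0 : 0 <= t.

Definition restart r := v (t + r).

Lemma ctl0_restart r : ctl0 restart r = if 0 < r then ctl0 v (r + t) else 0.
Proof.
rewrite /ctl0 /restart; case: ifPn => // r0.
by rewrite ltr_wpDr// addrC.
Qed.

Lemma ctl1_restart r : ctl1 M restart r = if 0 < r then ctl1 M v (r + t) else (fun=> 0).
Proof.
apply/funext => s; rewrite /ctl1 /restart; case: ifPn => // r0.
by rewrite ltr_wpDr// addrC.
Qed.

Lemma admissible_restart : admissible M 0 restart.
Proof.
have [a0 a1] := (admissibleP M v).1 av.
have mc0 := measurable_ctl0 av; have mc1 := measurable_ctl1 av.
have mpos (f : R -> R) : measurable_fun setT f ->
    measurable_fun setT (fun r : R => if 0 < r then f r else 0).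
  by move=> mf; apply: measurable_fun_ifT => //; exact: measurable_fun_ltr.
have shift_hexp r : 0 < r -> hexp (lam M / 2) r = expR (lam M / 2 * t) * hexp (lam M / 2) (r + t).
  move=> r0; rewrite (hexpM _ (ltW r0) t_ge0) mulrCA [hexp _ t]hexp_pos// -expRD.
  by rewrite mulNr subrr expR0 mulr1.
apply/admissibleP; split.
  apply: (L2_le _ _ (L2Z (expR (lam M / 2 * t)) (L2_shift t a0))).
    apply: measurable_funM; first exact: measurable_hexp.
    rewrite (_ : ctl0 restart = fun r => if 0 < r then ctl0 v (r + t) else 0).
      by apply: mpos; exact: measurable_fun_shift.
    by apply/funext => r; rewrite ctl0_restart.
  move=> r; rewrite ctl0_restart; case: ifPn => r0; last by rewrite mulr0 normr0.
  by rewrite (shift_hexp _ r0) mulrA.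
apply/L2_ltyP.
have m1 : measurable_fun setT (fun z : R * R => hexp (lam M / 2) z.1 * ctl1 M restart z.1 z.2).
  apply: measurable_funM; first exact: (measurableT_comp (measurable_hexp _) measurable_fst).
  rewrite (_ : (fun z : R * R => _) = fun z : R * R => if 0 < z.1 then ctl1 M v (z.1 + t) z.2 else 0).
    apply: measurable_fun_ifT => //.
      by apply: measurable_fun_ltr => //; exact: measurable_fst.
    apply: (measurableT_comp mc1 (g := fun z : R * R => (z.1 + t, z.2))).
    apply: measurable_fun_pair; last exact: measurable_snd.
    by apply: measurable_funD => //; exact: measurable_fst.
  by apply/funext => z; rewrite ctl1_restart; case: ifP.
split=> //; rewrite fubini_tonelli1//=; last first.
- by move=> z; rewrite lee_fin sqr_ge0.
- exact/measurable_EFinP/measurable_funX.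
have [ma1 ia1] := (L2_ltyP _ _).1 a1.
pose sq (z : R * R) := ((hexp (lam M / 2) z.1 * ctl1 M v z.1 z.2) ^+ 2)%:E.
have msq : measurable_fun setT sq by exact/measurable_EFinP/measurable_funX.
have sq0 z : (0 <= sq z)%E by rewrite lee_fin sqr_ge0.
have mF := measurable_fun_fubini_tonelli_F (m2 := leb) sq msq sq0.
pose c := expR (lam M / 2 * t) ^+ 2.
have c0 : 0 <= c by exact: sqr_ge0.
apply: (@le_lt_trans _ _ (\int[leb]_r (c%:E * fubini_F leb sq (r + t)%R))%E).
  apply: le_integral_pointwise => r _; rewrite /fubini_F/= -ge0_integralZl_EFin//; last first.
    exact: (measurable_fun_pair2 (r + t) msq).
  apply: le_integral_pointwise => s _; rewrite /sq/= -EFinM lee_fin ctl1_restart.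
  case: ifPn => r0; last by rewrite mulr0 expr0n/= mulr_ge0// sqr_ge0.
  by rewrite (shift_hexp _ r0) -mulrA exprMn.
rewrite ge0_integralZl_EFin//; last 2 first.
- by move=> r _; exact: integral_ge0.
- exact: (measurableT_comp mF (measurable_shift t)).
rewrite lte_mul_pinfty ?lee_fin// ge0_integral_shift//; last first.
  by move=> r; exact: integral_ge0.
by rewrite -fubini_tonelli1.
Qed.

Lemma kap_T f r h s : L2 leb (ext f) -> 0 <= r -> 0 <= h -> L2 leb (ctl1 M v s) ->
  kap M v (T r f) h s = kap M v f (h + r) s.
Proof.
move=> lf r0 h0 ls; rewrite /kap.
have -> : corr (ext (T r f)) (ctl1 M v s) h =
    expR (- mu M * r) * corr (ext f) (ctl1 M v s) (h + r).
  rewrite /corr -RintegralZl//; last exact: L2_mul (L2_shift (h + r) lf) ls.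
  apply: eq_Rintegral => x _; rewrite ext_T//; case: ifPn => [_|].
    by rewrite addrA mulrA.
  rewrite -ltNge => xh; suff -> : ctl1 M v s x = 0 by rewrite !mulr0.
  rewrite /ctl1; case: ifP => // _; apply: ext_neg.
  by apply: le_lt_trans xh; rewrite lerDl.
by rewrite ext_T// h0 hexpM// [hexp _ r]hexp_pos//; ring.
Qed.

(** Actions before [t] have their delay extended by [r], which moves onto [f] as [T r]; actions
    after [t] are those of the restarted control. *)
Lemma forced_restart f r : V M f -> 0 <= r ->
  forced M v f (t + r) = forced M v (T r f) t + forced M restart f r.
Proof.
move=> Vf r0; have lf := V_L2 Vf; have VT := V_T sbar_ge0 r0 Vf.
have i1 := integ_kap_diag sbar_ge0 mu_gt0 lam_gt0 av (t + r) Vf.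
have i2 := integ_kap_diag sbar_ge0 mu_gt0 lam_gt0 av t VT.
have i3 := integ_shift (- t) (integ_kap_diag sbar_ge0 mu_gt0 lam_gt0 admissible_restart r Vf).
have i0 := integ_kap_diag sbar_ge0 mu_gt0 lam_gt0 admissible_restart r Vf.
rewrite /forced -(Rint_shift (- t) (integ_measurable i0)) -RintegralD//.
apply: ae_Rint; [exact: integ_measurable i1|exact: integ_measurable (integD i2 i3)|].
apply: aeS (ae_L2_ctl1 av) => s ls.
have [s0|s0] := leP s 0.
  by rewrite !kap_out ?addr0// subr_le0; exact: le_trans s0 t_ge0.
have [st|ts] := leP s t.
  rewrite (kap_out M restart f _ (_ : s - t <= 0)) ?subr_le0// addr0 kap_T ?subr_ge0//.
  by congr kap; ring.
rewrite (kap_neg M v (T r f) s (_ : t - s < 0)) ?subr_lt0// add0r /kap.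
rewrite ctl1_restart ctl0_restart subr_gt0 ts subrK.
by rewrite (_ : t + r - s = r - (s - t)); last by ring.
Qed.

Lemma adjoint_semigroup_comb a f g : T t (fun s => a * f s + g s) =
  (fun s => a * T t f s + T t g s).
Proof.
apply/funext => s; rewrite /adjoint_semigroup; case: ifP => _; first by ring.
by rewrite mulr0 addr0.
Qed.

(** The supergradient inequality compares values of [V0] at elements of V' only, so the state
    reached at [t] has to be one. *)
Lemma state_dual y : dualV M y -> dualV M (state M 0 y v t).
Proof.
move=> dy; have [yl _] := dy; have [C C0 yC] := dual_bound dy; split.
  move=> a f g Vf Vg.
  rewrite !(stateE sbar_ge0 mu_gt0 lam_gt0 av)//; last exact: V_comb.
  rewrite (forced_comb sbar_ge0 mu_gt0 lam_gt0 av)// /orbit t_ge0 adjoint_semigroup_comb.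
  by rewrite yl//; [ring|exact: V_T|exact: V_T].
exists (C + 2 * \int[leb]_r (box t r * size_ctl M v r)) => f Vf.
rewrite (stateE sbar_ge0 mu_gt0 lam_gt0 av)// mulrDl.
apply: le_trans (ler_normD _ _) _; apply: lerD.
  rewrite /orbit t_ge0; apply: le_trans (yC _ (V_T sbar_ge0 t_ge0 Vf)) _.
  rewrite ler_wpM2l//; apply: le_trans (H1_norm_T sbar_ge0 t_ge0 Vf) _.
  rewrite ler_piMl ?H1_norm_ge0// -expR0 ler_expR mulNr oppr_le0 mulr_ge0// ltW//.
by rewrite mulrAC; exact: (forced_bound sbar_ge0 mu_gt0 lam_gt0 av).
Qed.

Lemma output_restart y f r : dualV M y -> V M f -> 0 <= r ->
  orbit M (state M 0 y v t) f r + forced M restart f r =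
  orbit M y f (t + r) + forced M v f (t + r).
Proof.
move=> dy Vf r0; rewrite forced_restart// addrA; congr (_ + _).
rewrite /orbit r0 addr_ge0// (stateE sbar_ge0 mu_gt0 lam_gt0 av)//; last exact: V_T.
by rewrite /orbit t_ge0 adjoint_semigroupD.
Qed.

End restart.

(** * Short-time modulus of the discounted orbit *)

Section resolvent_modulus.
Context (R : realType) (M : vintage_model R).
Hypothesis sbar_ge0 : (0 <= sbar M)%E.
Hypothesis mu_gt0 : 0 < mu M.
Hypothesis lam_gt0 : 0 < lam M.
Local Notation leb := (@lebesgue_measure R).
Local Notation ext := (ext M).
Local Notation k := (mu M + lam M).
Implicit Types (f g W : R -> R).

Let k_gt0 : 0 < k. Proof. exact: addr_gt0. Qed.

Lemma one_sub_hexp_le h : 0 <= h -> 0 <= 1 - hexp k h <= k * h.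
Proof.
move=> h0; rewrite subr_ge0 (hexp_le1 _ (ltW k_gt0))/= hexp_pos//.
by have := expR_ge1Dx (- k * h); lra.
Qed.

Lemma corr_le A B t : L2 leb A -> L2 leb B -> `|corr A B t| <= nrm leb A * nrm leb B.
Proof.
move=> lA lB; rewrite -(nrm_shift t (L2_measurable lA)).
by apply: cauchy_schwarz => //; exact: L2_shift.
Qed.

(** Translation by [h] moves an H^1 function by [O(h)] in L^2, seen here through the pairing with
    [W]. [W] has to vanish at negative ages because [ext f] may jump at 0. *)
Lemma corr_increment f g W h : V M f -> wderiv M f g -> L2 leb W ->
  (forall s, s < 0 -> W s = 0) -> 0 <= h ->
  `|corr (ext f) W h - \int[leb]_s (ext f s * W s)| <= h * (nrm leb (ext g) * nrm leb W).
Proof.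
move=> Vf fg lW W0 h0; have lf := V_L2 Vf; have [lg _] := fg.
have [mg _] := lg; have [mW _] := lW.
pose H (z : R * R) := box h z.1 * (ext g (z.2 + z.1) * W z.2).
have mH : measurable_fun setT H.
  apply: measurable_funM; first exact: (measurableT_comp (measurable_box h) measurable_fst).
  apply: measurable_funM; last exact: (measurableT_comp mW measurable_snd).
  by apply: (measurableT_comp mg); apply: measurable_funD;
    [exact: measurable_snd|exact: measurable_fst].
have igW x : integ leb (fun s => ext g (s + x) * W s) by exact: L2_mul (L2_shift x lg) lW.
have ib := integ_box h.
rewrite (_ : corr _ _ _ - _ = \int[leb]_s \int[leb]_x H (x, s)); last first.
  rewrite /corr -RintegralB//; [|exact: L2_mul (L2_shift h lf) lW|exact: L2_mul].
  apply: eq_Rintegral => s _; rewrite -mulrBl.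
  have [s0|s0] := leP 0 s; last first.
    by rewrite W0// mulr0; apply/esym/Rint_eq0 => x; rewrite /H/= W0// !mulr0.
  rewrite (ext_increment sbar_ge0 Vf fg s0 h0) -(RintegralZr _ measurableT (L2_box_shift s h lg)).
  by apply: eq_Rintegral => x _; rewrite /H/= [s + x]addrC mulrA.
have [|_ _ i1 _ e] := Rfubini (m1 := leb) (m2 := leb) H mH.
  apply: (@le_lt_trans _ _ (\int[leb]_x ((nrm leb (ext g) * nrm leb W) * box h x)%:E)%E); last first.
    by apply: integrable_lty => //; exact: (integZ _ ib).
  apply: le_integral_pointwise => x _.
  rewrite (_ : integral _ _ _ = (\int[leb]_s (box h x * `|ext g (s + x) * W s|))%:E).
    rewrite RintegralZl//; last exact: integ_norm.
    rewrite lee_fin mulrC ler_wpM2r ?box_ge0// -(nrm_shift x mg).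
    by apply: cauchy_schwarz_norm => //; exact: L2_shift.
  rewrite EFin_Rint; last by apply: integZ; exact: integ_norm.
  by apply: eq_integral => s _; rewrite /H/= normrM (ger0_norm (box_ge0 _ _)).
rewrite -{}e; apply: le_trans (le_normr_Rintegral measurableT i1) _.
rewrite -[X in _ <= X * _](Rint_box h0) mulrC -RintegralZl//.
apply: le_Rintegral => //; [exact: integ_norm|exact: integZ|].
move=> x _; rewrite /H/= RintegralZl//; last exact: igW.
rewrite normrM (ger0_norm (box_ge0 _ _)) mulrC ler_wpM2r ?box_ge0//.
exact: corr_le.
Qed.

(* [hexp lam h * kap f h] and [cpair f] are the pairings of the control with the
   discounted orbit [T h f] and with [f]; the gap is of order [sqrt h]. *)
Lemma kap_modulus w f h r : V M f -> L2 leb (ctl1 M w r) -> 0 <= h -> h <= 1 ->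
  `|hexp (lam M) h * kap M w f h r - cpair M w f r| <=
  (2 * k + 1) * H1_norm M f * Num.sqrt h * size_ctl M w r.
Proof.
move=> Vf lr h0 h1; have [g fg] := V_wderiv Vf; have lf := V_L2 Vf.
have [nf ng] := nrm_le_H1_norm sbar_ge0 Vf fg.
set H := H1_norm M f in nf ng *; have H0 : 0 <= H by exact: H1_norm_ge0.
set W := ctl1 M w r in lr *; set c := ctl0 w r.
have W0 s : s < 0 -> W s = 0 by move=> s0; rewrite /W /ctl1; case: ifP => // _; exact: ext_neg.
have hs : h <= Num.sqrt h.
  by rewrite -{1}(sqr_sqrtr h0) expr2 ler_piMl ?sqrtr_ge0// -sqrtr1 ler_wsqrtr.
set q := Num.sqrt h in hs *; have q0 : 0 <= q by exact: sqrtr_ge0.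
have /andP[d0 dk] := one_sub_hexp_le h0; set d := 1 - hexp k h in d0 dk.
have kq : d <= k * q by apply: le_trans dk _; rewrite ler_wpM2l// ltW.
have nW0 : 0 <= nrm leb W by exact: nrm_ge0.
(* Each part splits into the increment of [f] over [h], with constant 1, and the discount loss
   [d <= k * q]; the boundary value brings in the factor 2 of the Sobolev bound. *)
have E : hexp (lam M) h * kap M w f h r - cpair M w f r =
    ((corr (ext f) W h - \int[leb]_s (ext f s * W s)) - d * corr (ext f) W h) +
    ((ext f h - ext f 0) - d * ext f h) * c.
  rewrite /kap /cpair -/W -/c /d; rewrite hexpD; ring.
rewrite E; apply: le_trans (ler_normD _ _) _.
rewrite /size_ctl -/W -/c mulrDr; apply: lerD.
  apply: le_trans (ler_normB _ _) _.
  apply: (@le_trans _ _ (q * (H * nrm leb W) + k * q * (H * nrm leb W))).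
    apply: lerD.
      apply: le_trans (corr_increment Vf fg lr W0 h0) _.
      by apply: ler_pM => //; rewrite ?mulr_ge0 ?nrm_ge0// ler_wpM2r.
    rewrite normrM (ger0_norm d0); apply: ler_pM => //.
    by apply: le_trans (corr_le h lf lr) _; rewrite ler_wpM2r.
  have : 0 <= k * (q * (H * nrm leb W)) by rewrite !mulr_ge0// ltW.
  by lra.
rewrite normrM ler_wpM2r//; apply: le_trans (ler_normB _ _) _.
apply: (@le_trans _ _ (q * H + k * q * (2 * H))).
  apply: lerD.
    have := ext_increment_le sbar_ge0 Vf fg (lexx 0) h0; rewrite add0r => i.
    by apply: le_trans i _; rewrite ler_wpM2l.
  rewrite normrM (ger0_norm d0); apply: ler_pM => //.
  exact: (ext_le_H1_norm sbar_ge0).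
by lra.
Qed.

End resolvent_modulus.

(** * Comparison of extended integrals *)

Section integral_bounds.
Context (R : realType).
Local Notation leb := (@lebesgue_measure R).

Lemma ae_le_integral d (T : measurableType d) (m : {measure set T -> \bar R})
    (D : set T) (f g : T -> \bar R) : measurable D ->
  measurable_fun D f -> measurable_fun D g ->
  {ae m, forall t, D t -> (f t <= g t)%E} ->
  (\int[m]_(t in D) f t <= \int[m]_(t in D) g t)%E.
Proof.
move=> mD mf mg fg; rewrite integralE [leRHS]integralE; apply: leeB.
- apply: ae_ge0_le_integral => //.
  + exact: measurable_funepos.
  + exact: measurable_funepos.
  + by apply: aeS fg => t h Dt; rewrite !funeposE le_max2// h.
- apply: ae_ge0_le_integral => //.
  + exact: measurable_funeneg.
  + exact: measurable_funeneg.
  + by apply: aeS fg => t h Dt; rewrite !funenegE le_max2// leeN2 h.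
Qed.

Lemma integral_pos (h : R -> R) : integ leb h -> (forall t, t < 0 -> h t = 0) ->
  (\int[leb]_(t in `]0%R, +oo[) (h t)%:E = (\int[leb]_t h t)%:E)%E.
Proof.
move=> ih h0; have mh := integ_measurable ih.
rewrite integral_itv_obnd_cbnd; last first.
  by apply: measurable_funTS; exact/measurable_EFinP.
rewrite EFin_Rint// [LHS]integral_mkcond; apply: eq_integral => t _.
by rewrite patchE mem_setE in_itv/= andbT; case: leP => // /h0 ->.
Qed.

(** A profit need not be integrable, so finite and infinite parts are treated case by case, with
    [oo - oo] equal to [-oo]. *)
Lemma le_integralZl d (T : measurableType d) (m : {measure set T -> \bar R})
    (D : set T) (c : R) (f : T -> \bar R) : measurable D -> measurable_fun D f ->
  0 <= c -> (\int[m]_(t in D) (c%:E * f t) <= c%:E * \int[m]_(t in D) f t)%E.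
Proof.
move=> mD mf c0; rewrite integralE [in leRHS]integralE ge0_funeposM// ge0_funenegM//.
have mp := measurable_funepos mf; have mn := measurable_funeneg mf.
rewrite !ge0_integralZl_EFin//.
have p0 : (0 <= \int[m]_(t in D) f^\+ t)%E by exact: integral_ge0.
have n0 : (0 <= \int[m]_(t in D) f^\- t)%E by exact: integral_ge0.
move: c0; rewrite le_eqVlt => /predU1P[<-|c0]; first by rewrite !mul0e subee.
case: (integral _ _ _) p0 => [p||]// _; case: (integral _ _ _) n0 => [n||]// _.
- by rewrite -!EFinM -!EFinB mulrBr.
- by rewrite /= !gt0_muley ?lte_fin// !gt0_muleNy ?lte_fin//.
- by rewrite !gt0_muley ?lte_fin//.
- by rewrite !gt0_muley ?lte_fin// addeNy leNye.
Qed.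

Lemma Rint_box_hexp (l t : R) : 0 < l -> 0 <= t ->
  integ leb (fun r => box t r * hexp l r) /\
  \int[leb]_r (box t r * hexp l r) = (1 - hexp l t) / l.
Proof.
move=> l0 t0; have ih := integ_hexp l0; have mh := measurable_hexp l.
have ib : integ leb (fun r => box t r * hexp l r).
  apply: (integ_le _ _ ih).
    by apply: measurable_funM; [exact: measurable_box|].
  by move=> r; rewrite ger0_norm ?mulr_ge0 ?box_ge0 ?hexp_ge0// ler_piMl ?hexp_ge0 ?box_le1.
split=> //.
have mt : measurable_fun setT (fun r : R => l * hexp l r * (t <= r)%R%:R : R).
  apply: measurable_funM; first exact: measurable_funM.
  rewrite (_ : (fun r : R => (t <= r)%R%:R : R) = \1_(`[t, +oo[%classic)).
    exact/measurable_indicP.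
  by apply/funext => r; rewrite indicE mem_setE in_itv/= andbT.
have it : integ leb (fun r : R => l * hexp l r * (t <= r)%R%:R : R).
  apply: (integ_le _ _ (integZ l ih)) => // r.
  have p0 : 0 <= l * hexp l r by rewrite mulr_ge0 ?hexp_ge0// ltW.
  by case: (t <= r); rewrite ?mulr1 ?mulr0 ?normr0// ger0_norm.
rewrite -(Rint_hexp_tail l0 t0); apply: (mulfI (lt0r_neq0 l0)).
rewrite [RHS]mulrC divfK ?gt_eqF// -RintegralZl//.
rewrite [X in X - _](_ : 1 = \int[leb]_r (l * hexp l r)); last first.
  by rewrite RintegralZl// Rint_hexp// mulfV ?gt_eqF.
rewrite -RintegralB//; last exact: (integZ l ih).
apply: ae_Rint; [exact: integ_measurable (integZ l ib)|
  exact: integ_measurable (integB (integZ l ih) it)|].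
(* The point [r = t] belongs both to the box and to the tail. *)
apply: aeS (ae_neq t) => r rt; rewrite /box.
have [r0|r0] := leP 0 r; last by rewrite hexp_neg//=; ring.
by case: (ltgtP r t) rt => //= _ _; ring.
Qed.

End integral_bounds.

(** * Payoff bounds, optimality and the superdifferential of V0 *)

Section lq_payoff_bounds.
Context (R : realType) (sb : \bar R) (mu lam : R)
    (Rev alpha : R -> R) (beta0 q0 eps : R) (beta1 q1 : R -> R).
Local Notation leb := (@lebesgue_measure R).
Local Notation M := (lq_model sb mu lam Rev alpha beta0 q0 beta1 q1).
Local Notation ext := (ext M).
Hypothesis sb_ge0 : (0 <= sb)%E.
Hypothesis mu_gt0 : 0 < mu.
Hypothesis lam_gt0 : 0 < lam.
Hypothesis V_alpha : V M alpha.
Hypothesis eps_gt0 : 0 < eps.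
Hypothesis eps_beta0 : eps <= beta0.
Hypothesis beta1_fin : Lp_ages M +oo%E beta1.
Hypothesis eps_beta1 : ae_ages M (fun s => eps <= beta1 s).
Hypothesis L2_q1 : Lp_ages M 2%:E q1.
Hypothesis Rev_derivable : forall r : R, derivable Rev r 1.
Hypothesis Rev_concave : convex_function [set: R^o] ((fun r => - Rev r) : R^o -> R^o).
Hypothesis Rev_lipschitz : [lipschitz derive1 Rev r | r in setT].
Local Notation k := (mu + lam).
Local Notation rho := (Res k (ext alpha)).
Local Notation rcost := (rcost sb mu lam Rev alpha beta0 q0 beta1 q1).

Let k_gt0 : 0 < k. Proof. exact: addr_gt0. Qed.

Let mbeta : measurable_fun setT (ext beta1). Proof. exact: measurable_beta1 beta1_fin. Qed.

Let lq1 : L2 leb (ext q1). Proof. exact/Lp2P. Qed.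

Let V_rho : V M rho. Proof. exact: (V_Res (M := M)). Qed.

Lemma measurable_Rev : measurable_fun setT Rev.
Proof.
apply: continuous_measurable_fun => r.
exact/differentiable_continuous/derivable1_diffP.
Qed.

Section integrand.
Variables (y : (R -> R) -> R) (v : R -> R * (R -> R)).
Hypothesis dy : dualV M y.
Hypothesis av : admissible M 0 v.

Definition output t := orbit M y alpha t + forced M v alpha t.

Lemma measurable_forced : measurable_fun setT (forced M v alpha).
Proof.
have [i1 _ _] := laplace_forced (M := M) sb_ge0 mu_gt0 lam_gt0 av V_alpha.
have mi := integ_measurable i1.
rewrite (_ : forced M v alpha = fun t => expR (lam * t) *
    (hexp lam t * forced M v alpha t)).
  apply: measurable_funM => //; apply: measurableT_comp => //.
apply/funext => t; have [t0|t0] := leP 0 t.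
  by rewrite hexp_pos// mulrA -expRD mulNr subrr expR0 mul1r.
rewrite hexp_neg// mul0r mulr0 /forced; apply: Rint_eq0 => r.
have [r0|r0] := leP r 0; first exact: kap_out.
by apply: kap_neg; lra.
Qed.

Lemma measurable_output : measurable_fun setT output.
Proof.
have [mo _ _] := laplace_orbit (M := M) sb_ge0 k_gt0 dy V_alpha.
by apply: measurable_funD => //; exact: measurable_forced.
Qed.

(** The integrand of [payoff] in measurable form. It stays extended-valued because the cost is known
    to be finite only at times with an L^2 slice. *)
Definition profit t : \bar R := ((hexp lam t)%:E * ((Rev (output t))%:E -
  ((beta0 * ctl0 v t ^+ 2 + q0 * ctl0 v t)%:E +
   \int[leb]_s (ext beta1 s * ctl1 M v t s ^+ 2 + ext q1 s * ctl1 M v t s)%:E)))%E.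

Lemma payoffE : payoff M 0 y v = (\int[leb]_(t in `]0%R, +oo[) profit t)%E.
Proof.
apply: eq_integral => t; rewrite inE/= in_itv/= andbT => t0.
rewrite /profit hexp_pos ?ltW//; congr (_ * (_ - _))%E.
  by rewrite /output -(stateE (M := M) sb_ge0 mu_gt0 lam_gt0 av y (ltW t0) V_alpha).
rewrite /cost /ctl0 t0; congr (_ + _)%E; rewrite integral_mkcond.
apply: eq_integral => s _; rewrite /ctl1 t0 /= !ext_if !patchE; case: ifP => //.
by rewrite expr0n !mulr0 addr0.
Qed.

Lemma measurable_profit : measurable_fun setT profit.
Proof.
have mc1 := measurable_ctl1 av; have mc0 := measurable_ctl0 av.
apply: emeasurable_funM; first by apply/measurable_EFinP; exact: measurable_hexp.
apply: emeasurable_funB.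
  by apply/measurable_EFinP; apply: (measurableT_comp measurable_Rev); exact: measurable_output.
apply: emeasurable_funD.
  apply/measurable_EFinP; apply: measurable_funD; apply: measurable_funM => //.
  exact: measurable_funX.
apply: (measurable_integral_param (m2 := leb) (fun z : R * R =>
  (ext beta1 z.2 * ctl1 M v z.1 z.2 ^+ 2 + ext q1 z.2 * ctl1 M v z.1 z.2)%:E)).
apply/measurable_EFinP; apply: measurable_funD; apply: measurable_funM => //.
- exact: (measurableT_comp mbeta measurable_snd).
- exact: measurable_funX.
- by apply: (measurableT_comp _ measurable_snd) => //; case: lq1.
Qed.

Lemma profitE t : 0 < t -> L2 leb (ctl1 M v t) ->
  profit t = (hexp lam t * (Rev (output t) - rcost (v t)))%:E.
Proof.
move=> t0; rewrite /profit /ctl1 /ctl0 t0 => lv.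
have ic := integ_cost beta1_fin L2_q1 lv.
rewrite EFinM EFinB /rcost; congr (_ * (_ - _))%E.
by rewrite [RHS]EFinD; congr (_ + _)%E; rewrite (EFin_Rint ic).
Qed.

End integrand.

Variables (u0 : R) (u1 x : R -> R).
Hypothesis lu : L2 leb (ext u1).
Hypothesis lx : L2 leb (ext x).
Hypothesis x_stationary : ae_ages M (fun s => x s = stationary_state M u0 u1 s).
Local Notation u := (u0, u1).
Local Notation a := (pair_ages M alpha x).
Local Notation eta := (derive1 Rev a).

Definition steady_profit := Rev a - rcost u.

Let dx : dualV M (pivot M x). Proof. exact: pivot_dual. Qed.

Let au : admissible M 0 (fun=> u). Proof. exact: (admissible_cst (M := M)). Qed.

Lemma output_sub y v t : admissible M 0 v -> 0 <= t ->
  output y v t - a =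
  orbit M y alpha t - orbit M (pivot M x) alpha t + forced M (control_sub v u) alpha t.
Proof.
move=> av t0; rewrite -/(pivot M x alpha).
rewrite -(stationary_orbit (M := M) sb_ge0 mu_gt0 lu lx x_stationary V_alpha t0).
rewrite /output (forced_sub (M := M) sb_ge0 mu_gt0 lam_gt0 t V_alpha av au); ring.
Qed.

(* Concavity of [Rev] at [a] and strong convexity of the cost at [u], whose
   gradient there is [zeta]. *)
Lemma profit_le y v zeta t : admissible M 0 v -> 0 < t -> L2 leb (ctl1 M v t) ->
  L2 leb (ext zeta) -> u0 = (zeta 0 - q0) / (2 * beta0) ->
  ae_ages M (fun s => u1 s = (zeta s - q1 s) / (2 * beta1 s)) ->
  (profit y v t <= (hexp lam t * (steady_profit + eta * (orbit M y alpha t -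
      orbit M (pivot M x) alpha t + forced M (control_sub v u) alpha t) -
    cpair M (control_sub v u) zeta t - eps * (ctl0 (control_sub v u) t ^+ 2 +
      nrm leb (ctl1 M (control_sub v u) t) ^+ 2)))%:E)%E.
Proof.
move=> av t0 lv lz e0 e1; rewrite profitE// lee_fin ler_wpM2l ?hexp_ge0//.
have lvt : L2 leb (ext (v t).2) by move: lv; rewrite /ctl1 t0.
have := rcost_convex eps_gt0 eps_beta0 beta1_fin eps_beta1 L2_q1 (u := u) lu lvt lz e0 e1.
have := concave_tangent (output y v t) Rev_concave (@Rev_derivable a).
rewrite (output_sub _ av (ltW t0)) (cpairE (M := M) sb_ge0 _ _ t0).
have -> : nrm leb (ctl1 M (control_sub v u) t) = nrm leb (fun s => ext (v t).2 s - ext u1 s).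
  by congr nrm; apply/funext => s; rewrite ctl1_sub /ctl1 t0.
rewrite /ctl0 t0 /steady_profit /control_sub/=; lra.
Qed.

(** After integration of [profit_le] the deviation drops out: by [laplace_forced] its discounted
    effect on the output, times [eta], is exactly its marginal cost. Only the orbits of the two data
    remain, with Laplace transforms [y rho] and [pivot M x rho]. *)
Lemma payoff_le_costate y v : dualV M y -> admissible M 0 v ->
  u0 = (eta * rho 0 - q0) / (2 * beta0) ->
  ae_ages M (fun s => u1 s = (eta * rho s - q1 s) / (2 * beta1 s)) ->
  (payoff M 0 y v <= (steady_profit / lam + eta * (y rho - pivot M x rho))%:E)%E.
Proof.
move=> dy av e0 e1; have aw := admissible_sub av au; set w := control_sub v u in aw *.
have [mo io eo] := laplace_orbit (M := M) sb_ge0 k_gt0 dy V_alpha.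
have [mox iox eox] := laplace_orbit (M := M) sb_ge0 k_gt0 dx V_alpha.
have [ifw icp ef] := laplace_forced (M := M) sb_ge0 mu_gt0 lam_gt0 aw V_alpha.
have ih := integ_hexp lam_gt0.
pose h t := steady_profit * hexp lam t + eta * ((hexp lam t * orbit M y alpha t -
  hexp lam t * orbit M (pivot M x) alpha t) +
  (hexp lam t * forced M w alpha t - hexp lam t * cpair M w rho t)).
have i2 := integD (integB io iox) (integB ifw icp).
have i_h : integ leb h by apply: integD; exact: integZ.
have h0 t : t < 0 -> h t = 0 by move=> t0; rewrite /h !hexp_neg//; ring.
have eh : \int[leb]_t h t = steady_profit / lam + eta * (y rho - pivot M x rho).
  rewrite RintegralD//; [|exact: integZ|exact: integZ].
  rewrite !RintegralZl// RintegralD//; [|exact: integB|exact: integB].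
  by rewrite !RintegralB// (Rint_hexp lam_gt0) eo eox ef subrr addr0.
rewrite -eh -integral_pos// payoffE//.
apply: ae_le_integral => //.
- by apply: measurable_funTS; exact: measurable_profit.
- by apply/measurable_EFinP; apply: measurable_funTS; exact: integ_measurable i_h.
apply: aeS (aeI (ae_L2_ctl1 av) (ae_L2_ctl1 aw)) => t [lv lw].
rewrite /= in_itv/= andbT => t0.
have lz : L2 leb (ext (fun s => eta * rho s)).
  by rewrite (_ : ext _ = fun s => eta * ext rho s);
    [apply: L2Z; exact: V_L2|apply/funext => s; rewrite ext_cst].
apply: le_trans (profit_le y av t0 lv lz e0 e1) _; rewrite -/w lee_fin.
have -> : cpair M w (fun s => eta * rho s) t = eta * cpair M w rho t.
  rewrite /cpair mulrDr; congr (_ + _).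
    rewrite -RintegralZl//; last exact: L2_mul (V_L2 V_rho) lw.
    by apply: eq_Rintegral => s _; rewrite ext_cst mulrA.
  by rewrite ext_cst mulrA.
rewrite /h (_ : steady_profit * hexp lam t + _ = hexp lam t * (steady_profit +
  eta * (orbit M y alpha t - orbit M (pivot M x) alpha t + forced M w alpha t) -
  eta * cpair M w rho t)); last by ring.
rewrite ler_wpM2l ?hexp_ge0// lerBlDr lerDl mulr_ge0 ?(ltW eps_gt0)//.
by rewrite addr_ge0 ?sqr_ge0.
Qed.

Let L2_row t : L2 leb (ctl1 M (fun=> u) t).
Proof.
rewrite (_ : ctl1 M (fun=> u) t = fun s => (0 < t)%R%:R * ext u1 s); first exact: L2Z.
by apply/funext => s; rewrite /ctl1; case: ifP => _; rewrite ?mul1r ?mul0r.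
Qed.

Let orbit_x t : 0 <= t ->
  orbit M (pivot M x) alpha t + forced M (fun=> u) alpha t = a.
Proof. exact: (stationary_orbit (M := M)). Qed.

Lemma payoff_steady : payoff M 0 (pivot M x) (fun=> u) = (steady_profit / lam)%:E.
Proof.
have ih := integZ steady_profit (integ_hexp lam_gt0).
rewrite payoffE// -(Rint_hexp lam_gt0) -RintegralZl//; last exact: integ_hexp.
rewrite -integral_pos//; last by move=> t t0; rewrite hexp_neg// mulr0.
apply: eq_integral => t; rewrite inE/= in_itv/= andbT => t0.
by rewrite profitE// /output orbit_x ?ltW// mulrC.
Qed.

(** Under the same control, a perturbation of the datum shifts the output by [th] times the orbit of
    [omega]. [lipschitz_lower] gives the first-order term, whose Laplace transform is [omega rho],
    and [C] is [L] times the discounted energy of the orbit. *)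
Lemma payoff_steady_ge omega : dualV M omega -> exists C, forall th : R,
  ((steady_profit / lam + eta * (th * omega rho) - C * th ^+ 2)%:E <=
    payoff M 0 (fun f => (th * omega f + pivot M x f)%R) (fun=> u))%E.
Proof.
move=> dw; have [L L0 hL] := lipschitz_lower Rev_derivable Rev_lipschitz.
have [D D0 hD] := orbit_bound (M := M) sb_ge0 dw V_alpha.
have [mo io eo] := laplace_orbit (M := M) sb_ge0 k_gt0 dw V_alpha.
pose o := orbit M omega alpha; rewrite -/o in hD mo io eo.
have ih := integ_hexp lam_gt0.
have i2 : integ leb (fun t => hexp lam t * o t ^+ 2).
  apply: (integ_le _ _ (integZ D (integ_norm io))).
    apply: measurable_funM; first exact: measurable_hexp.
    exact: measurable_funX.
  move=> t; rewrite expr2 mulrA normrM mulrC ler_wpM2r//.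
  by apply: le_trans (hD t) _; rewrite ler_piMr// hexp_le1// ltW.
exists (L * \int[leb]_t (hexp lam t * o t ^+ 2)) => th.
pose h t := steady_profit * hexp lam t + (eta * th) * (hexp lam t * o t) -
  (L * th ^+ 2) * (hexp lam t * o t ^+ 2).
have i1 : integ leb (fun t => steady_profit * hexp lam t + (eta * th) * (hexp lam t * o t)).
  by apply: integD; exact: integZ.
have i_h : integ leb h by apply: integB i1 _; exact: integZ.
have -> : steady_profit / lam + eta * (th * omega rho) -
    (L * \int[leb]_t (hexp lam t * o t ^+ 2)) * th ^+ 2 = \int[leb]_t h t.
  rewrite RintegralB//; last exact: integZ.
  rewrite RintegralD//; [|exact: integZ|exact: integZ].
  by rewrite !RintegralZl// (Rint_hexp lam_gt0) eo; ring.
have h0 t : t < 0 -> h t = 0 by move=> t0; rewrite /h !hexp_neg//; ring.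
rewrite -integral_pos// payoffE//.
apply: le_integral_pointwise => t; rewrite /= in_itv/= andbT => t0.
rewrite profitE// lee_fin.
have -> : output (fun f => th * omega f + pivot M x f) (fun=> u) t = a + th * o t.
  rewrite -(orbit_x (ltW t0)) /output /o /orbit (ltW t0); ring.
rewrite (_ : h t = hexp lam t * (Rev a + eta * (th * o t) - L * (th * o t) ^+ 2 - rcost u)).
  by rewrite ler_wpM2l ?hexp_ge0// lerB.
by rewrite /h /steady_profit; ring.
Qed.

Lemma V0_le (b : R) y : (forall v, admissible M 0 v -> (payoff M 0 y v <= b%:E)%E) ->
  (V0 M y <= b%:E)%E.
Proof. by move=> h; apply: ge_ereal_sup => _ [v av <-]; exact: h. Qed.

Lemma payoff_le_V0 y v : admissible M 0 v -> (payoff M 0 y v <= V0 M y)%E.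
Proof. by move=> av; apply: ereal_sup_ubound; exists v. Qed.

Section costate.
Hypothesis e0 : u0 = (eta * rho 0 - q0) / (2 * beta0).
Hypothesis e1 : ae_ages M (fun s => u1 s = (eta * rho s - q1 s) / (2 * beta1 s)).

Lemma optimal_steady : optimal M (pivot M x) (fun=> u).
Proof.
split; first exact: au.
move=> v av; rewrite [leRHS]payoff_steady.
by have := payoff_le_costate dx av e0 e1; rewrite subrr mulr0 addr0.
Qed.

Lemma V0_steady : V0 M (pivot M x) = (steady_profit / lam)%:E.
Proof.
apply: le_anti; apply/andP; split.
  apply: V0_le => v av; rewrite -payoff_steady; exact: (optimal_steady.2 v av).
by rewrite -payoff_steady; exact: payoff_le_V0.
Qed.

Lemma superdifferential_steady xi : V M xi ->
  (forall s, ages M s -> xi s = eta * rho s) ->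
  superdifferential_V0 M (pivot M x) xi.
Proof.
move=> Vxi exi; split=> //; rewrite V0_steady// => y dy.
have E z : dualV M z -> z xi = eta * z rho.
  move=> dz; rewrite -(dualZ (M := M) sb_ge0 eta dz V_rho).
  by apply: (dual_ext (M := M) sb_ge0 dz) => //; exact: VZ.
apply: V0_le => v av; rewrite !E// -mulrBr.
exact: payoff_le_costate.
Qed.

End costate.

(** Translating time by [t] turns the tail into the discounted payoff of the restarted control from
    the state reached, by [output_restart]. *)
Lemma profit_tail_le y v t : dualV M y -> admissible M 0 v -> 0 <= t ->
  (\int[leb]_(r in `]t, +oo[) profit y v r <=
   (hexp lam t)%:E * payoff M 0 (state M 0 y v t) (restart v t))%E.
Proof.
move=> dy av t0.
have ar : admissible M 0 (restart v t) by exact: (admissible_restart (M := M)).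
have ds : dualV M (state M 0 y v t) by exact: (state_dual (M := M)).
have mp := measurable_profit dy av; have mp' := measurable_profit ds ar.
rewrite payoffE//.
apply: le_trans (le_integralZl leb _ (measurable_funTS mp') (hexp_ge0 lam t)) => //.
rewrite [leLHS]integral_mkcond -(integral_shift t (f := profit y v \_ `]t, +oo[)); last first.
  by apply/(measurable_restrictT _ _).1 => //; exact: measurable_funTS.
rewrite [leRHS]integral_mkcond le_eqVlt; apply/orP; left; apply/eqP.
apply: eq_integral => r _; rewrite !patchE !mem_setE !in_itv/= !andbT ltrDr.
case: ifPn => // r0; rewrite /profit hexpM ?(ltW r0)// mulrC EFinM -muleA.
congr (_ * (_ * (_ - (_ + _))))%E.
- congr (Rev _)%:E; rewrite /output [r + t]addrC.
  by rewrite -(output_restart (M := M) sb_ge0 mu_gt0 lam_gt0 av t0 dy V_alpha (ltW r0)).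
- by rewrite ctl0_restart// r0.
- by apply: eq_integral => s _; rewrite ctl1_restart// r0.
Qed.

Section short_time.
Variable xi : R -> R.
Hypothesis dxi : superdifferential_V0 M (pivot M x) xi.
Hypothesis e0 : u0 = (xi 0 - q0) / (2 * beta0).
Hypothesis e1 : ae_ages M (fun s => u1 s = (xi s - q1 s) / (2 * beta1 s)).
Local Notation v0 := (fine (V0 M (pivot M x))).

Let V_xi : V M xi. Proof. by case: dxi. Qed.

(** The constant control keeps the datum, so the state reached differs from it only by the effect of
    the deviation, which [xi] prices. *)
Lemma V0_state_le v t : admissible M 0 v -> 0 <= t ->
  (V0 M (state M 0 (pivot M x) v t) <= (v0 + forced M (control_sub v u) xi t)%:E)%E.
Proof.
move=> av t0; have [_ fin h] := dxi.
have ds : dualV M (state M 0 (pivot M x) v t) by exact: (state_dual (M := M)).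
apply: le_trans (h _ ds) _; rewrite [leRHS]EFinD fineK// leeD2l// lee_fin.
rewrite (stateE (M := M) sb_ge0 mu_gt0 lam_gt0 av _ t0 V_xi).
rewrite -[X in _ - X](stationary_orbit (M := M) sb_ge0 mu_gt0 lu lx x_stationary V_xi t0).
rewrite (forced_sub (M := M) sb_ge0 mu_gt0 lam_gt0 t V_xi av au).
by lra.
Qed.

(** [profit_le] bounds the profit up to [t], and [V0_state_le] bounds what follows. The price [kap]
    of the deviation in the tail nearly cancels its marginal cost [cpair] in the head; the remainder
    is absorbed by strong convexity. *)
Lemma payoff_short_time : exists2 C, 0 <= C & forall v t, admissible M 0 v -> 0 < t -> t <= 1 ->
  (payoff M 0 (pivot M x) v <= (steady_profit * ((1 - hexp lam t) / lam) +
    hexp lam t * v0 + C * t ^+ 2)%:E)%E.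
Proof.
(* [expR (- lam)] bounds the discount from below up to time 1; the half is due to [size_ctl ^ 2]
   being at most twice the sum of the two squares. [A] comes from [forced_bound], [B] from
   [kap_modulus]. *)
pose c := eps * expR (- lam) / 2; have c0 : 0 < c by rewrite divr_gt0 ?mulr_gt0 ?expR_gt0.
pose A := `|eta| * (2 * H1_norm M alpha); have A0 : 0 <= A by rewrite !mulr_ge0 ?H1_norm_ge0.
pose B := (2 * k + 1) * H1_norm M xi.
have B0 : 0 <= B by rewrite mulr_ge0 ?H1_norm_ge0// addr_ge0// mulr_ge0// ltW.
exists ((A + B) ^+ 2 / (4 * c)); first by rewrite divr_ge0 ?sqr_ge0// mulr_ge0// ltW.
move=> v t av t0 t1; have tge0 := ltW t0.
have aw := admissible_sub av au; set w := control_sub v u in aw *.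
pose n := size_ctl M w; pose N := \int[leb]_r (box t r * n r).
have ib := integ_box t; have ibn : integ leb (fun r => box t r * n r).
  exact: (integ_box_size_ctl (M := M)).
have ikap := integ_kap_diag (M := M) sb_ge0 mu_gt0 lam_gt0 aw t V_xi.
have ih := integ_hexp lam_gt0.
have [ibh ebh] : integ leb (fun r => box t r * hexp lam r) /\
    \int[leb]_r (box t r * hexp lam r) = (1 - hexp lam t) / lam.
  exact: Rint_box_hexp.
pose K := (A + B) ^+ 2 / (4 * c).
(* [A * N] bounds the gain in revenue at every [r], and over [[0, t]] it has the same integral as
   [A * t * n r]. Subtracting the latter charges the gain to the time of the deviation, where the
   quadratic loss can absorb it. *)
pose H r := steady_profit * (box t r * hexp lam r) + ((A * N + K * t) * box t r -
  (A * t) * (box t r * n r)) - hexp lam t * kap M w xi (t - r) r.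
have i2 : integ leb (fun r => (A * N + K * t) * box t r - (A * t) * (box t r * n r)).
  by apply: integB; exact: integZ.
have i1 : integ leb (fun r => steady_profit * (box t r * hexp lam r) +
    ((A * N + K * t) * box t r - (A * t) * (box t r * n r))).
  by apply: integD i2; exact: integZ.
have i_H : integ leb H by apply: integB i1 _; exact: integZ.
have eH : \int[leb]_r H r = steady_profit * ((1 - hexp lam t) / lam) + K * t ^+ 2 -
    hexp lam t * forced M w xi t.
  rewrite RintegralB//; last exact: integZ.
  rewrite RintegralD//; last exact: integZ.
  rewrite RintegralB//; [|exact: integZ|exact: integZ].
  by rewrite !RintegralZl// ebh (Rint_box tge0) -/N -/(forced M w xi t); ring.
have head : (\int[leb]_(r in `]0%R, t]) profit (pivot M x) v r <= (\int[leb]_r H r)%:E)%E.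
  have -> : ((\int[leb]_r H r)%:E = \int[leb]_(r in `]0%R, t]) (H r)%:E)%E.
    rewrite EFin_Rint// [RHS]integral_mkcond; apply: ae_eq_integral => //.
    - by apply/measurable_EFinP; exact: integ_measurable i_H.
    - apply/(measurable_restrictT _ _).1 => //; apply: measurable_funTS.
      by apply/measurable_EFinP; exact: integ_measurable i_H.
    (* [box t] contains 0, which the time interval excludes; at every other time outside the
       interval [H] vanishes. *)
    apply: aeS (ae_neq 0) => r r0 _; rewrite patchE mem_setE in_itv/=.
    case: ifPn => //; rewrite negb_and -!leNgt -ltNge => h.
    suff -> : H r = 0 by [].
    have b0 : box t r = 0.
      rewrite /box; case: ifPn => // /andP[r1 r2]; move: h r0.
      by rewrite leNgt lt_neqAle r1 ltNge r2 andbT orbF negbK eq_sym => ->.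
    rewrite /H b0; case/orP: h => h; first by rewrite kap_out//; ring.
    by rewrite kap_neg ?subr_lt0//; ring.
  apply: ae_le_integral => //.
  - by apply: measurable_funTS; exact: measurable_profit.
  - by apply: measurable_funTS; apply/measurable_EFinP; exact: integ_measurable i_H.
  apply: aeS (aeI (ae_L2_ctl1 av) (ae_L2_ctl1 aw)) => r [lv lw].
  rewrite /= in_itv/= => /andP[r0 rt].
  apply: le_trans (profit_le _ av r0 lv (V_L2 V_xi) e0 e1) _; rewrite lee_fin -/w.
  rewrite subrr add0r.
  have fN : eta * forced M w alpha r <= A * N.
    apply: le_trans (ler_norm _) _; rewrite normrM /A -mulrA ler_wpM2l//.
    apply: le_trans (forced_bound (M := M) sb_ge0 mu_gt0 lam_gt0 aw r V_alpha) _.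
    rewrite ler_wpM2l ?mulr_ge0 ?H1_norm_ge0//; apply: le_Rintegral => //.
      exact: (integ_box_size_ctl (M := M)).
    move=> p _; rewrite ler_wpM2r ?size_ctl_ge0// /box.
    by case: ifPn => [/andP[-> /le_trans -> //]|_]; case: ifP.
  have h1 : hexp lam r <= 1 by rewrite hexp_le1// ltW.
  have h0 := hexp_ge0 lam r.
  have hc : c * 2 <= eps * hexp lam r.
    rewrite /c divfK// ler_wpM2l ?(ltW eps_gt0)// hexp_pos ?(ltW r0)//.
    by rewrite ler_expR mulNr lerN2 ler_piMr ?(ltW lam_gt0)// (le_trans rt).
  have nn : n r ^+ 2 <= 2 * (ctl0 w r ^+ 2 + nrm leb (ctl1 M w r) ^+ 2).
    rewrite /n /size_ctl -[ctl0 w r ^+ 2]real_normK ?num_real//.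
    by have := sqr_ge0 (nrm leb (ctl1 M w r) - `|ctl0 w r|); lra.
  have tr0 : 0 <= t - r by rewrite subr_ge0.
  have := kap_modulus (M := M) sb_ge0 mu_gt0 lam_gt0 (w := w) (h := t - r) (r := r) V_xi lw tr0.
  rewrite -/n; have tr1 : t - r <= 1 by lra.
  move=> /(_ tr1) modulus.
  have ht : hexp lam t = hexp lam r * hexp lam (t - r).
    by rewrite -hexpM ?(ltW r0)//; congr hexp; ring.
  have b1 : box t r = 1 by rewrite /box (ltW r0) rt.
  have n0 : 0 <= n r by exact: size_ctl_ge0.
  set q := Num.sqrt t; have q_ge0 : 0 <= q by exact: sqrtr_ge0.
  have qt : q ^+ 2 = t by exact: sqr_sqrtr.
  have tq : t <= q by rewrite -[X in X <= _]qt expr2 ler_piMl// -sqrtr1 ler_wsqrtr.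
  have qq : Num.sqrt (t - r) <= q by apply: ler_wsqrtr; lra.
  have mod2 : hexp lam t * kap M w xi (t - r) r - hexp lam r * cpair M w xi r <= B * q * n r.
    rewrite ht -mulrA -mulrBr; apply: le_trans (ler_norm _) _; rewrite normrM ger0_norm//.
    apply: le_trans (ler_wpM2l h0 modulus) _.
    apply: (@le_trans _ _ (1 * (B * q * n r))); last by rewrite mul1r.
    apply: ler_pM => //.
      by apply: mulr_ge0 => //; apply: mulr_ge0; [exact: B0|exact: sqrtr_ge0].
    by rewrite ler_wpM2r//; apply: ler_wpM2l; first exact: B0.
  (* As [t <= q], the linear terms are at most [(A + B) * q * n r]; completing the square against
     [c * n r ^+ 2] leaves [K * q ^+ 2], which is [K * t]. *)
  have young : A * t * n r + B * q * n r - c * n r ^+ 2 <= K * t.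
    apply: (@le_trans _ _ ((A + B) * q * n r - c * n r ^+ 2)).
      rewrite lerB// -mulrDl ler_wpM2r// mulrDl lerD2r ler_wpM2l//.
    rewrite -subr_ge0 (_ : _ - _ = ((A + B) * q - 2 * c * n r) ^+ 2 / (4 * c)).
      by rewrite divr_ge0 ?sqr_ge0// mulr_ge0// ltW.
    by rewrite /K -qt; field; rewrite gt_eqF.
  rewrite /H b1 mul1r !mulr1.
  have costle : c * n r ^+ 2 <= hexp lam r * (eps * (ctl0 w r ^+ 2 + nrm leb (ctl1 M w r) ^+ 2)).
    apply: (@le_trans _ _ (c * (2 * (ctl0 w r ^+ 2 + nrm leb (ctl1 M w r) ^+ 2)))).
      by rewrite ler_wpM2l// ltW.
    by rewrite !mulrA [hexp lam r * _]mulrC ler_wpM2r// addr_ge0// sqr_ge0.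
  have AN : hexp lam r * (eta * forced M w alpha r) <= A * N.
    apply: (@le_trans _ _ (hexp lam r * (A * N))); first by rewrite ler_wpM2l.
    rewrite ler_piMl// mulr_ge0//; apply: Rintegral_ge0 => p _.
    by rewrite mulr_ge0 ?box_ge0 ?size_ctl_ge0.
  rewrite !mulrBr mulrDr; lra.
have tail : (\int[leb]_(r in `]t, +oo[) profit (pivot M x) v r <=
    (hexp lam t * (v0 + forced M w xi t))%:E)%E.
  apply: le_trans (profit_tail_le dx av tge0) _; rewrite EFinM lee_wpmul2l ?lee_fin ?hexp_ge0//.
  apply: le_trans (V0_state_le av tge0); apply: payoff_le_V0.
  exact: (admissible_restart (M := M)).
rewrite payoffE// (_ : `]0, +oo[%classic = `]0, t] `|` `]t, +oo[)%classic; last first.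
  by apply: itv_bndbnd_setU; rewrite bnd_simp.
rewrite integral_setU//=; first last.
- apply/disj_setPS => r /= []; rewrite !in_itv/= andbT => /andP[_ rt].
  by rewrite ltNge rt.
- by apply: measurable_funTS; exact: measurable_profit.
apply: le_trans (leeD head tail) _; rewrite -EFinD lee_fin eH /K; lra.
Qed.

(* Dynamic programming over [[0, t]] with the constant control, divided by [t]. *)
Lemma V0_short_time : v0 <= steady_profit / lam.
Proof.
have [C C0 hC] := payoff_short_time; have [_ fin _] := dxi.
suff h t : 0 < t -> t <= 1 -> v0 <= steady_profit / lam + C / (lam * expR (- lam)) * t.
  set D := C / _ in h; have D0 : 0 <= D.
    by rewrite divr_ge0// mulr_ge0 ?expR_ge0// ltW.
  rewrite leNgt; apply/negP => gap.
  (* For times up to [d] the error is at most half of the supposed gap. *)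
  pose d := (v0 - steady_profit / lam) / (D + 1) / 2.
  have d0 : 0 < d by rewrite !divr_gt0// ?subr_gt0// ltr_wpDl.
  have m0 : 0 < Num.min 1 d by rewrite lt_min ltr01.
  have := h _ m0 (_ : Num.min 1 d <= 1); rewrite ge_min lexx => /(_ isT) h1.
  have : D * Num.min 1 d <= D * d by rewrite ler_wpM2l// ge_min lexx orbT.
  have : d * (D + 1) * 2 = v0 - steady_profit / lam.
    by rewrite /d mulrAC divfK ?pnatr_eq0// divfK// gt_eqF// ltr_wpDl.
  by move=> ? ?; lra.
move=> t0 t1; have := V0_le (fun v av => hC v t av t0 t1).
rewrite -(fineK fin) lee_fin.
have e : hexp lam t = expR (- (lam * t)) by rewrite hexp_pos ?(ltW t0)// mulNr.
(* [V0] and the payoff of the feedback both end up multiplied by [1 - hexp lam t]. This lower bound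
   of order [t] leaves an error linear in [t] after division. *)
have e1t : lam * expR (- lam) * t <= 1 - hexp lam t.
  have -> : 1 - hexp lam t = hexp lam t * (expR (lam * t) - 1).
    by rewrite mulrBr mulr1 e -expRD addNr expR0.
  rewrite mulrAC mulrC; apply: ler_pM.
  - exact: expR_ge0.
  - by rewrite mulr_ge0// ltW.
  - by rewrite e ler_expR lerN2 ler_piMr// ltW.
  - by have := expR_ge1Dx (lam * t); lra.
set p := 1 - hexp lam t in e1t *.
have pp : 0 < p by apply: lt_le_trans e1t; rewrite !mulr_gt0 ?expR_gt0.
rewrite (_ : hexp lam t = 1 - p); last by rewrite /p; ring.
move=> h; rewrite -(ler_pM2l pp) mulrDr.
have : C * t ^+ 2 <= p * (C / (lam * expR (- lam)) * t).
  apply: le_trans (ler_wpM2r _ e1t); last first.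
    by rewrite mulr_ge0 ?(ltW t0)// divr_ge0// mulr_ge0 ?expR_ge0// ltW.
  rewrite le_eqVlt; apply/orP; left; apply/eqP; field.
  by rewrite !gt_eqF ?expR_gt0.
have -> : p * (steady_profit / lam) = steady_profit * (p / lam) by ring.
by lra.
Qed.

(** Along the Dirac mass at [s], [V0] lies above the payoff of [u], with slope [eta * rho s] up to a
    quadratic error, and below a line of slope [xi s]. By [V0_short_time] the two bounds touch at
    [th = 0]; both signs of [th] are allowed, so the slopes agree. *)
Lemma superdifferential_costate s : ages M s -> xi s = eta * rho s.
Proof.
move=> As; have dw := eval_dual (M := M) sb_ge0 As; have [_ fin hV] := dxi.
have [C hC] := payoff_steady_ge dw.
have key (th : R) : th * (eta * rho s - xi s) <= C * th ^+ 2.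
  have dy := dual_comb th dw dx.
  have := le_trans (hC th) (le_trans (payoff_le_V0 _ au) (hV _ dy)).
  rewrite -(fineK fin) -EFinD lee_fin; have := V0_short_time; lra.
(* For this [th] the quadratic term is strictly below the linear one unless the slopes coincide. *)
have := key ((eta * rho s - xi s) / (`|C| + 1)).
have C1 : 0 < `|C| + 1 by rewrite ltr_wpDl.
set d := eta * rho s - xi s => h.
have {}h : d ^+ 2 * (`|C| + 1) <= d ^+ 2 * C.
  move: h; rewrite -(ler_pM2r (exprn_gt0 2 C1)).
  have -> : d / (`|C| + 1) * d * (`|C| + 1) ^+ 2 = d ^+ 2 * (`|C| + 1).
    by field; rewrite gt_eqF.
  by have -> : C * (d / (`|C| + 1)) ^+ 2 * (`|C| + 1) ^+ 2 = d ^+ 2 * C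
    by field; rewrite gt_eqF.
have d2 : d ^+ 2 <= 0.
  have : d ^+ 2 * C <= d ^+ 2 * `|C| by rewrite ler_wpM2l ?sqr_ge0// ler_norm.
  lra.
have : d ^+ 2 == 0 by rewrite eq_le d2 sqr_ge0.
by rewrite sqrf_eq0 /d subr_eq0 => /eqP ->.
Qed.

End short_time.

End lq_payoff_bounds.

(** Measurability is available for [g] alone: [f] is squeezed between the two functions that equal
    [g] off a null set and [-oo] or [+oo] on it. *)
Lemma ae_eq_integral_l d (T : measurableType d) (R : realType)
    (m : {measure set T -> \bar R}) (D : set T) (f g : T -> \bar R) :
  measurable D -> measurable_fun D g -> {ae m, forall t, D t -> f t = g t} ->
  (\int[m]_(t in D) f t = \int[m]_(t in D) g t)%E.
Proof.
move=> mD mg [N [mN N0 fgN]]; rewrite integral_mkcond [RHS]integral_mkcond.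
have {}mg : measurable_fun setT (g \_ D) by exact/(measurable_restrictT _ _).1.
have mN' : measurable_fun setT (fun t => t \in N).
  apply: (measurable_fun_bool true) => //; rewrite setTI.
  by rewrite (_ : _ @^-1` _ = N)//; apply/seteqP; split=> t; rewrite /= -[_ = true]/(is_true _) inE.
pose G c t := if t \in N then c else (g \_ D) t.
have mG c : measurable_fun setT (G c) by exact: measurable_fun_ifT.
have eG c : (\int[m]_t G c t = \int[m]_t (g \_ D) t)%E.
  apply: ae_eq_integral => //; exists N; split=> // t /= /existsNP[_].
  by rewrite /G; case: ifPn => // /set_mem.
have fG t : t \notin N -> (f \_ D) t = (g \_ D) t.
  move=> nN; rewrite !patchE; case: ifPn => // /set_mem Dt.
  apply/eqP; apply/negPn/negP => /eqP fg; move/negP: nN; apply.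
  by apply/mem_set/fgN => /= h; apply: fg; exact: h.
apply/eqP; rewrite eq_le -{1}(eG +oo%E) -(eG -oo%E).
apply/andP; split; apply: le_integral_pointwise => t _; rewrite /G.
  by case: ifPn => [_|/fG -> //]; exact: leey.
by case: ifPn => [_|/fG -> //]; exact: leNye.
Qed.

(** [v1] stands for the feedback [conjugate' (cost1 M s) (xi s)], which is made explicit only where
    [eps <= beta1 s] and so comes without measurability. *)
Lemma stationary_state_ae_l (R : realType) (M : vintage_model R) u0 (u1 v1 : R -> R) s :
  measurable_fun (ages M) u1 -> ae_ages M (fun x => v1 x = u1 x) -> ages M s ->
  stationary_state M u0 v1 s = stationary_state M u0 u1 s.
Proof.
move=> m1 e [s0 ss]; congr (_ + fine _); apply: ae_eq_integral_l => //.
  apply/measurable_EFinP; apply: measurable_funM.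
    apply: measurableT_comp => //; apply: measurable_funM => //.
    exact: measurable_funB.
  apply: measurable_funS m1 => //.
    by apply: measurable_ages; apply: le_trans ss; rewrite lee_fin.
  by move=> x /=; rewrite in_itv/= => /andP[x0 xs]; split=> //; apply: le_trans ss.
apply: aeS e => x h; rewrite /= in_itv/= => /andP[x0 xs]; rewrite h//.
by split=> //; apply: le_trans ss.
Qed.

(* The last three claims need 0 < lam: for lam <= 0 a nonzero constant control
   is not in L^2_lam and V0 may be infinite. Uniqueness of the CLE-equilibrium
   point needs uniqueness of eta: with alpha of variable sign, c1 may be
   negative and distinct solutions eta then give distinct CLE-equilibria. *)
Theorem corollary5p7 (R : realType) (sb : \bar R) (mu lam : R)
    (Rev alpha : R -> R) (beta0 q0 eps : R) (beta1 q1 : R -> R) :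
  let M := lq_model sb mu lam Rev alpha beta0 q0 beta1 q1 in
  (0 <= sb)%E -> 0 < mu -> - mu < lam ->
  model_assumptions M ->
  0 < eps -> eps <= beta0 ->
  Lp_ages M +oo%E beta1 -> ae_ages M (fun s => eps <= beta1 s) ->
  0 <= q0 -> Lp_ages M 2%:E q1 ->
  let W1 := w1 M beta0 beta1 in
  let W2 := w2 M beta0 q0 beta1 q1 in
  let c1 := pair_ages M alpha W1 in
  let c2 := pair_ages M alpha W2 in
  forall (xbar zetabar : R -> R) (u0bar : R) (u1bar : R -> R),
  measurable_fun (ages M) xbar -> measurable_fun (ages M) u1bar ->
  (MP_equilibrium M xbar zetabar (u0bar, u1bar) <->
   exists eta : R,
     [/\ eta = derive1 Rev (eta * c1 - c2),
         ae_ages M (fun s => xbar s = - W2 s + eta * W1 s),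
         forall s, ages M s ->
           zetabar s = derive1 Rev (pair_ages M alpha xbar) * alpha_bar M s,
         u0bar = (zetabar 0 - q0) / (2 * beta0) &
         ae_ages M
           (fun s => u1bar s = (zetabar s - q1 s) / (2 * beta1 s))]) /\
  (0 < lam -> MP_equilibrium M xbar zetabar (u0bar, u1bar) ->
   [/\ optimal M (pivot M xbar) (fun=> (u0bar, u1bar)),
       CLE_equilibrium M xbar &
       frechet_differentiable_V0 M ->
       (forall eta eta' : R, eta = derive1 Rev (eta * c1 - c2) ->
          eta' = derive1 Rev (eta' * c1 - c2) -> eta = eta') ->
       forall y, CLE_equilibrium M y -> ae_ages M (fun s => y s = xbar s)]).
Proof.
move=> M sb0 mu0 lam_mu [[Rev_d _ Rev_c Rev_l V_alpha] _ _ _] eps0 eps_b b1fin eps_b1 _ Lq1.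
move=> W1 W2 c1 c2 x zeta u0 u1 mx mu1.
have Rd (r : R) : derivable Rev r 1 by exact: Rev_d.
have MPE : MP_equilibrium M x zeta (u0, u1) <-> _ :=
  MP_equilibriumP sb0 mu0 lam_mu V_alpha eps0 eps_b b1fin eps_b1 Lq1 zeta u0 mx mu1.
have cost0E p : conjugate' (fun r => beta0 * r ^+ 2 + q0 * r) p = (p - q0) / (2 * beta0).
  exact: (conjugate'_cost0 sb mu lam Rev alpha q0 beta1 q1 eps0 eps_b).
split=> // lam0 MP; have A0 : ages M 0 by exact: ages0.
have [[/Lp2P lx _ /Lp2P lu] [ex ez _ _]] := MP.
have [eta [eeta ex' _ eu0 eu1]] := MPE.1 MP.
pose rho := Res (mu + lam) (ext M alpha).
have zrho s : ages M s -> zeta s = derive1 Rev (pair_ages M alpha x) * rho s.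
  by move=> As; rewrite ez// (alpha_barE As).
have {}ex' : ae_ages M (fun s => x s = eta * W1 s + - W2 s).
  by apply: aeS ex' => s h As; rewrite h// addrC.
have e0 : u0 = (derive1 Rev (pair_ages M alpha x) * rho 0 - q0) / (2 * beta0).
  by rewrite eu0 zrho.
have e1 : ae_ages M (fun s => u1 s =
    (derive1 Rev (pair_ages M alpha x) * rho s - q1 s) / (2 * beta1 s)).
  by apply: aeS eu1 => s h As; rewrite h// zrho.
have V_rho : V M rho by apply: (V_Res (M := M)) => //; exact: addr_gt0.
have V_zeta : V M zeta.
  apply: (V_eq (M := M)) (VZ (M := M) sb0 (derive1 Rev (pair_ages M alpha x)) V_rho) => //.
  by move=> s As; rewrite zrho.
split.
- exact: (optimal_steady sb0 mu0 lam0 V_alpha eps0 eps_b b1fin eps_b1 Lq1 Rd Rev_c lu lx ex e0 e1).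
- split; first exact/Lp2P.
  exists zeta; first exact: (superdifferential_steady sb0 mu0 lam0 V_alpha eps0
    eps_b b1fin eps_b1 Lq1 Rd Rev_c lu lx ex e0 e1 V_zeta zrho).
  have eu1' : ae_ages M (fun s => conjugate' (cost1 M s) (zeta s) = u1 s).
    apply: aeS (aeI eu1 (conjugate'_cost1 eps0 eps_b1 zeta)) => s [h1 h2] As.
    by rewrite h1// -h2.
  apply: aeS ex => s h As; rewrite h//= cost0E -eu0.
  exact/esym/stationary_state_ae_l.
move=> _ eta_unique y [/Lp2P ly [xi dxi ey]].
pose p0 := (xi 0 - q0) / (2 * beta0).
pose p1 s := (xi s - q1 s) / (2 * beta1 s).
have V_xi : V M xi by case: dxi.
have lp : L2 (@lebesgue_measure R) (ext M p1).
  apply: (L2_div_beta1 eps0 b1fin eps_b1); rewrite (_ : ext _ _ = fun s => ext M xi s - ext M q1 s).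
    by apply: L2B; [exact: V_L2|exact/Lp2P].
  by apply/funext => s; rewrite extB.
have {}ey : ae_ages M (fun s => y s = stationary_state M p0 p1 s).
  apply: aeS ey => s h As; rewrite h//= cost0E.
  apply: stationary_state_ae_l => //; first by apply/(measurable_ext (M := M)) => //; case: lp.
  exact: (conjugate'_cost1 eps0 eps_b1 xi).
have ep : ae_ages M (fun s => p1 s = (xi s - q1 s) / (2 * beta1 s)) by exact: aeT.
have exi := superdifferential_costate sb0 mu0 lam0 V_alpha eps0
    eps_b b1fin eps_b1 Lq1 Rd Rev_c Rev_l lp ly ey dxi erefl ep.
set eta' := derive1 Rev (pair_ages M alpha y) in exi.
(* Since [xi = eta' * rho], its feedback is that of the maximum principle: [y] lies on the same
   affine line as [x], and pairing with [alpha] makes [eta'] a solution of the scalar equation. *)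
have ey' : ae_ages M (fun s => y s = eta' * W1 s + - W2 s).
  apply: aeS ey => s h As; rewrite h// /p0 exi// -(alpha_barE A0).
  apply: (stationary_lq sb0 mu0 lam_mu V_alpha eps0 b1fin eps_b1 Lq1) => //.
  by apply: aeT => r Ar; rewrite /p1 exi// -(alpha_barE Ar).
have my : measurable_fun (ages M) y by apply/(measurable_ext (M := M)) => //; case: ly.
have [_ py] := pair_lq sb0 mu0 lam_mu V_alpha eps0 b1fin eps_b1 Lq1 my ey'.
have ee : eta = eta' by apply: eta_unique => //; rewrite -py.
by apply: aeS (aeI ex' ey') => s [h1 h2] As; rewrite h1// h2// ee.
Qed.
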